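(* There is an algorithm which, given a finite field $\mathbb{F}_q$ of odd characteristic and a set $f_1,\ldots,f_r$ of $r\ge 2$ (distinct) monic quadratic polynomials over $\mathbb{F}_q$, decides whether or not the set $f_1,\ldots,f_r$ is dynamically-irreducible, which takes $O(r(\log q)^3q^{1/2})$ operations, and requires $O((\log q)^2q^{1/2})$ storage locations. The implied constants are absolute.
   Context: A set of polynomials $f_1,\ldots,f_r$ of positive degree over a finite field $\mathbb{F}_q$ is called dynamically-irreducible if all polynomials formed by composition of $f_1,\ldots,f_r$, i.e. all $f_{i_1}\circ f_{i_2}\circ\cdots\circ f_{i_n}$ with $n\ge 1$ and $i_1,\ldots,i_n\in\{1,\ldots,r\}$ (repetitions allowed), are irreducible over $\mathbb{F}_q$. Computational conventions: each polynomial is given as $f_i(X)=(X-b_i)^2+c_i$ with $b_i,c_i\in\mathbb{F}_q$. The elements of $\mathbb{F}_q$ are assumed to be described in such a way that a total ordering can be imposed on them (for example lexicographic order on coordinates with respect to a power basis over $\mathbb{F}_p$). An operation is a field operation in $\mathbb{F}_q$, a comparison of two elements of $\mathbb{F}_q$ in this ordering, or an elementary memory access or pointer manipulation. One storage location holds one element of $\mathbb{F}_q$ (or a pointer), and the storage bound refers to working memory, not counting the input $f_1,\ldots,f_r$. *)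

(* Defs.v *)
From mathcomp Require Import all_boot all_order all_algebra.
Set Implicit Arguments.
Unset Strict Implicit.
Unset Printing Implicit Defensive.
Import GRing.Theory.
Local Open Scope ring_scope.

Definition comp_along (F : fieldType) (I : Type) (f : I -> {poly F})
    (s : seq I) : {poly F} :=
  foldr (fun i g => f i \Po g) 'X s.

Definition dynamically_irreducible (F : fieldType) (I : Type)
    (f : I -> {poly F}) : Prop :=
  forall (i : I) (s : seq I), irreducible_poly (comp_along f (i :: s)).

Definition quadratic (F : fieldType) (b c : F) : {poly F} :=
  ('X - b%:P) ^+ 2 + c%:P.

(** * A random access machine over a finite field

    The machine has k field registers and k pointer registers, a read-only
    input, and an addressable working memory of which each location holds
    either a field element or a pointer.  A program is a finite piece of
    syntax, independent of the field and of the input.  The only access it has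
    to field elements is through the field operations and through comparisons
    in a given ordering: there is no conversion between field elements and
    pointers. *)

Inductive instr (k : nat) : Type :=
  (* field registers: first argument := ... *)
  | FZero of 'I_k
  | FOne of 'I_k
  | FCopy of 'I_k & 'I_k
  | FAdd of 'I_k & 'I_k & 'I_k
  | FSub of 'I_k & 'I_k & 'I_k
  | FMul of 'I_k & 'I_k & 'I_k
  | FDiv of 'I_k & 'I_k & 'I_k
  (* working memory at the address held in a pointer register; in the store
     instructions the address register comes first *)
  | FLoad of 'I_k & 'I_k
  | FStore of 'I_k & 'I_k
  | PLoad of 'I_k & 'I_k
  | PStore of 'I_k & 'I_k
  (* input: coefficients b_i and c_i (i held in a pointer register), the
     number r of polynomials, and the cardinality q of the field *)
  | InB of 'I_k & 'I_k
  | InC of 'I_k & 'I_k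
  | InR of 'I_k
  | InQ of 'I_k
  (* pointer registers: first argument := ... *)
  | PConst of 'I_k & nat
  | PCopy of 'I_k & 'I_k
  | PAdd of 'I_k & 'I_k & 'I_k
  | PSub of 'I_k & 'I_k & 'I_k.

Inductive test (k : nat) : Type :=
  | FEq of 'I_k & 'I_k
  | FLe of 'I_k & 'I_k
  | PEq of 'I_k & 'I_k
  | PLe of 'I_k & 'I_k.

Inductive prog (k : nat) : Type :=
  | Skip
  | Do of instr k
  | Seq of prog k & prog k
  | If of test k & prog k & prog k
  | While of test k & prog k.

Arguments Skip {k}.

Record state (k : nat) (F : Type) : Type := State {
  freg : 'I_k -> F;
  preg : 'I_k -> nat;
  mem : nat -> F + nat
}.

Definition init_state (k : nat) (F : finFieldType) : state k F :=
  State (fun=> 0) (fun=> 0%N) (fun=> inr 0%N).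

Section Machine.

(* le  : the ordering of the field used by comparisons
   b c : the input polynomials (X - b_i)^2 + c_i
   M   : number of working memory locations, with addresses 0, ..., M - 1
   W   : strict upper bound on the pointers; it keeps unit-cost pointer
         addition from computing with huge integers
   An instruction that would use an address or an input index out of range,
   produce a pointer that is not smaller than W, or load a value of the wrong
   sort, is stuck (result None). *)
Context (k : nat) (F : finFieldType) (le : rel F) (r : nat) (b c : 'I_r -> F).
Context (M W : nat).

Definition set_freg (s : state k F) (x : 'I_k) (v : F) : option (state k F) :=
  Some (State [eta freg s with x |-> v] (preg s) (mem s)).

Definition set_preg (s : state k F) (a : 'I_k) (n : nat) :
    option (state k F) :=
  if (n < W)%N then Some (State (freg s) [eta preg s with a |-> n] (mem s))
  else None.

Definition load (s : state k F) (n : nat) : option (F + nat) :=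
  if (n < M)%N then Some (mem s n) else None.

Definition store (s : state k F) (n : nat) (v : F + nat) :
    option (state k F) :=
  if (n < M)%N then Some (State (freg s) (preg s) [eta mem s with n |-> v])
  else None.

Definition input (g : 'I_r -> F) (n : nat) : option F :=
  omap g (insub n).

Definition step (e : instr k) (s : state k F) : option (state k F) :=
  match e with
  | FZero x => set_freg s x 0
  | FOne x => set_freg s x 1
  | FCopy x y => set_freg s x (freg s y)
  | FAdd x y z => set_freg s x (freg s y + freg s z)
  | FSub x y z => set_freg s x (freg s y - freg s z)
  | FMul x y z => set_freg s x (freg s y * freg s z)
  | FDiv x y z => set_freg s x (freg s y / freg s z)
  | FLoad x a => if load s (preg s a) is Some (inl v) then set_freg s x v
                 else None
  | FStore a x => store s (preg s a) (inl (freg s x))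
  | PLoad d a => if load s (preg s a) is Some (inr n) then set_preg s d n
                 else None
  | PStore a d => store s (preg s a) (inr (preg s d))
  | InB x a => if input b (preg s a) is Some v then set_freg s x v else None
  | InC x a => if input c (preg s a) is Some v then set_freg s x v else None
  | InR a => set_preg s a r
  | InQ a => set_preg s a #|F|
  | PConst a n => set_preg s a n
  | PCopy a d => set_preg s a (preg s d)
  | PAdd a d d' => set_preg s a (preg s d + preg s d')
  | PSub a d d' => set_preg s a (preg s d - preg s d')
  end.

Definition holds (t : test k) (s : state k F) : bool :=
  match t with
  | FEq x y => freg s x == freg s y
  | FLe x y => le (freg s x) (freg s y)
  | PEq a d => preg s a == preg s d
  | PLe a d => (preg s a <= preg s d)%N
  end.

(* [exec p s n s'] : started in s, the program p halts in s' after n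
   operations; every instruction and every evaluation of a test is one
   operation. *)
Inductive exec : prog k -> state k F -> nat -> state k F -> Prop :=
  | ExecSkip s : exec Skip s 0 s
  | ExecDo e s s' : step e s = Some s' -> exec (Do e) s 1 s'
  | ExecSeq p1 p2 s n1 s1 n2 s2 :
      exec p1 s n1 s1 -> exec p2 s1 n2 s2 -> exec (Seq p1 p2) s (n1 + n2) s2
  | ExecIfTrue t p1 p2 s n s' :
      holds t s -> exec p1 s n s' -> exec (If t p1 p2) s n.+1 s'
  | ExecIfFalse t p1 p2 s n s' :
      ~~ holds t s -> exec p2 s n s' -> exec (If t p1 p2) s n.+1 s'
  | ExecWhileTrue t p s n1 s1 n2 s2 :
      holds t s -> exec p s n1 s1 -> exec (While t p) s1 n2 s2 ->
      exec (While t p) s (n1 + n2).+1 s2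
  | ExecWhileFalse t p s :
      ~~ holds t s -> exec (While t p) s 1 s.

End Machine.

(* Started on the input (b, c), the program P halts after n operations with the
   truth value of [claim] in pointer register 0 (1 for true, 0 for false),
   using m storage locations: all its registers and M memory locations. *)
Definition decides_with (k : nat) (P : prog k.+1) (F : finFieldType)
    (le : rel F) (r : nat) (b c : 'I_r -> F) (W : nat) (claim : Prop)
    (n m : nat) : Prop :=
  exists (M : nat) (s : state k.+1 F) (ans : bool),
    [/\ exec le b c M W P (init_state k.+1 F) n s,
        preg s ord0 = ans :> nat,
        ans <-> claim
      & m = (k.+1 + k.+1 + M)%N].

(* Main.v *)
(** For a monic irreducible [g] of even degree over a field of odd order,
    [g (X ^ 2)] is irreducible if and only if [g 0] is not a square; after a
    translation, [g ((X - b) ^ 2 + c)] is irreducible if and only if [g c] is not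
    a square.  Hence the [f_i] are dynamically irreducible if and only if no
    [- c_i] is a square and no [f_i u] is, where [u] ranges over the orbit of the
    [c_j] under the [f_i].

    Dynamical irreducibility forces the orbit to be small.  Let
    [2 ^ N >= log q].  The [2 ^ N] compositions of length [N] of two of the [f_i]
    are distinct irreducible polynomials which take only nonsquare values on the
    orbit.  Expanding the product of the [1 - chi (G u)] over these compositions
    [G] and summing over [u] in [F], Weil's bound, obtained by Stepanov's method
    with a worse constant, shows that the orbit has [O((log q) ^ 2 sqrt q)]
    elements.

    The algorithm explores the orbit breadth first, testing each new value with
    Euler's criterion, and answers negatively when a square occurs or when the
    orbit exceeds this bound.  The elements already met are kept in a
    balanced search tree, so that a membership test takes [O(log q)]
    operations. *)

Require Import Defs.
From mathcomp Require Import all_boot all_order all_algebra all_fingroup all_solvable all_field.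
From mathcomp Require Import zify ring boolp reals exp.
Set Implicit Arguments.
Unset Strict Implicit.
Unset Printing Implicit Defensive.
Import Order.TTheory GRing.Theory Num.Theory.
Local Open Scope ring_scope.

(** * Irreducibility of compositions with quadratics *)

(** Two of the [f_i] suffice for the orbit bound, which is why it does not depend on [r]. A product
    of [G] over a nonempty set of words is squarefree of positive degree, never a constant times a
    square, so its character sum is small. Each point of the orbit counts [2 ^ (2 ^ N)] times in the
    sum of the products of the [1 - chi (G u)]; the empty set of words contributes [q] to the
    expansion, every other set a multiple of [4 ^ N * sqrt q]. After division by [2 ^ (2 ^ N) >= q]
    there remains 1 plus this error, and [2 ^ N <= 2 * log q] yields the square of the logarithm.

    The machine cannot turn a field element into an address, so visited elements cannot be marked in
    an array and only comparisons can recognise them. Each of [O((log q) ^ 2 sqrt q)] nodes has [r]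
    images, each costing [O(log q)] for Euler's criterion and the tree. A negative answer does not
    stop the search: the capacity of the tree alone bounds the time. *)

Definition is_square (F : finFieldType) (x : F) : bool := [exists y, y ^+ 2 == x].

Lemma is_squareP (F : finFieldType) (x : F) :
  reflect (exists y, y ^+ 2 = x) (is_square x).
Proof. by apply: (iffP existsP) => -[y hy]; exists y; apply/eqP. Qed.

Lemma is_square0 (F : finFieldType) : is_square (0 : F).
Proof. by apply/is_squareP; exists 0; rewrite expr0n. Qed.

Lemma oddF_pred (F : finFieldType) : odd #|F| -> #|F| = (#|F|./2).*2.+1.
Proof. by move=> oF; rewrite -[LHS]odd_double_half oF. Qed.

Lemma expf_card_pred (F : finFieldType) (x : F) : x != 0 -> x ^+ #|F|.-1 = 1.
Proof.
move=> x0; apply: (mulIf x0); rewrite mul1r -exprSr prednK ?expf_card //.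
by apply/card_gt0P; exists 0.
Qed.

(** The unit group is cyclic: [x = w ^+ k] with [w] of order [q - 1], and the power is 1 exactly
    when [k] is even. *)
Lemma euler_criterion (F : finFieldType) (x : F) :
  odd #|F| -> x != 0 -> is_square x = (x ^+ #|F|./2 == 1).
Proof.
move=> oF x0; have eF := oddF_pred oF.
apply/is_squareP/eqP => [[y hy]|hx].
  rewrite -hy -exprM mul2n; suff -> : (#|F|./2).*2 = #|F|.-1.
    by rewrite expf_card_pred //; apply: contraNneq x0 => y0; rewrite -hy y0 expr0n.
  by rewrite {2}eF.
have /cyclicP[w hw] := field_unit_group_cyclic [set: {unit F}]%G.
have ux : x \is a GRing.unit by rewrite unitfE.
have : (Sub x ux : {unit F}) \in <[w]>%g by rewrite -hw inE.
case/cycleP=> k hk.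
have ew : #[w]%g = (#|F|./2).*2 by rewrite /order -hw card_finField_unit {1}eF.
have xw : x = FinRing.uval w ^+ k by rewrite -FinRing.val_unitX -hk.
have : (w ^+ (k * #|F|./2) = 1)%g.
  by apply/val_inj; rewrite /= FinRing.val_unitX /= exprM -xw.
move/eqP; rewrite -order_dvdn ew -mul2n dvdn_pmul2r; last first.
  by have := finNzRing_gt1 F; rewrite eF; lia.
case/dvdnP=> j hj; exists (FinRing.uval w ^+ j).
by rewrite xw hj exprM.
Qed.

(** This covers [x = 0], where both sides are false; the program can thus compare a single power
    with [-1], without a test for zero. *)
Lemma euler_nonsquare (F : finFieldType) (x : F) :
  odd #|F| -> ~~ is_square x = (x ^+ #|F|./2 == -1).
Proof.
move=> oF; have eF := oddF_pred oF.
have F2 : (1 : F) != -1.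
  apply/eqP=> h.
  have h2 : 2%N \in [pchar F].
    by rewrite inE /= mulr2n {2}h subrr.
  have := pprimeChar_pgroup h2.
  rewrite /pgroup cardsT => /p_natP[[|n] /= hn].
    by have := finNzRing_gt1 F; rewrite hn.
  by move: oF; rewrite hn oddX.
have [->|x0] := eqVneq x 0.
  rewrite is_square0 expr0n; case: #|F|./2 eF (finNzRing_gt1 F) => [->//|n _ _] /=.
  by rewrite eq_sym oppr_eq0 oner_eq0.
rewrite euler_criterion //.
have : (x ^+ #|F|./2) ^+ 2 = 1.
  by rewrite -exprM muln2 -[RHS](expf_card_pred x0) {2}eF.
move/eqP; rewrite sqrf_eq1 => /orP[/eqP ->|/eqP ->].
  by rewrite eqxx; apply/esym/negbTE.
by rewrite eqxx eq_sym F2.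
Qed.

(* [sqr_norm p] at [X ^ 2] is the norm of [p] from [F(X)] to [F(X ^ 2)]. *)
Definition sqr_norm (F : fieldType) (p : {poly F}) : {poly F} :=
  even_poly p ^+ 2 - 'X * odd_poly p ^+ 2.

Lemma sqr_normE (F : fieldType) (p : {poly F}) :
  sqr_norm p \Po 'X^2 = p * (p \Po - 'X).
Proof.
have e2 : 'X^2 \Po (- 'X) = 'X^2 :> {poly F} by rewrite comp_Xn_poly sqrrN.
rewrite -{2 3}(poly_even_odd p) /sqr_norm !(comp_polyD, comp_polyM).
rewrite -!comp_polyA e2 comp_polyX rmorphN rmorphM !rmorphXn /= comp_polyX.
ring.
Qed.

Lemma comp_Xsqr_inj (F : fieldType) (p q : {poly F}) :
  p \Po 'X^2 = q \Po 'X^2 -> p = q.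
Proof.
move/eqP; rewrite -subr_eq0 -rmorphB /= comp_poly_eq0 ?size_polyXn // subr_eq0.
by move/eqP.
Qed.

Lemma size_sqr_norm (F : fieldType) (p : {poly F}) :
  size (sqr_norm p) = size p.
Proof.
have [->|p0] := eqVneq p 0.
  by rewrite /sqr_norm even_polyC odd_polyC expr0n /= mulr0 subr0 size_poly0.
have sX : size (- 'X : {poly F}) = 2%N by rewrite size_polyN size_polyX.
have q0 : p \Po - 'X != 0 by rewrite comp_poly2_eq0.
have n0 : sqr_norm p != 0.
  rewrite -(comp_poly_eq0 _ (q := 'X^2)) ?size_polyXn // sqr_normE mulf_neq0 //.
have := size_comp_poly (sqr_norm p) 'X^2.
rewrite sqr_normE size_mul // size_comp_poly2 // size_polyXn /=.
move: p0 n0; rewrite -!size_poly_gt0.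
case: (size p) => [|a] //; case: (size (sqr_norm _)) => [|b] // _ _.
by rewrite addSn addnS /= addnn -muln2 => /eqP; rewrite eqn_mul2r /= => /eqP ->.
Qed.

(** In even degree [p] and [p (- X)] have the same leading coefficient; in odd degree a sign would
    spoil the square. *)
Lemma lead_sqr_norm (F : fieldType) (p : {poly F}) :
  odd (size p) -> lead_coef (sqr_norm p) = lead_coef p ^+ 2.
Proof.
move=> os.
have := lead_coef_comp (sqr_norm p) (q := 'X^2).
rewrite size_polyXn lead_coefXn expr1n mulr1 => <- //.
rewrite sqr_normE lead_coefM lead_coef_comp ?size_polyN ?size_polyX //.
rewrite lead_coefN lead_coefX -signr_odd; case: (size p) os => //= n /negbTE ->.
by rewrite expr0 mulr1 expr2.
Qed.

Lemma irreducible_comp_sqr (F : finFieldType) (g : {poly F}) :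
  g \is monic -> irreducible_poly g -> odd (size g) -> ~~ is_square g.[0] ->
  irreducible_poly (g \Po 'X^2).
Proof.
move=> mg [sg ig] og ns.
have g0 : g != 0 by apply: monic_neq0.
have sgc : (size (g \Po 'X^2)).-1 = ((size g).-1 * 2)%N.
  by rewrite size_comp_poly size_polyXn.
have gc0 : g \Po 'X^2 != 0 by rewrite comp_poly_eq0 ?size_polyXn.
split; first by move: sg sgc; case: (size g) (size (_ \Po _)) => [|[|n]] // [|[|m]].
move=> P sP /dvdpP[Q hQ].
(* Taking norms in [g (X ^ 2) = Q * P]; if [g] divides both norms, then
   [sqr_norm P] is a multiple of [g], and its value at 0 is a square. *)
have hN : g ^+ 2 = sqr_norm Q * sqr_norm P.
  apply: comp_Xsqr_inj; rewrite rmorphXn [RHS]comp_polyM !sqr_normE /=.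
  rewrite mulrACA -hQ -comp_polyM -hQ -comp_polyA.
  by rewrite comp_Xn_poly sqrrN expr2.
have N0 : sqr_norm Q * sqr_norm P != 0 by rewrite -hN expf_neq0.
have sN : (size Q + size P = (size g).*2)%N.
  have := size_mul (p := sqr_norm Q) (q := sqr_norm P).
  rewrite -hN expr2 size_mul // !size_sqr_norm.
  move: N0; rewrite mulf_eq0 negb_or => /andP[h1 h2].
  move=> /(_ h1 h2); move: h1 h2; rewrite -!size_poly_gt0 !size_sqr_norm.
  by move: (size g) (size Q) (size P) sg; lia.
have irr : irreducible_poly g by split.
(* A factor of [g ^+ 2] that [g] does not divide is coprime to [g ^+ 2], hence constant. *)
have key (A B : {poly F}) : g ^+ 2 = A * B -> ~~ (g %| B) -> size B = 1%N.
  move=> hAB; rewrite -irreducible_poly_coprime // => cB.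
  have : B %| g ^+ 2 by rewrite hAB dvdp_mull.
  move=> h; have c2 : coprimep B (g ^+ 2) by rewrite coprimep_expr // coprimep_sym.
  by have := coprimep_dvdl h c2; rewrite coprimepp => /eqP.
have [gP|gP] := boolP (g %| sqr_norm P); last first.
  by have := key _ _ hN gP; rewrite size_sqr_norm => /eqP; rewrite (negbTE sP).
have [gQ|gQ] := boolP (g %| sqr_norm Q); last first.
  rewrite mulrC in hN; have := key _ _ hN gQ; rewrite size_sqr_norm => s1.
  rewrite -dvdp_size_eqp ?hQ ?dvdp_mull // -hQ; apply/eqP.
  move: sN sgc sg; rewrite s1; move: (size g) (size P) (size (g \Po _)) => a b c; lia.
move: N0; rewrite mulf_eq0 negb_or => /andP[h1 h2].
have := dvdp_leq h2 gP; have := dvdp_leq h1 gQ; rewrite !size_sqr_norm => l1 l2.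
have sPg : size P = size g by move: sN l1 l2; move: (size P) (size g) (size Q) => a b c; lia.
(* Both norms have at least the degree of [g], and together twice that degree. So [sqr_norm P] is
   [g] up to a scalar, which is the square of [lead_coef P] because [g] is monic. *)
have /eqpP[[c d] /= /andP[c0 d0] hcd] : g %= sqr_norm P.
  by rewrite -dvdp_size_eqp // size_sqr_norm sPg.
have lc : c = d * lead_coef P ^+ 2.
  rewrite -lead_sqr_norm ?sPg // -lead_coefZ -hcd lead_coefZ (monicP mg) mulr1 //.
have hx : (sqr_norm P).[0] = (even_poly P).[0] ^+ 2.
  by rewrite /sqr_norm hornerD hornerN ['X * _]mulrC hornerMX mulr0 oppr0 addr0 horner_exp.
have lP : lead_coef P != 0.
  rewrite lead_coef_eq0; apply: contraNneq h2 => ->.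
  by rewrite /sqr_norm even_polyC odd_polyC expr0n /= mulr0 subr0.
case/negP: ns; apply/is_squareP; exists ((even_poly P).[0] / lead_coef P).
have /(congr1 (fun p => p.[0])) := hcd; rewrite !hornerZ hx lc.
rewrite expr_div_n -mulrA => /(mulfI d0) <-.
by rewrite mulrAC mulfV ?mul1r // expf_neq0.
Qed.

Lemma card_pnat (F : finFieldType) (R : nzSemiRingType) (i : nat) :
  [pchar R] =i [pchar F] -> [pchar R].-nat (#|F| ^ i)%N.
Proof.
move=> hR; have [p pp pF] := finPcharP F.
have : p.-nat #|F| by rewrite -cardsT; apply: (pprimeChar_pgroup pF).
move=> hp; rewrite pnatX; apply/orP; left.
by apply: sub_in_pnat hp => j _ /eqP ->; rewrite hR.
Qed.

(** Frobenius fixes the coefficients. The target ring is general because two are used: the field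
    generated by a root of [g], and [{poly F}], where this becomes [f ^+ q = f (X ^ q)]. *)
Lemma horner_frobenius (F : finFieldType) (R : comNzRingType)
    (u : {rmorphism F -> R}) (p : {poly F}) (x : R) (i : nat) :
  [pchar R] =i [pchar F] ->
  (map_poly u p).[x] ^+ (#|F| ^ i) = (map_poly u p).[x ^+ (#|F| ^ i)].
Proof.
move=> hR.
have q0 : (#|F| ^ i)%N != 0%N.
  by rewrite -lt0n expn_gt0; apply/orP; left; apply/card_gt0P; exists 0.
elim/poly_ind: p => [|p c IH].
  by rewrite map_poly0 !horner0 expr0n (negbTE q0).
rewrite rmorphD rmorphM /= map_polyX map_polyC /= !hornerMXaddC.
rewrite exprDn_pchar ?card_pnat // exprMn IH -rmorphXn /=.
suff -> : c ^+ (#|F| ^ i) = c by [].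
by elim: i {q0 IH} => [|i IH]; rewrite ?expn0 ?expr1 // expnS exprM expf_card.
Qed.

(** * The field generated by a root of an irreducible polynomial *)

Section QuotientField.

Variables (F : finFieldType) (g : {poly F}) (hI : monic_irreducible_poly g).
Local Notation K := {poly %/ g with hI}.
Local Notation q := #|F|.
Let iota : {rmorphism F -> K} := qpolyC g.
Let alpha : K := in_qpoly g 'X.
Let n := (size g).-1.

Lemma size_irr_pred : size g = n.+1.
Proof. by rewrite /n; case: hI => -[]; case: (size g). Qed.

Lemma in_qpoly_horner (p : {poly F}) : in_qpoly g p = (map_poly iota p).[alpha] :> K.
Proof. by rewrite -[p in LHS]comp_polyXr; apply: in_qpoly_comp_horner. Qed.

Lemma pchar_quot : [pchar K] =i [pchar F].
Proof. exact: pchar_qpoly. Qed.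

Lemma in_qpoly_val (x : K) : x = in_qpoly g (val x).
Proof. by apply/val_inj; rewrite [RHS]in_qpoly_small // size_mk_monic. Qed.

Lemma in_qpoly_eq0 (p : {poly F}) : in_qpoly g p = 0 :> K <-> g %| p.
Proof.
have mk := mk_monicE hI.
split=> [/(congr1 val)/=|h]; [|apply/val_inj => /=].
  by rewrite -Pdiv.IdomainMonic.modpE ?monic_mk_monic // mk => /eqP.
by rewrite -Pdiv.IdomainMonic.modpE ?monic_mk_monic // mk; apply/eqP.
Qed.

Lemma root_alpha i : root (map_poly iota g) (alpha ^+ (q ^ i)).
Proof.
rewrite /root -horner_frobenius; last exact: pchar_quot.
rewrite -in_qpoly_horner (_ : in_qpoly g g = 0) ?expr0n; last by apply/in_qpoly_eq0.
by rewrite -leqn0 leqNgt expn_gt0 (ltnW (finNzRing_gt1 _)).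
Qed.

Lemma frob_inj i : injective (fun x : K => x ^+ (q ^ i)).
Proof.
move=> x y /= h.
have : (x - y) ^+ (q ^ i) = 0.
  apply: (addIr (y ^+ (q ^ i))); rewrite -exprDn_pchar ?subrK ?add0r //.
  by apply: card_pnat pchar_quot.
by move/eqP; rewrite expf_eq0 subr_eq0 => /andP[_ /eqP].
Qed.

(** Otherwise every element of [K], being a polynomial in [alpha], would be a root of
    [X ^ (q ^ d) - X], but [K] has [q ^ n] elements. *)
Lemma alpha_order d : (0 < d < n)%N -> alpha ^+ (q ^ d) != alpha.
Proof.
case/andP=> d0 dn; apply/eqP=> h.
have q1 := finNzRing_gt1 F.
have hK (x : K) : x ^+ (q ^ d) = x.
  rewrite (in_qpoly_val x) in_qpoly_horner horner_frobenius ?h //.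
  exact: pchar_quot.
have Q1 : (1 < q ^ d)%N by apply: leq_trans (ltn_expl _ _) => //; rewrite ltnS.
have sP : size ('X^(q ^ d) - 'X : {poly K}) = (q ^ d).+1.
  by rewrite size_polyDl ?size_polyXn // size_polyN size_polyX ltnS.
have := @max_poly_roots _ ('X^(q ^ d) - 'X : {poly K}) (enum K).
rewrite -size_poly_gt0 sP enum_uniq -cardE card_qfpoly -/n => /(_ isT) h2.
have : (q ^ n < (q ^ d).+1)%N.
  apply: h2 => //; apply/allP=> x _.
  by rewrite /root hornerD hornerXn hornerN hornerX hK subrr.
by rewrite ltnS leq_exp2l // leqNgt dn.
Qed.

(** The conjugates of [alpha] are roots; undoing the smaller power of Frobenius reduces their
    distinctness to [alpha_order], and there are as many as the degree. *)
Lemma map_poly_prod_frob :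
  map_poly iota g = \prod_(i < n) ('X - (alpha ^+ (q ^ i))%:P).
Proof.
have mg : map_poly iota g \is monic by rewrite map_monic; case: hI.
pose rs := [seq alpha ^+ (q ^ i) | i : 'I_n <- enum 'I_n].
have -> : \prod_(i < n) ('X - (alpha ^+ (q ^ i))%:P) = \prod_(z <- rs) ('X - z%:P).
  by rewrite big_map big_enum.
rewrite [LHS](@all_roots_prod_XsubC _ _ rs) ?(monicP mg) ?scale1r //.
- by rewrite size_map_poly size_map size_enum_ord size_irr_pred.
- by apply/allP=> _ /mapP[i _ ->]; apply: root_alpha.
rewrite uniq_rootsE map_inj_uniq ?enum_uniq // => i j.
wlog ij : i j / (i <= j)%N.
  by move=> h; case: (leqP i j) => [/h//|/ltnW ji /esym /(h _ _ ji)].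
move=> hij; apply/val_inj/eqP; rewrite /= eqn_leq ij leqNgt /=; apply/negP=> lij.
have d : (0 < j - i < n)%N.
  by rewrite subn_gt0 lij (leq_ltn_trans (leq_subr _ _) (ltn_ord j)).
have /negP[] := alpha_order d; apply/eqP/(@frob_inj i).
by rewrite /= -exprM -expnD subnK.
Qed.

Lemma alpha_neq0 : (2 < size g)%N -> alpha != 0.
Proof.
move=> sg; apply/eqP=> /in_qpoly_eq0 h.
by have := dvdp_leq (negbT (polyX_eq0 F)) h; rewrite size_polyX leqNgt sg.
Qed.

(* [g 0] is the norm of [alpha], because [n] is even, and
   [alpha ^+ ((q ^ n - 1) / 2)] is the norm raised to the power [(q - 1) / 2]. *)
Lemma alpha_square : odd q -> odd (size g) -> (2 < size g)%N ->
  is_square g.[0] -> is_square alpha.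
Proof.
move=> oq og sg /is_squareP[t ht].
have eq := oddF_pred oq.
have en : ~~ odd n by rewrite /n; case: (size g) og sg => //=.
have oK : odd #|K| by rewrite card_qfpoly oddX oq orbT.
rewrite euler_criterion //; last exact: alpha_neq0.
(* The exponent of the norm, [(q ^ n - 1) / (q - 1)]. *)
pose S := (\sum_(i < n) q ^ i)%N.
have hS : iota t ^+ 2 = alpha ^+ S.
  rewrite -rmorphXn /= ht -(horner_map iota g 0) rmorph0 map_poly_prod_frob.
  rewrite horner_prod (eq_bigr (fun i : 'I_n => - alpha ^+ (q ^ i))); last first.
    by move=> i _; rewrite hornerXsubC sub0r.
  rewrite prodrN card_ord -signr_odd (negbTE en) expr0 mul1r.
  by rewrite /S (big_morph _ (exprD alpha) (expr0 _)).
have hN : #|K|./2 = (S * q./2)%N.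
  have : (#|K|./2).*2.+1 = (S * (q./2).*2).+1.
    rewrite -(oddF_pred oK) card_qfpoly -/n.
    rewrite [X in (_ * X)%N](_ : _ = q.-1); last by rewrite {2}eq.
    by rewrite mulnC -predn_exp prednK // expn_gt0 eq.
  by move=> [] h; apply: double_inj; rewrite h doubleMr.
rewrite hN exprM -hS -exprM mul2n; apply/eqP.
rewrite (_ : (q./2).*2 = q.-1); last by rewrite {2}eq.
rewrite -rmorphXn /= expf_card_pred ?rmorph1 //.
apply/eqP=> t0; move: hS; rewrite t0 rmorph0 expr0n /= => /esym/eqP.
by rewrite expf_eq0 (negbTE (alpha_neq0 sg)) andbF.
Qed.

End QuotientField.

Lemma reducible_comp_sqr (F : finFieldType) (g : {poly F}) :
  odd #|F| -> g \is monic -> irreducible_poly g -> odd (size g) ->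
  is_square g.[0] -> ~ irreducible_poly (g \Po 'X^2).
Proof.
move=> oq mg ig og sq irr.
have hI : monic_irreducible_poly g by split.
have sg : (2 < size g)%N by case: ig => + _; case: (size g) og => [|[|[]]].
have /is_squareP[y hy] := alpha_square hI oq og sg sq.
pose h := val y : {poly F}.
(* [alpha = h ^+ 2] in the quotient gives [g (X ^ 2) %| (X - k) * (X + k)] with [k]
   even; whichever factor it divides, it then divides [2 X]. *)
have : g %| 'X - h ^+ 2.
  apply/(in_qpoly_eq0 hI); rewrite rmorphB rmorphXn /= -/h.
  by rewrite -(in_qpoly_val y) hy subrr.
move/(dvdp_comp_poly 'X^2).
rewrite rmorphB rmorphXn /= comp_polyX.
pose k := h \Po 'X^2; rewrite -/k subr_sqr => hP.
have ke : k \Po - 'X = k by rewrite /k -comp_polyA comp_Xn_poly sqrrN.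
have ge : (g \Po 'X^2) \Po - 'X = g \Po 'X^2 by rewrite -comp_polyA comp_Xn_poly sqrrN.
have s2 : size ('X *+ 2 : {poly F}) = 2%N.
  rewrite -scaler_nat size_scale ?size_polyX //.
  apply/eqP=> h2; have h2' : 2%N \in [pchar F] by rewrite inE /= h2.
  have := pprimeChar_pgroup h2'.
  rewrite /pgroup cardsT => /p_natP[[|j] /= hn].
    by have := finNzRing_gt1 F; rewrite hn.
  by move: oq; rewrite hn oddX.
suff : g \Po 'X^2 %| 'X *+ 2.
  move/dvdp_leq; rewrite -size_poly_gt0 s2 => /(_ isT).
  have := size_comp_poly g 'X^2; rewrite size_polyXn /=.
  move: sg; case: (size g) => [|[|[|a]]] //; case: (size (g \Po _)) => [|[|[|b]]] //.
have [hd|hd] := boolP (g \Po 'X^2 %| 'X - k).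
  have := dvdp_comp_poly (- 'X) hd; rewrite ge rmorphB /= comp_polyX ke => hd2.
  have := dvdp_sub hd hd2; rewrite (_ : _ - _ - (_ - _) = 'X *+ 2) //; ring.
move: hP; rewrite Gauss_dvdpr ?irreducible_poly_coprime // => hd1.
have := dvdp_comp_poly (- 'X) hd1; rewrite ge rmorphD /= comp_polyX ke => hd2.
have := dvdp_sub hd1 hd2; rewrite (_ : _ + _ - (_ + _) = 'X *+ 2) //; ring.
Qed.

Lemma irreducible_comp_sqrP (F : finFieldType) (g : {poly F}) :
  odd #|F| -> g \is monic -> irreducible_poly g -> odd (size g) ->
  irreducible_poly (g \Po 'X^2) <-> ~~ is_square g.[0].
Proof.
move=> oq mg ig og; split; last exact: irreducible_comp_sqr.
by move=> irr; apply/negP=> /(reducible_comp_sqr oq mg ig og).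
Qed.

Lemma irreducible_comp_shift (F : fieldType) (p : {poly F}) (a : F) :
  irreducible_poly p -> irreducible_poly (p \Po ('X + a%:P)).
Proof.
have s2 (u : F) : size ('X + u%:P : {poly F}) = 2%N by rewrite size_XaddC.
have K (u : F) (r : {poly F}) : (r \Po ('X + (- u)%:P)) \Po ('X + u%:P) = r.
  rewrite -comp_polyA comp_polyD comp_polyX comp_polyC polyCN addrK.
  by rewrite comp_polyXr.
move=> [sp ip]; split=> [|q sq qp]; first by rewrite size_comp_poly2.
have qp2 : q \Po ('X + (- a)%:P) %| p.
  by rewrite -[p](K (- a)) opprK dvdp_comp_poly.
have sq2 : size (q \Po ('X + (- a)%:P)) != 1%N by rewrite (size_comp_poly2 q (s2 _)).
have /eqpP[[u v] /= uv huv] := ip _ sq2 qp2.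
apply/eqpP; exists (u, v) => //=.
by rewrite -comp_polyZ -huv comp_polyZ K.
Qed.

Lemma irreducible_comp_shiftE (F : fieldType) (p : {poly F}) (a : F) :
  irreducible_poly (p \Po ('X + a%:P)) <-> irreducible_poly p.
Proof.
split; last exact: irreducible_comp_shift.
move/(irreducible_comp_shift (- a)); rewrite -comp_polyA comp_polyD comp_polyX.
by rewrite comp_polyC polyCN subrK comp_polyXr.
Qed.

(** * Dynamical irreducibility as a condition on nonsquares *)

Section Quadratics.

Variables (F : finFieldType) (I : Type) (b c : I -> F).
Hypothesis oF : odd #|F|.
Let f i := quadratic (b i) (c i).

Lemma quadraticE (u v : F) : quadratic u v = ('X^2 + v%:P) \Po ('X - u%:P).
Proof. by rewrite comp_polyD comp_Xn_poly comp_polyC. Qed.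

Lemma horner_quadratic (u v x : F) : (quadratic u v).[x] = (x - u) ^+ 2 + v.
Proof. by rewrite /quadratic hornerD hornerC horner_exp hornerXsubC. Qed.

Lemma size_quadratic (u v : F) : size (quadratic u v) = 3%N.
Proof. by rewrite quadraticE size_comp_poly2 ?size_XsubC // size_XnaddC. Qed.

Lemma quadratic_monic (u v : F) : quadratic u v \is monic.
Proof.
rewrite quadraticE monicE lead_coef_comp ?size_XsubC // lead_coefXsubC expr1n.
by rewrite mulr1 lead_coefXnaddC.
Qed.

Lemma comp_along_cat s t : comp_along f (s ++ t) = comp_along f s \Po comp_along f t.
Proof.
by elim: s => [|i s IH]; rewrite /= ?comp_polyX // -/(comp_along _ _) IH comp_polyA.
Qed.

Lemma comp_along_rcons s i : comp_along f (rcons s i) = comp_along f s \Po f i.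
Proof. by rewrite -cats1 comp_along_cat /= comp_polyXr. Qed.

Lemma size_comp_along s : size (comp_along f s) = (2 ^ size s).+1.
Proof.
elim: s => [|i s IH] /=; first by rewrite size_polyX.
have := size_comp_poly (f i) (comp_along f s).
rewrite -/(comp_along f s) IH size_quadratic /= -expnS.
case: (size (f i \Po _)) => [/= /esym/eqP|n /= -> //].
by rewrite expn_eq0.
Qed.

Lemma comp_along_monic s : comp_along f s \is monic.
Proof.
elim: s => [|i s IH] /=; first exact: monicX.
rewrite monicE lead_coef_comp -/(comp_along f s).
  by rewrite (monicP IH) expr1n mulr1 (monicP (quadratic_monic _ _)).
by rewrite size_comp_along ltnS expn_gt0.
Qed.

Lemma irreducible_quadraticP (u v : F) :
  irreducible_poly (quadratic u v) <-> ~~ is_square (- v).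
Proof.
split=> [irr|ns].
  apply/negP=> /is_squareP[y hy].
  have [_ /(_ ('X - (u + y)%:P))] := irr.
  rewrite size_XsubC dvdp_XsubCl /root horner_quadratic addrAC subrr add0r hy addNr.
  by rewrite eqxx => /(_ isT isT) /eqp_size; rewrite size_XsubC size_quadratic.
apply: cubic_irreducible; rewrite ?size_quadratic // => x.
apply: contra ns; rewrite /root horner_quadratic addr_eq0 => /eqP h.
by apply/is_squareP; exists (x - u).
Qed.

Lemma irreducible_comp_quadraticP (g : {poly F}) (u v : F) :
  g \is monic -> irreducible_poly g -> odd (size g) ->
  irreducible_poly (g \Po quadratic u v) <-> ~~ is_square g.[v].
Proof.
move=> mg ig og.
have s2 (a : F) : size ('X + a%:P : {poly F}) = 2%N by rewrite size_XaddC.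
rewrite quadraticE comp_polyA -polyCN irreducible_comp_shiftE.
rewrite (_ : 'X^2 + v%:P = ('X + v%:P) \Po 'X^2); last first.
  by rewrite comp_polyD comp_polyX comp_polyC.
rewrite comp_polyA irreducible_comp_sqrP //.
- by rewrite horner_comp hornerD hornerX hornerC add0r.
- by rewrite monicE lead_coef_comp ?s2 // lead_coefXaddC expr1n mulr1 (monicP mg).
- exact: irreducible_comp_shift.
- by rewrite size_comp_poly2.
Qed.

(** Induction on the word, adding the innermost quadratic last. Words of length 1 have a condition
    of their own because the criterion for [g] composed with a quadratic wants [g] of even degree,
    and the empty composition is [X]. *)
Lemma dynamically_irreducibleP :
  dynamically_irreducible f <->
  (forall i, ~~ is_square (- c i)) /\
  (forall i s j, ~~ is_square (comp_along f (i :: s)).[c j]).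
Proof.
have oc i s : odd (size (comp_along f (i :: s))).
  by rewrite size_comp_along expnS mul2n /= odd_double.
split=> [DI|[h1 h2] i s].
  split=> [i|i s j].
    by apply/(irreducible_quadraticP (b i)); have := DI i [::]; rewrite /= comp_polyXr.
  apply/(irreducible_comp_quadraticP (b j)) => //; first exact: comp_along_monic.
  by rewrite -[quadratic _ _]/(f j) -comp_along_rcons rcons_cons.
elim/last_ind: s => [|s j IH].
  by rewrite /= comp_polyXr; apply/irreducible_quadraticP.
rewrite -rcons_cons comp_along_rcons; apply/irreducible_comp_quadraticP => //.
exact: comp_along_monic.
Qed.

End Quadratics.

(** * Stepanov's method *)

Section Taylor.

Variable F : fieldType.
Implicit Types p q r f : {poly F}.

(* The coefficient of [Y ^ k] in [taylor p = p (X + Y)] is the k-th Hasse derivative. *)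
Definition taylor p : {poly {poly F}} := p^:P \Po ('X + 'X%:P).

Lemma taylorM p q : taylor (p * q) = taylor p * taylor q.
Proof. by rewrite /taylor rmorphM /= comp_polyM. Qed.

Lemma taylorD p q : taylor (p + q) = taylor p + taylor q.
Proof. by rewrite /taylor rmorphD /= comp_polyD. Qed.

Lemma taylorX n p : taylor (p ^+ n) = taylor p ^+ n.
Proof. by rewrite /taylor !rmorphXn. Qed.

Lemma taylor_sum I (s : seq I) (G : I -> {poly F}) :
  taylor (\sum_(i <- s) G i) = \sum_(i <- s) taylor (G i).
Proof. by rewrite /taylor !rmorph_sum. Qed.

Lemma taylor_polyX : taylor 'X = 'X + 'X%:P.
Proof. by rewrite /taylor map_polyX comp_polyX. Qed.

Lemma coef_XDXn j k :
  (('X + 'X%:P : {poly {poly F}}) ^+ j)`_k = 'X^(j - k) *+ 'C(j, k).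
Proof.
rewrite addrC exprDn coef_sum; under eq_bigr do rewrite coefMn -polyC_exp coefCM coefXn.
have [kj|jk] := ltnP k j.+1; last first.
  rewrite bin_small // mulr0n big1 // => i _.
  by rewrite gtn_eqF ?mulr0 ?mul0rn // (leq_trans (ltn_ord i)).
rewrite (bigD1 (Ordinal kj)) //= eqxx mulr1 big1 ?addr0 // => i.
by rewrite -val_eqE /= eq_sym => /negbTE ->; rewrite mulr0 mul0rn.
Qed.

Lemma coef_taylor p k :
  (taylor p)`_k = \sum_(j < size p) p`_j *: ('X^(j - k) *+ 'C(j, k)).
Proof.
rewrite /taylor coef_comp_poly size_map_polyC; apply: eq_bigr => j _.
by rewrite coef_map /= coef_XDXn mul_polyC.
Qed.

Lemma coef0_taylor p : (taylor p)`_0 = p.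
Proof.
rewrite coef_taylor -[RHS]coefK poly_def; apply: eq_bigr => i _.
by rewrite subn0 bin0 mulr1n.
Qed.

Lemma size_coef_taylor p k : (size ((taylor p)`_k)%R <= size p - k)%N.
Proof.
rewrite coef_taylor; apply: leq_trans (size_sum _ _ _) _.
apply/bigmax_leqP => j _; apply: leq_trans (size_scale_leq _ _) _.
have [kj|jk] := leqP k j; last by rewrite bin_small // mulr0n size_poly0.
rewrite -scaler_nat; apply: leq_trans (size_scale_leq _ _) _.
by rewrite size_polyXn -subSn // leq_sub2r.
Qed.

(** The Hasse derivatives at [x] are the coefficients of [p (X + x)], which therefore starts in
    degree [l]. Iterated derivatives would lose multiplicities beyond the characteristic. *)
Lemma taylor_root_mul p x l :
  (forall k, (k < l)%N -> ((taylor p)`_k).[x] = 0) -> ('X - x%:P) ^+ l %| p.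
Proof.
move=> h.
have e : map_poly (horner_eval x) (taylor p) = p \Po ('X + x%:P).
  rewrite /taylor map_comp_poly /= rmorphD /= map_polyX map_polyC /= /horner_eval hornerX.
  congr (_ \Po _); apply/polyP => i.
  by rewrite coef_map_id0 ?horner0 // coef_map /= hornerC.
have hX : 'X^l %| p \Po ('X + x%:P).
  rewrite -e; apply/dvdpP; exists (drop_poly l (map_poly (horner_eval x) (taylor p))).
  rewrite -[LHS](poly_take_drop l) (_ : take_poly _ _ = 0) ?add0r //.
  apply/polyP=> k; rewrite coef_take_poly coef0; case: ifP => // kl.
  by rewrite coef_map /= /horner_eval h.
have := dvdp_comp_poly ('X - x%:P) hX.
by rewrite comp_Xn_poly -comp_polyA comp_polyD comp_polyX comp_polyC subrK comp_polyXr.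
Qed.

(** Each Hasse derivation costs at most one factor [f] and raises the degree of the cofactor by at
    most [m - 1]. Induction on [L] through the Leibniz rule, which is the product of Taylor
    expansions. *)
Lemma dvd_coef_taylor f r m D L k :
  (0 < m)%N -> (0 < D)%N -> (size f <= m.+1)%N -> (size r <= D)%N -> (k <= L)%N ->
  exists2 w, (taylor (f ^+ L * r))`_k = f ^+ (L - k) * w
           & (size w <= D + k * m.-1)%N.
Proof.
move=> m0 D0 sf sr.
have sfn i : (size (f ^+ i) <= (m * i).+1)%N.
  apply: leq_trans (size_poly_exp_leq _ _) _; rewrite ltnS leq_mul2r; apply/orP; right.
  by move: (size f) sf => a; lia.
elim: L k => [|L IH] k.
  rewrite leqn0 => /eqP ->; exists r; rewrite ?expr0 ?mul1r ?coef0_taylor //.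
  by rewrite addn0.
rewrite leq_eqVlt => /orP[/eqP ->|]; last rewrite ltnS => kL.
  exists ((taylor (f ^+ L.+1 * r))`_L.+1); first by rewrite subnn expr0 mul1r.
  apply: leq_trans (size_coef_taylor _ _) _.
  have := leq_trans (size_polyMleq (f ^+ L.+1) r) (leq_pred _).
  move: (size_polyMleq (f ^+ L.+1) r) (sfn L.+1) sr.
  move: (size (f ^+ L.+1 * r)) (size (f ^+ L.+1)) (size r) => a b c h1 h2 h3 _.
  case: m m0 {sf sfn IH} h2 => // m _ h2 /=; move: h1 h2; rewrite !mulnS !mulSn; lia.
pose good p := exists2 w, p = f ^+ (L.+1 - k) * w & (size w <= D + k * m.-1)%N.
rewrite exprS -mulrA taylorM coefM.
apply: (big_ind good) => [|p1 p2 [w1 -> s1] [w2 -> s2]|[i /= ik] _].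
- by exists 0; rewrite ?mulr0 ?size_poly0.
- exists (w1 + w2); first by rewrite mulrDr.
  by apply: leq_trans (size_polyD _ _) _; rewrite geq_max s1 s2.
have [|w hw sw] := IH (k - i)%N; first by apply: leq_trans (leq_subr _ _) kL.
case: i ik hw sw => [_|i ik] hw sw.
  exists w; last by rewrite subn0 in sw.
  by rewrite coef0_taylor hw subn0 subSn // exprS mulrA.
have [mi|im] := leqP (size f) i.+1.
  exists 0; rewrite ?size_poly0 // mulr0.
  suff -> : (taylor f)`_i.+1 = 0 by rewrite mul0r.
  apply/eqP; rewrite -size_poly_leq0; apply: leq_trans (size_coef_taylor _ _) _.
  by rewrite leqn0 subn_eq0.
exists ((taylor f)`_i.+1 * (f ^+ i * w)).
  rewrite hw (_ : L - (k - i.+1) = L.+1 - k + i)%N; last by lia.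
  by rewrite exprD; ring.
apply: leq_trans (size_polyMleq _ _) _.
have := size_polyMleq (f ^+ i) w; move: (size_coef_taylor f i.+1) (sfn i).
move: im sw sf; move: (size ((taylor f)`_i.+1)%R) (size f) (size (f ^+ i * w)) (size w) (size (f ^+ i)).
move=> a b c d e h1 h2 h3 h4 h5 h6.
have {h4} : (a <= m - i)%N by lia.
have -> : (D + k * m.-1 = D + (k - i.+1) * m.-1 + i.+1 * m.-1)%N.
  by rewrite -addnA -mulnDl subnK.
have im : (i < m)%N by lia.
move: ((k - i.+1) * m.-1)%N h2 => z h2; rewrite mulSn.
case: m m0 im {sfn IH h3 good hw} h5 => // m _ im; rewrite mulSn /=.
have : (i * m = m * i)%N by rewrite mulnC.
lia.
Qed.

(** The expansion of [X ^ (q j)] is a power of [Y ^ q + X ^ q], so Hasse derivatives of order below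
    [q] treat [X ^ (q j)] as a constant. *)
Lemma coef_taylor_MXn (q : nat) (B : {poly {poly F}}) (c : {poly F}) (j k : nat) :
  (k < q)%N -> (B * ('X^q + c%:P) ^+ j)`_k = B`_k * c ^+ j.
Proof.
move=> kq; elim: j => [|j IH]; first by rewrite !expr0 !mulr1.
by rewrite exprSr mulrA mulrDr coefD coefMXn kq add0r coefMC IH exprSr mulrA.
Qed.

End Taylor.

Lemma taylor_Xcard (F : finFieldType) j :
  taylor ('X^(#|F| * j) : {poly F}) = ('X^#|F| + ('X^#|F|)%:P) ^+ j.
Proof.
rewrite taylorX taylor_polyX exprM exprDn_pchar -?polyC_exp //.
rewrite -[X in X.-nat _]/[pchar {poly {poly F}}] -(expn1 #|F|).
by apply: card_pnat => i; rewrite !pchar_poly.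
Qed.

Lemma exp_card_poly (F : finFieldType) (f : {poly F}) : f ^+ #|F| = f \Po 'X^#|F|.
Proof.
have := @horner_frobenius F {poly F} polyC f 'X 1.
rewrite !expn1 => h; rewrite -[LHS](congr1 (fun p => p ^+ _) (comp_polyXr f)).
by rewrite /comp_poly h // => i; rewrite pchar_poly.
Qed.

Lemma dvdp_prod_XsubC (F : fieldType) (s : seq F) (l : nat) (P : {poly F}) :
  uniq s -> (forall x, x \in s -> ('X - x%:P) ^+ l %| P) ->
  \prod_(x <- s) ('X - x%:P) ^+ l %| P.
Proof.
elim: s => [|x s IH] /=; first by rewrite big_nil dvd1p.
case/andP=> xs us h; rewrite big_cons Gauss_dvdp; last first.
  apply: coprimep_expl; rewrite coprimep_sym coprimep_XsubC /root horner_prod.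
  rewrite prodf_seq_neq0; apply/allP=> y ys /=.
  rewrite horner_exp hornerXsubC expf_neq0 // subr_eq0.
  by apply: contraNneq xs => ->.
rewrite h ?mem_head // IH // => y ys; apply: h; by rewrite in_cons ys orbT.
Qed.

Lemma card_mul_roots (F : finFieldType) (A : {set F}) (l : nat) (P : {poly F}) :
  P != 0 -> (forall x, x \in A -> ('X - x%:P) ^+ l %| P) ->
  (#|A| * l < size P)%N.
Proof.
move=> P0 h.
have := @dvdp_prod_XsubC _ (enum A) l P (enum_uniq _).
have hh x : x \in enum A -> ('X - x%:P) ^+ l %| P by rewrite mem_enum; apply: h.
move=> /(_ hh) /(dvdp_leq P0); apply: leq_trans.
rewrite size_prod_seq => [|x _]; last by rewrite expf_neq0 // polyXsubC_eq0.
under eq_bigr do rewrite size_exp_XsubC.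
rewrite -cardE big_enum sum_nat_const mulnS; move: (#|A| * l)%N #|A|.
lia.
Qed.

Section Stepanov.

Variables (F : finFieldType) (f : {poly F}) (m : nat).
Local Notation q := #|F|.
Local Notation h := (#|F|./2).
Hypothesis oF : odd q.
Hypothesis m0 : (0 < m)%N.
Hypothesis sf : size f = m.+1.
Hypothesis f00 : f.[0] != 0.
Hypothesis f_nonsquare : forall (r s : {poly F}) (c : F),
  r ^+ 2 * f = c *: s ^+ 2 -> r = 0.

Let f0 : f != 0. Proof. by rewrite -size_poly_eq0 sf. Qed.

(** Multiplying by the conjugate [r - s * f ^+ h] and by [f] gives [r ^+ 2 * f - s ^+ 2 * f ^+ q],
    and [f ^+ q = f (X ^ q)] is [f.[0]] modulo [X ^ q]. The resulting [r ^+ 2 * f - f.[0] *: s ^+ 2]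
    has degree below [q], so it vanishes, and [f] is not a constant times a square. *)
Lemma stepanov_block_eq0 (D : nat) (r s : {poly F}) : (0 < D)%N ->
  (size r <= D)%N -> (size s <= D)%N -> (D.*2 + m <= q.+1)%N ->
  'X^q %| r + s * f ^+ h -> r = 0 /\ s = 0.
Proof.
move=> D0 sr ss dq hX.
have dq1 : ((D.*2 + m).-1 <= q)%N.
  by rewrite -ltnS prednK // addn_gt0 double_gt0 D0.
have hfq : f ^+ h * f ^+ h * f = f ^+ q.
  by rewrite -exprD addnn -exprSr -oddF_pred.
have hf : 'X^q %| f ^+ q - f.[0]%:P.
  rewrite exp_card_poly -[f.[0]%:P](comp_polyC _ 'X^q) -rmorphB /=.
  rewrite -[X in X %| _](comp_polyX 'X^q) dvdp_comp_poly //.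
  by rewrite -['X]subr0 -polyC0 dvdp_XsubCl /root !hornerE subrr.
have hz : 'X^q %| r ^+ 2 * f - f.[0] *: s ^+ 2.
  rewrite -mul_polyC.
  rewrite (_ : _ - _ = (r + s * f ^+ h) * ((r - s * f ^+ h) * f)
                       + (f ^+ q - f.[0]%:P) * s ^+ 2); last by rewrite -hfq; ring.
  by rewrite dvdp_add // dvdp_mulr.
have z : r ^+ 2 * f - f.[0] *: s ^+ 2 = 0.
  apply/eqP; apply: contraTT hz => n0; apply/negP => /(dvdp_leq n0).
  rewrite size_polyXn; apply/negP; rewrite -ltnNge ltnS.
  apply: leq_trans (size_polyD _ _) _; rewrite geq_max size_polyN; apply/andP; split.
    apply: leq_trans (size_polyMleq _ _) _; rewrite sf addnS /=.
    have := size_polyMleq r r; rewrite -expr2.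
    move: (size (r ^+ 2)) (size r) sr => a b; move: D0 => /[swap] *; apply: leq_trans dq1; lia.
  apply: leq_trans (size_scale_leq _ _) _; rewrite expr2.
  apply: leq_trans (size_polyMleq _ _) _.
  move: (size s) ss => b ss; apply: leq_trans dq1; lia.
have r0 : r = 0 by apply: (@f_nonsquare r s f.[0]); apply/eqP; rewrite -subr_eq0 z.
split=> //; move/eqP: z; rewrite r0 expr0n mul0r sub0r oppr_eq0 scaler_eq0.
by rewrite (negbTE f00) expf_eq0 /= => /eqP.
Qed.

(** Reduction modulo [X ^ q] isolates the lowest block; once it vanishes, the sum can be divided by
    [X ^ q]. *)
Lemma stepanov_indep (D J : nat) (r s : nat -> {poly F}) : (0 < D)%N ->
  (forall j, size (r j) <= D)%N -> (forall j, size (s j) <= D)%N ->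
  (D.*2 + m <= q.+1)%N ->
  \sum_(j < J) (r j + s j * f ^+ h) * 'X^(q * j) = 0 ->
  forall j, (j < J)%N -> r j = 0 /\ s j = 0.
Proof.
move=> D0 hr hs dq; elim: J r s hr hs => // J IH r s hr hs.
rewrite big_ord_recl muln0 expr0 mulr1.
rewrite (eq_bigr (fun j : 'I_J => (r j.+1 + s j.+1 * f ^+ h) * 'X^(q * j) * 'X^q)); last first.
  by move=> j _; rewrite lift0 mulnS addnC exprD mulrA.
rewrite -mulr_suml => hsum.
have [r0 s0] : r 0%N = 0 /\ s 0%N = 0.
  apply: (@stepanov_block_eq0 D) => //.
  move/eqP: hsum; rewrite addr_eq0 => /eqP ->.
  by rewrite -mulNr dvdp_mull.
move: hsum; rewrite r0 s0 mul0r !add0r => /eqP; rewrite mulf_eq0 => /orP[|]; last first.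
  by rewrite -size_poly_eq0 size_polyXn.
move=> /eqP hsum [|j] // jJ.
exact: (IH (fun j => r j.+1) (fun j => s j.+1)).
Qed.

Section Aux.
Variables (D J l : nat) (a : F).
Hypothesis D0 : (0 < D)%N.
Hypothesis dq : (D.*2 + m <= q.+1)%N.
Hypothesis lq : (l <= q)%N.
Hypothesis hcount : (l * (D + l * m.-1 + J) < 2 * (D * J))%N.

Let E := (D + l * m.-1 + J)%N.

(* the cofactor of [f ^+ (L - k)] in the k-th Hasse derivative of [f ^+ L * r] *)
Definition hasse_cofactor (L k : nat) (r : {poly F}) : {poly F} :=
  (taylor (f ^+ L * r))`_k %/ f ^+ (L - k).

Lemma hasse_cofactorB L k r s :
  hasse_cofactor L k (r - s) = hasse_cofactor L k r - hasse_cofactor L k s.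
Proof.
by rewrite /hasse_cofactor mulrBr /taylor !rmorphB /= coefB divpD divpN.
Qed.

Lemma hasse_cofactorP (L k : nat) (r : {poly F}) : (size r <= D)%N -> (k <= L)%N ->
  (taylor (f ^+ L * r))`_k = f ^+ (L - k) * hasse_cofactor L k r /\
  (size (hasse_cofactor L k r) <= D + k * m.-1)%N.
Proof.
move=> sr kL.
have [|w hw sw] := @dvd_coef_taylor _ f r m D L k m0 D0 _ sr kL; rewrite ?sf //.
have e : hasse_cofactor L k r = w.
  by rewrite /hasse_cofactor hw mulrC mulpK // expf_neq0.
by rewrite e.
Qed.

Local Opaque hasse_cofactor.

(* On the points where [f ^+ h = a], and where [x ^+ q = x], the k-th Hasse derivative
   of [stepanov_poly r s] is [f ^+ (l - k) * stepanov_cond r s k].  There are more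
   choices of [r] and [s] than of the [l] conditions, so that by the pigeonhole
   principle all conditions vanish for some nontrivial [r] and [s]. *)
Definition stepanov_cond (r s : nat -> {poly F}) (k : nat) : {poly F} :=
  \sum_(j < J) (hasse_cofactor l k (r j) + a *: hasse_cofactor (l + h) k (s j)) * 'X^j.

Definition stepanov_poly (r s : nat -> {poly F}) : {poly F} :=
  \sum_(j < J) (f ^+ l * r j + f ^+ (l + h) * s j) * 'X^(q * j).

Lemma size_stepanov_cond (r s : nat -> {poly F}) (k : nat) : (k < l)%N ->
  (forall j, size (r j) <= D)%N -> (forall j, size (s j) <= D)%N ->
  (size (stepanov_cond r s k) <= E)%N.
Proof.
move=> kl hr hs; apply: leq_trans (size_sum _ _ _) _; apply/bigmax_leqP => j _.
apply: leq_trans (size_polyMleq _ _) _; rewrite size_polyXn addnS /=.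
have [_ h1] := hasse_cofactorP (hr j) (ltnW kl).
have [_ h2] := hasse_cofactorP (hs j) (leq_trans (ltnW kl) (leq_addr h l)).
apply: leq_add; last exact: ltnW.
have kk : (D + k * m.-1 <= D + l * m.-1)%N by rewrite leq_add2l leq_mul2r (ltnW kl) orbT.
apply: leq_trans (size_polyD _ _) _; rewrite geq_max (leq_trans h1 kk) /=.
by apply: leq_trans (size_scale_leq _ _) _; apply: leq_trans h2 kk.
Qed.

Lemma stepanov_vanish (r s : nat -> {poly F}) (x : F) :
  (forall j, size (r j) <= D)%N -> (forall j, size (s j) <= D)%N ->
  (forall k, (k < l)%N -> stepanov_cond r s k = 0) ->
  f.[x] ^+ h = a -> ('X - x%:P) ^+ l %| stepanov_poly r s.
Proof.
move=> hr hs hc hx; apply: taylor_root_mul => k kl.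
have kq : (k < q)%N by apply: leq_trans lq.
suff -> : (taylor (stepanov_poly r s))`_k =
  f ^+ (l - k) * \sum_(j < J) (hasse_cofactor l k (r j) +
     f ^+ h * hasse_cofactor (l + h) k (s j)) * 'X^(q * j).
  rewrite hornerM (_ : (\sum_(j < J) _).[x] = (stepanov_cond r s k).[x]); last first.
    rewrite !horner_sum; apply: eq_bigr => j _.
    rewrite !hornerM !hornerD !hornerXn hornerZ hornerM horner_exp hx.
    by rewrite exprM expf_card.
  by rewrite hc // horner0 mulr0.
rewrite taylor_sum coef_sum mulr_sumr; apply: eq_bigr => j _.
rewrite taylorM taylor_Xcard coef_taylor_MXn // taylorD coefD -exprM mulrA.
rewrite (hasse_cofactorP (hr j) (ltnW kl)).1.
rewrite (hasse_cofactorP (hs j) (leq_trans (ltnW kl) (leq_addr h l))).1.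
by rewrite mulrDr mulrA -exprD -addnBAC // ltnW.
Qed.

Lemma stepanov_exists : exists r s : nat -> {poly F},
  [/\ forall j, (size (r j) <= D)%N, forall j, (size (s j) <= D)%N,
      forall k, (k < l)%N -> stepanov_cond r s k = 0
    & stepanov_poly r s != 0].
Proof.
pose T := {ffun 'I_J -> {poly_D F}}.
pose ext (u : T) (j : nat) : {poly F} := if insub j is Some i then val (u i) else 0.
have sext u j : (size (ext u j) <= D)%N.
  by rewrite /ext; case: insubP => [i _ _|_]; rewrite ?size_npoly ?size_poly0.
pose cond (uv : T * T) : {ffun 'I_l -> {poly_E F}} :=
  [ffun k : 'I_l => npolyp E (stepanov_cond (ext uv.1) (ext uv.2) k)].
(* There are [q ^ (2 D J)] choices of [r] and [s], but only [q ^ (l E)] possible values of the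
   conditions; [hcount] compares the exponents. The difference of two colliding choices satisfies
   all conditions by linearity. *)
have /injectivePn[u [v uv huv]] : ~~ injectiveb cond.
  apply/negP => /injectiveP /leq_card.
  rewrite card_prod !card_ffun !card_npoly !card_ord -!expnM -expnD.
  rewrite leq_exp2l ?finNzRing_gt1 // leqNgt.
  by rewrite mulnC addnn -mul2n hcount.
pose r j := ext u.1 j - ext v.1 j; pose s j := ext u.2 j - ext v.2 j.
have hr j : (size (r j) <= D)%N.
  by apply: leq_trans (size_polyD _ _) _; rewrite size_polyN geq_max !sext.
have hs j : (size (s j) <= D)%N.
  by apply: leq_trans (size_polyD _ _) _; rewrite size_polyN geq_max !sext.
exists r, s; split; [exact: hr | exact: hs | |].
  move=> k kl.
  have -> : stepanov_cond r s k =
     stepanov_cond (ext u.1) (ext u.2) k - stepanov_cond (ext v.1) (ext v.2) k.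
    rewrite -sumrB; apply: eq_bigr => j _.
    rewrite /r /s (hasse_cofactorB l) (hasse_cofactorB (l + h)) scalerBr -mulrBl.
    by rewrite opprD addrACA.
  have hw (w : T * T) : val (cond w (Ordinal kl)) = stepanov_cond (ext w.1) (ext w.2) k.
    rewrite ffunE; apply: npolypK.
    by apply: size_stepanov_cond => // j; apply: sext.
  by rewrite -!hw huv subrr.
apply: contraNneq uv => hP.
(* If the auxiliary polynomial vanished, division by [f ^+ l] and independence of the blocks would
   make the two choices equal. *)
have h0 : forall j, (j < J)%N -> r j = 0 /\ s j = 0.
  apply: (@stepanov_indep D J r s D0 hr hs dq).
  apply: (mulfI (expf_neq0 l f0)); rewrite mulr0 -[RHS]hP mulr_sumr.
  by apply: eq_bigr => j _; rewrite exprD; ring.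
have hext (w : T) (i : 'I_J) : ext w i = val (w i) by rewrite /ext valK.
have e1 : u.1 = v.1.
  apply/ffunP=> i; apply/val_inj; rewrite -!hext; apply/eqP; rewrite -subr_eq0.
  by apply/eqP; case: (h0 i (ltn_ord i)).
have e2 : u.2 = v.2.
  apply/ffunP=> i; apply/val_inj; rewrite -!hext; apply/eqP; rewrite -subr_eq0.
  by apply/eqP; case: (h0 i (ltn_ord i)).
by rewrite [u]surjective_pairing e1 e2 -surjective_pairing.
Qed.

Lemma stepanov_count (A : {set F}) :
  (forall x, x \in A -> f.[x] ^+ h = a) ->
  (#|A| * l <= m * (l + h) + D + q * J.-1)%N.
Proof.
move=> hA; have [r [s [hr hs hc P0]]] := stepanov_exists.
have hd x : x \in A -> ('X - x%:P) ^+ l %| stepanov_poly r s.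
  by move=> /hA; apply: stepanov_vanish.
apply: leq_trans (ltnW (card_mul_roots P0 hd)) _.
apply: leq_trans (size_sum _ _ _) _; apply/bigmax_leqP => j _.
apply: leq_trans (size_polyMleq _ _) _; rewrite size_polyXn addnS /=.
apply: leq_add; last by rewrite leq_mul2l; apply/orP; right; have := ltn_ord j; lia.
have sfn (i : nat) : (size (f ^+ i) <= (m * i).+1)%N.
  by apply: leq_trans (size_poly_exp_leq _ _) _; rewrite sf.
have key (i : nat) (p : {poly F}) : (i <= l + h)%N -> (size p <= D)%N ->
      (size (f ^+ i * p)%R <= m * (l + h) + D)%N.
  move=> il sp; apply: leq_trans (size_polyMleq _ _) _.
  have : (m * i <= m * (l + h))%N by rewrite leq_mul2l il orbT.
  move: (sfn i); move: (m * i)%N (m * (l + h))%N (size (f ^+ i)) (size p) sp => x y z w; lia.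
by apply: leq_trans (size_polyD _ _) _; rewrite geq_max !key // leq_addr.
Qed.

End Aux.

End Stepanov.

(** * The quadratic character and its sums *)

Definition chi (F : finFieldType) (x : F) : int :=
  if x == 0 then 0 else if is_square x then 1 else -1.

Lemma one_neqN1 (F : finFieldType) : odd #|F| -> (1 : F) != -1.
Proof.
move=> oF; have := euler_nonsquare (0 : F) oF; rewrite is_square0 expr0n /=.
have := euler_nonsquare (1 : F) oF; rewrite expr1n => <- _.
by rewrite negbK; apply/is_squareP; exists 1; rewrite expr1n.
Qed.

Lemma chiM (F : finFieldType) (x y : F) : odd #|F| -> chi (x * y) = chi x * chi y.
Proof.
move=> oF; rewrite /chi mulf_eq0.
have [x0|x0] /= := eqVneq x 0; first by rewrite mul0r.
have [y0|y0] /= := eqVneq y 0; first by rewrite mulr0.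
rewrite euler_criterion ?mulf_neq0 // exprMn.
have hx := euler_criterion oF x0; have hy := euler_criterion oF y0.
have nx := euler_nonsquare x oF; have ny := euler_nonsquare y oF.
have n1 := one_neqN1 oF.
move: nx ny; case: (is_square x) hx => /esym hx /esym nx; case: (is_square y) hy => /esym hy /esym ny.
- by rewrite (eqP hx) (eqP hy) mul1r eqxx.
- by rewrite (eqP hx) (eqP ny) mul1r eq_sym (negbTE n1).
- by rewrite (eqP nx) (eqP hy) mulr1 eq_sym (negbTE n1).
- by rewrite (eqP nx) (eqP ny) mulrNN mulr1 eqxx.
Qed.

Lemma chi1 (F : finFieldType) : chi (1 : F) = 1.
Proof.
by rewrite /chi oner_eq0; case: is_squareP => // -[]; exists 1; rewrite expr1n.
Qed.

Section CharacterSum.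

Variables (F : finFieldType) (f : {poly F}) (m l : nat).
Local Notation q := #|F|.
Hypothesis oF : odd q.
Hypothesis m0 : (0 < m)%N.
Hypothesis sf : size f = m.+1.
Hypothesis f00 : f.[0] != 0.
Hypothesis f_nonsquare : forall (r s : {poly F}) (c : F),
  r ^+ 2 * f = c *: s ^+ 2 -> r = 0.
Hypothesis lq1 : (l * l <= q)%N.
Hypothesis lq2 : (q <= l * l + 2 * l)%N.

Lemma half_count_bound (a : F) (A : {set F}) : (2 * m + 2 <= l)%N ->
  (forall x, x \in A -> f.[x] ^+ q./2 = a) ->
  (2 * #|A| <= q + 20 * (m * l))%N.
Proof.
move=> ml hA.
have h1 := divn_eq q 4; have h2 : (q %% 4 < 4)%N by rewrite ltn_mod.
have h3 := odd_double_half l; have h4 : (odd l <= 1)%N by case: (odd l).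
have h5 := oddF_pred oF.
(* With [D] near [q / 4] and [J] near [l / 2], the main terms [l * D] of the conditions and
   [2 * D * J] of the unknowns balance; the excess [2 * m + 2] in [J] pays for the remaining
   conditions. The degree, mainly [q * J], divided by the multiplicity [l] is [q / 2 + O(m * l)]. *)
have := @stepanov_count F f m oF m0 sf f00 f_nonsquare
   (q %/ 4).+1 (l./2 + 2 * m + 2) l a (ltn0Sn _) _ _ _ A hA.
move: lq1 lq2 h1 h2 h3 h4 h5.
move: (nat_of_bool (odd l)) (q %/ 4)%N (q %% 4)%N l./2 q./2 => o d e l2 Q2.
move: q (#|A|) m0 => Q N.
case: m ml => // m' ml _ q1 q2 h1 h2 h3 h4 h5 /=; set M := m'.+1.
have l4 : (4 <= l)%N by rewrite /M in ml *; lia.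
have q3 : (4 * l <= Q)%N by apply: leq_trans q1; rewrite leq_mul2r l4 orbT.
have H1 : ((d.+1).*2 + M <= Q.+1)%N by rewrite /M; lia.
have H2 : (l <= Q)%N by lia.
have H3 : (l * (d.+1 + l * m' + (l2 + 2 * M + 2)) < 2 * (d.+1 * (l2 + 2 * M + 2)))%N.
  have k1 : (l * l + 1 <= 4 * d.+1)%N by lia.
  have k2 : (l + 4 * M + 3 <= 2 * (l2 + 2 * M + 2))%N by lia.
  have k3 : (2 * (l2 + 2 * M + 2) <= 3 * l)%N by rewrite /M; lia.
  have k4 := leq_mul (leqnn d.+1) k2.
  have k5 := leq_mul (leqnn l) k3.
  have k6 := leq_mul k1 (leqnn (4 * M + 3)).
  move: k4 k5 k6; rewrite /M; move: (l2 + 2 * m'.+1 + 2)%N => J; nia.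
move=> /(_ H1 H2 H3).
rewrite (_ : (l2 + 2 * M + 2).-1 = l2 + 2 * M + 1)%N; last by lia.
move=> h.
have l0 : (0 < l)%N by lia.
have q4 : (2 * Q <= 3 * (l * l))%N.
  have := leq_mul l4 (leqnn l); lia.
have hl : (4 * (N * l) <= 2 * (Q * l) + 10 * (M * Q) + 5 * Q + 4 * (M * l) + 4)%N.
  have e1 : (Q * (l2 + 2 * M + 1) = Q * l2 + 2 * (M * Q) + Q)%N by ring.
  have e2 : (2 * (Q * l2) <= Q * l)%N.
    by rewrite mulnCA leq_mul2l; apply/orP; right; lia.
  have e3 : (2 * (M * (l + Q2)) <= 2 * (M * l) + M * Q)%N.
    have -> : (M * Q = 2 * (M * Q2) + M)%N by rewrite h5 mulnS -mul2n; ring.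
    by rewrite mulnDr mulnDr addnA leq_addr.
  lia.
have hm : (10 * (M * Q) + 5 * Q + 4 * (M * l) + 4 <= 40 * (M * (l * l)))%N.
  have e1 : (2 * (M * Q) <= 3 * (M * (l * l)))%N by rewrite mulnCA (mulnCA 3) leq_mul2l q4 orbT.
  have e2 : (l * l <= M * (l * l))%N by rewrite leq_pmull.
  have e3 : (4 * (M * l) <= M * (l * l))%N by rewrite mulnCA leq_mul2l leq_mul2r l4 !orbT.
  have e4 : (16 <= l * l)%N by apply: (leq_mul l4 l4).
  lia.
rewrite -(leq_pmul2r l0) mulnDl -!mulnA; move: hl hm; lia.
Qed.

Lemma chi_sum_split :
  let N (e : F) := #|[set x | f.[x] ^+ q./2 == e]| in
  \sum_x chi f.[x] = (N 1)%:Z - (N (-1))%:Z /\ (N 0%R <= m)%N /\ (N 1%R + N (-1)%R + N 0%R = q)%N.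
Proof.
move=> N.
have q2 : (0 < q./2)%N by have := finNzRing_gt1 F; rewrite (oddF_pred oF); case: q./2.
have n1 := one_neqN1 oF.
have n0 : (1 : F) != 0 := oner_neq0 F.
have n0' : (-1 : F) != 0 by rewrite oppr_eq0.
have cases (y : F) : y ^+ q./2 = 0 \/ y ^+ q./2 = 1 \/ y ^+ q./2 = -1.
  have [->|y0] := eqVneq y 0; first by left; rewrite expr0n gtn_eqF.
  right; case hy: (is_square y).
    by left; apply/eqP; rewrite -euler_criterion.
  by right; apply/eqP; rewrite -euler_nonsquare // hy.
have hchi (y : F) : chi y = (y ^+ q./2 == 1)%:Z - (y ^+ q./2 == -1)%:Z.
  rewrite /chi; have [->|y0] := eqVneq y 0.
    by rewrite expr0n gtn_eqF //= !(eq_sym 0) (negbTE n0) (negbTE n0').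
  rewrite euler_criterion //; have [|hy] := eqVneq (y ^+ q./2) 1.
    by move=> ->; rewrite (negbTE n1) subr0.
  case: (cases y) => [/eqP|[/eqP|->]]; rewrite ?(negbTE hy) ?expf_eq0 ?(negbTE y0) ?andbF //.
  by rewrite eqxx.
split; [|split].
- rewrite (eq_bigr _ (fun x _ => hchi f.[x])) sumrB /N -!sum1_card.
  have nE (A : {set F}) : (\sum_(x in A) 1)%:Z = \sum_x (x \in A)%:Z.
    rewrite (big_morph Posz PoszD (erefl : Posz 0 = 0)) big_mkcond /=.
    by apply: eq_bigr => x _; case: (x \in A).
  by rewrite !nE; congr (_ - _); apply: eq_bigr => x _; rewrite inE.
- have f0 : f != 0 by rewrite -size_poly_eq0 sf.
  have := @max_poly_roots _ f (enum [set x | f.[x] ^+ q./2 == 0]) f0.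
  rewrite enum_uniq sf ltnS -cardE; apply=> //; apply/allP=> x.
  by rewrite mem_enum inE expf_eq0 => /andP[].
- rewrite /N; move: (q./2) cases => h cs; have nE (A : {set F}) : #|A| = (\sum_x (x \in A))%N.
    by rewrite -sum1_card big_mkcond /=; apply: eq_bigr => x _; case: (x \in A).
  rewrite -[RHS]cardsT !nE -!big_split /=; apply: eq_bigr => x _.
  rewrite !inE; case: (cs f.[x]) => [->|[->|->]];
  by rewrite ?eqxx ?(eq_sym 0) ?(eq_sym (-1) 1) ?(negbTE n1) ?(negbTE n0) ?(negbTE n0').
Qed.

(** Upper bounds for both [N1] and [N2] suffice: as [N1 + N2 = q - N0] with [N0 <= m], bounding one
    from above bounds the other from below. *)
Lemma chi_sum_bound : `|\sum_x chi f.[x]| <= (21 * (m * l))%N%:Z.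
Proof.
have [-> []] := chi_sum_split.
set N1 := #|[set x | f.[x] ^+ q./2 == 1]|; set N2 := #|[set x | f.[x] ^+ q./2 == -1]|.
set N0 := #|[set x | f.[x] ^+ q./2 == 0]| => h0 hq.
(* When [l] is small compared with [m], the trivial bound [q] is already below [21 * m * l]. *)
have [ml|lm] := leqP (2 * m + 2) l; last first.
  have : (q <= 21 * (m * l))%N.
    apply: leq_trans lq2 _; rewrite -mulnDl mulnA leq_mul2r; apply/orP; right; lia.
  lia.
have h1 := @half_count_bound 1 [set x | f.[x] ^+ q./2 == 1] ml.
have h2 := @half_count_bound (-1) [set x | f.[x] ^+ q./2 == -1] ml.
have : (2 * N1 <= q + 20 * (m * l))%N by apply: h1 => x; rewrite inE => /eqP.
have : (2 * N2 <= q + 20 * (m * l))%N by apply: h2 => x; rewrite inE => /eqP.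
have : (m <= m * l)%N by rewrite leq_pmulr //; lia.
lia.
Qed.

End CharacterSum.

(** * The size of the orbit *)

Lemma irreducible_dvdp_sqr (F : fieldType) (P r : {poly F}) :
  irreducible_poly P -> P %| r ^+ 2 -> P %| r.
Proof.
move=> iP; case: (boolP (P %| r)) => // h; rewrite expr2 Gauss_dvdpr ?(negbTE h) //.
by rewrite irreducible_poly_coprime.
Qed.

(** [P] has odd multiplicity on the left and even multiplicity on the right. The proof is an
    infinite descent: [P] divides [s], then [r], and can be removed from both. *)
Lemma irreducible_mul_nonsquare (F : fieldType) (P g : {poly F}) :
  irreducible_poly P -> ~~ (P %| g) ->
  forall (r s : {poly F}) (c : F), r ^+ 2 * (P * g) = c *: s ^+ 2 -> r = 0.
Proof.
move=> iP Pg r s c; have [n] := ubnP (size r); elim: n r s => // n IH r s rn hrs.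
have [//|r0] := eqVneq r 0.
have P0 : P != 0 by apply: contraNneq Pg => P0; case: iP; rewrite P0 size_poly0.
have g0 : g != 0 by apply: contraNneq Pg => ->; rewrite dvdp0.
have c0 : c != 0.
  apply/eqP=> c0; move/eqP: hrs; rewrite c0 scale0r !mulf_eq0.
  by rewrite (negbTE r0) (negbTE P0) (negbTE g0).
have /dvdpP[s' hs] : P %| s.
  by apply: irreducible_dvdp_sqr => //; rewrite -(dvdpZr _ _ c0) -hrs mulrCA dvdp_mulr.
have h1 : r ^+ 2 * g = c *: (P * s' ^+ 2).
  apply: (mulfI P0); rewrite mulrCA hrs hs -!mul_polyC; ring.
have /dvdpP[r' hr] : P %| r.
  apply: irreducible_dvdp_sqr => //.
  have : P %| r ^+ 2 * g by rewrite h1 dvdpZr // dvdp_mulr.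
  by rewrite mulrC Gauss_dvdpr // irreducible_poly_coprime.
have h2 : r' ^+ 2 * (P * g) = c *: s' ^+ 2.
  by apply: (mulfI P0); rewrite -scalerAr -h1 hr exprMn [P ^+ 2]expr2 mulrCA !mulrA.
have r'0 : r' != 0 by apply: contraNneq r0 => r'0; rewrite hr r'0 mul0r.
have sP : (1 < size P)%N by case: iP.
have := IH r' s' _ h2; rewrite hr => -> //; first by rewrite mul0r.
move: rn; rewrite hr size_mul //; move: r'0; rewrite -size_poly_gt0.
by move: sP; case: (size P) => [|[|a]] // _; move: (size r') => b b0; lia.
Qed.

(** * Compositions of two quadratics *)

Section BoolWords.

Variables (F : finFieldType) (b c : bool -> F).
Hypothesis oF : odd #|F|.
Let f i := quadratic (b i) (c i).
Hypothesis f_neq : f false != f true.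

(** The difference of squares factors, and the factor with [G + H] has positive degree since its
    leading coefficient is 2; as the product is constant, the other factor is 0. A constant [k], not
    just 0, is allowed so that the lemma can be applied again to the inner words. *)
Lemma quad_eq_const (i j : bool) (G H : {poly F}) (k : F) :
  G \is monic -> H \is monic -> size G = size H -> (1 < size G)%N ->
  (f i \Po G) - (f j \Po H) = k%:P -> G - H = (b i - b j)%:P /\ k = c i - c j.
Proof.
move=> mG mH sGH sG.
have e u v (K : {poly F}) : quadratic u v \Po K = (K - u%:P) ^+ 2 + v%:P.
  by rewrite /quadratic comp_polyD rmorphXn /= comp_polyB comp_polyX !comp_polyC.
have two0 : (2%:R : F) != 0.
  by rewrite mulr2n addr_eq0 (one_neqN1 oF).
rewrite /f !e => h.
have h1 : (G - H - (b i - b j)%:P) * (G + H - (b i + b j)%:P) = (k - c i + c j)%:P.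
  rewrite !polyCD polyCN -h !polyCN; ring.
have sS : size (G + H - (b i + b j)%:P) = size G.
  have sGH2 : size (G + H) = size G.
    apply/eqP; rewrite eqn_leq; apply/andP; split.
      by apply: leq_trans (size_polyD _ _) _; rewrite -sGH maxnn.
    have : (G + H)`_(size G).-1 != 0.
      by rewrite coefD {2}sGH -!lead_coefE (monicP mG) (monicP mH).
    move=> hc; have := contra (fun h => introT eqP (nth_default 0 h)) hc.
    by rewrite -ltnNge prednK // ltnW.
  rewrite size_polyDl ?sGH2 // size_polyN; apply: leq_ltn_trans (size_polyC_leq1 _) _.
  by [].
have S0 : G + H - (b i + b j)%:P != 0 by rewrite -size_poly_gt0 sS ltnW.
have [D0|D0] := eqVneq (G - H - (b i - b j)%:P) 0.
  split; first by apply/eqP; rewrite -subr_eq0 D0.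
  move/eqP: h1; rewrite D0 mul0r eq_sym polyC_eq0 => /eqP h1.
  by apply/eqP; rewrite -subr_eq0 -[X in _ == X]h1; apply/eqP; ring.
have := size_mul D0 S0; rewrite h1 sS => hs.
have := size_polyC_leq1 (k - c i + c j); rewrite hs.
move: D0 sG; rewrite -size_poly_gt0; move: (size (G - H - _)) (size G) => x y; lia.
Qed.

(** If the outermost letters differ, the [c] agree, so the [b] differ, and the inner words differ by
    the constant [b i - b j]. One level further in, this constant is a difference of two [c], that
    is 0; for empty inner words it is 0 at once. *)
Lemma comp_along_inj (s t : seq bool) :
  size s = size t -> comp_along f s = comp_along f t -> s = t.
Proof.
elim: s t => [|i s IH] [|j t] //= [st] hst.
have hm w : comp_along f w \is monic by apply: comp_along_monic.
have hs w : size (comp_along f w) = (2 ^ size w).+1 by apply: size_comp_along.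
have hp w : (1 < size (comp_along f w))%N by rewrite hs ltnS expn_gt0.
have sst : size (comp_along f s) = size (comp_along f t) by rewrite !hs st.
have hst0 : (f i \Po comp_along f s) - (f j \Po comp_along f t) = 0%:P.
  by rewrite -/(comp_along f (i :: s)) [X in X - _]hst subrr.
have [h1 h2] := quad_eq_const (hm s) (hm t) sst (hp s) hst0.
have bij : c i = c j by apply/eqP; rewrite -subr_eq0 -h2.
suff ij : i = j.
  by rewrite ij (IH t st) //; apply/eqP; rewrite -subr_eq0 h1 ij subrr.
apply/eqP/negPn/negP => ij.
have cc x y : c x = c y.
  by move: ij bij; move: (i) (j) => [] [] // _ cij; case: x; case: y.
suff bb : b i = b j.
  case/negP: f_neq; apply/eqP; rewrite /f (cc false true); congr (quadratic _ _).
  by move: ij bb; move: (i) (j) => [] [].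
apply/eqP; rewrite -subr_eq0.
case: s t st h1 {IH hst sst hst0} => [|i' s] [|j' t] //= st h1.
  by move/eqP: h1; rewrite subrr eq_sym polyC_eq0.
have sst' : size (comp_along f s) = size (comp_along f t) by case: st => st; rewrite !hs st.
have [_ ->] := quad_eq_const (hm s) (hm t) sst' (hp s) h1.
by rewrite (cc i' j') subrr.
Qed.

Hypothesis DI : forall s, s != [::] -> irreducible_poly (comp_along f s).
Variable l : nat.
Hypothesis lq1 : (l * l <= #|F|)%N.
Hypothesis lq2 : (#|F| <= l * l + 2 * l)%N.

Section Words.
Variable N : nat.
Hypothesis N0 : (0 < N)%N.
Local Notation words := (N.-tuple bool).
Let G (w : words) := comp_along f w.

Lemma word_neq0 (w : words) : tval w != [::].
Proof. by rewrite -size_eq0 size_tuple -lt0n. Qed.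

Lemma word_irr w : irreducible_poly (G w).
Proof. exact/DI/word_neq0. Qed.

Lemma word_size w : size (G w) = (2 ^ N).+1.
Proof. by rewrite size_comp_along size_tuple. Qed.

Lemma word_horner0 w : (G w).[0] != 0.
Proof.
apply/negP=> h; have [_ /(_ 'X)] := word_irr w.
rewrite size_polyX -[X in X %| _]subr0 -polyC0 dvdp_XsubCl /root h.
move=> /(_ isT isT) /eqp_size; rewrite size_polyX word_size => -[].
have := ltn_expl N (isT : 1 < 2)%N; move: N0; move: (2 ^ N)%N => x; lia.
Qed.

(** The product has degree at most [2 ^ N * 2 ^ N]. A word [w0] of the set provides the simple
    irreducible factor: distinct words give distinct monic irreducibles of equal degree, so [G w0]
    is prime to the rest. *)
Lemma subset_sum_bound (A : {ffun words -> bool}) :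
  (exists w, A w) ->
  `|\sum_x chi (\prod_(w | A w) G w).[x]| <= (21 * ((2 ^ N * 2 ^ N) * l))%N%:Z.
Proof.
case=> w0 Aw0; set P := \prod_(w | A w) G w.
pose k := #|[pred w | A w]|.
have kN : (k <= 2 ^ N)%N.
  by apply: leq_trans (max_card _) _; rewrite card_tuple card_bool.
have k0 : (0 < k)%N by apply/card_gt0P; exists w0.
have sP : size P = (k * 2 ^ N).+1.
  rewrite /P size_prod => [|w _]; last by rewrite -size_poly_eq0 word_size.
  under eq_bigr do rewrite word_size.
  rewrite sum_nat_const -/k mulnS; move: (k * 2 ^ N)%N => z.
  by rewrite -addnS addKn.
have km : (0 < k * 2 ^ N)%N by rewrite muln_gt0 k0 expn_gt0.
have P00 : P.[0] != 0.
  by rewrite /P horner_prod; apply/prodf_neq0 => w _; apply: word_horner0.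
apply: le_trans (chi_sum_bound oF km sP P00 _ lq1 lq2) _; last first.
  by rewrite lez_nat leq_mul2l /= leq_mul2r leq_mul2r kN !orbT.
rewrite /P (bigD1 w0) //=; apply: irreducible_mul_nonsquare (word_irr w0) _.
rewrite -irreducible_poly_coprime; last exact: word_irr.
rewrite coprimep_sym; elim/big_rec: _ => [|w Q /andP[_ ww0] IH]; first exact: coprime1p.
rewrite coprimepMl IH andbT irreducible_poly_coprime; last exact: word_irr.
apply: contra ww0 => hd; apply/eqP/val_inj/comp_along_inj; rewrite ?size_tuple //.
have : G w %= G w0 by rewrite -dvdp_size_eqp // !word_size.
by rewrite eqp_monic ?comp_along_monic // => /eqP.
Qed.

Lemma nonsquare_set_bound (A : {set F}) :
  (forall u w, u \in A -> ~~ is_square (G w).[u]) ->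
  (#|A| * 2 ^ (2 ^ N) <= #|F| + 2 ^ (2 ^ N) * (21 * ((2 ^ N * 2 ^ N) * l)))%N.
Proof.
move=> hA; set B := (21 * _)%N.
have chiN u w : u \in A -> chi (G w).[u] = -1.
  move=> uA; have := hA u w uA; rewrite /chi => ns; rewrite (negbTE ns).
  by case: eqP => // z; move: ns; rewrite z is_square0.
rewrite -lez_nat.
have cW : #|{: words}| = (2 ^ N)%N by rewrite card_tuple card_bool.
(* Every factor [1 - chi] is nonnegative, and on [A] all of them equal 2. *)
apply: (@le_trans _ _ (\sum_x \prod_(w : words) (1 - chi (G w).[x]))).
  rewrite (bigID (mem A)) /= -[X in X <= _]addr0 lerD //; last first.
    apply: sumr_ge0 => x _; apply: prodr_ge0 => w _.
    by rewrite /chi; case: ifP => // _; case: ifP.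
  rewrite (eq_bigr (fun=> (2 ^ (2 ^ N))%N%:Z)) => [|x xA].
    by rewrite sumr_const PoszM mulrC -mulr_natr natz.
  rewrite (eq_bigr (fun=> 2%:Z)) => [|w _]; last by rewrite chiN.
  by rewrite prodr_const cW -natz -!natrX natz.
(* [S w] tells whether the term [- chi] or the term 1 is taken from the factor of [w]. *)
pose H x (w : words) (j : bool) := if j then - chi (G w).[x] else 1.
have -> : \sum_x \prod_(w : words) (1 - chi (G w).[x]) =
   \sum_(S : {ffun words -> bool}) \sum_x \prod_w H x w (S w).
  rewrite exchange_big /=; apply: eq_bigr => x _.
  rewrite -bigA_distr_bigA; apply: eq_bigr => w _.
  by rewrite big_bool /H /= addrC.
have hS (S : {ffun words -> bool}) : \sum_x \prod_w H x w (S w) =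
    (\prod_(w | S w) -1) * \sum_x chi (\prod_(w | S w) G w).[x].
  rewrite mulr_sumr; apply: eq_bigr => x _.
  rewrite (bigID S) /= [X in _ * X]big1 => [|w /negbTE]; last by rewrite /H => ->.
  rewrite mulr1 horner_prod (big_morph (@chi F) (fun x y => chiM x y oF) (chi1 F)).
  rewrite -big_split /=; apply: eq_bigr => w; rewrite /H => ->.
  by rewrite mulN1r.
have hb (S : {ffun words -> bool}) :
    \sum_x \prod_w H x w (S w) <= (if S == [ffun=> false] then #|F| else B)%:Z.
  rewrite hS; apply: le_trans (ler_norm _) _; rewrite normrM normr_prod.
  rewrite big1 => [|w _]; last by rewrite normrN1.
  rewrite mul1r; case: eqP => [->|hS0].
    have -> : \prod_(w | [ffun=> false] w) G w = 1.
      by apply: big_pred0 => w; rewrite ffunE.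
    by under eq_bigr do rewrite hornerC chi1; rewrite sumr_const normr_nat natz.
  apply: subset_sum_bound; apply/existsP; apply: contra_notT hS0 => /existsPn h.
  by apply/ffunP => w; rewrite ffunE; apply/negbTE.
apply: le_trans (ler_sum _ (fun S _ => hb S)) _.
rewrite (bigD1 [ffun=> false]) //= eqxx PoszD lerD2l.
apply: le_trans (_ : \sum_(S : {ffun words -> bool}) B%:Z <= _); last first.
  by rewrite sumr_const card_ffun cW card_bool PoszM mulrC -mulr_natr natz.
rewrite [X in _ <= X](bigD1 [ffun=> false]) //= -[X in X <= _]add0r lerD //.
by apply: ler_sum => S /negbTE ->.
Qed.
End Words.

End BoolWords.

Definition reachable (F : finFieldType) (I : Type) (b c : I -> F) (u : F) : Prop :=
  exists (s : seq I) (j : I), u = (comp_along (fun i => quadratic (b i) (c i)) s).[c j].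

Lemma orbit_bound (F : finFieldType) (I : Type) (b c : I -> F) (i0 i1 : I)
    (L l : nat) (A : {set F}) :
  odd #|F| -> quadratic (b i0) (c i0) != quadratic (b i1) (c i1) ->
  dynamically_irreducible (fun i => quadratic (b i) (c i)) ->
  (#|F| <= 2 ^ L)%N -> (1 < L)%N -> (l * l <= #|F|)%N -> (#|F| <= l * l + 2 * l)%N ->
  (forall u, u \in A -> reachable b c u) ->
  (#|A| <= 1 + 84 * (L * L * l))%N.
Proof.
move=> oF neq DI qL L1 lq1 lq2 hA.
(* [L <= 2 ^ N <= 2 * L]: the lower bound gives [2 ^ (2 ^ N) >= q], the upper one
   [4 ^ N <= 4 * L ^ 2], whence [84 = 21 * 4]. *)
have /andP[N1 N2] := up_log_bounds (isT : 1 < 2)%N L1.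
set N := up_log 2 L in N1 N2.
have N0 : (0 < N)%N by case: (N) N2 => //; rewrite expn0 leqNgt L1.
pose e (x : bool) := if x then i1 else i0.
pose f' x := quadratic (b (e x)) (c (e x)).
have emap w : comp_along f' w = comp_along (fun i => quadratic (b i) (c i)) (map e w).
  by elim: w => //= x w ->.
have DI' s : s != [::] -> irreducible_poly (comp_along f' s).
  by case: s => // x s _; rewrite emap; apply: DI.
(* A word applied to a point of the orbit is a longer, nonempty word applied to some [c j]. *)
have ns u (w : N.-tuple bool) : u \in A -> ~~ is_square (comp_along f' w).[u].
  case/hA=> s [j ->]; rewrite emap -horner_comp -comp_along_cat.
  have : size w = N by rewrite size_tuple.
  case: (tval w) => [/= N00|x w' _]; first by move: N0; rewrite -N00.
  by have [_ /(_ (e x) (map e w' ++ s) j)] := (dynamically_irreducibleP _ _ oF).1 DI.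
have h := @nonsquare_set_bound F (b \o e) (c \o e) oF neq DI' l lq1 lq2 N N0 A ns.
have h1 : (2 ^ N * 2 ^ N <= 4 * (L * L))%N.
  have h2 : (2 ^ N <= 2 * L)%N.
    by rewrite -(prednK N0) expnS leq_mul2l /= ltnW.
  by apply: leq_trans (leq_mul h2 h2) _; rewrite mulnACA.
have h3 : (#|F| <= 2 ^ (2 ^ N))%N by apply: leq_trans qL _; rewrite leq_exp2l.
rewrite -(leq_pmul2r (_ : 0 < 2 ^ (2 ^ N))%N) ?expn_gt0 //.
apply: leq_trans h _; rewrite mulnDl mul1n leq_add // mulnC leq_mul2r; apply/orP; right.
have := leq_mul h1 (leqnn l); lia.
Qed.

Local Open Scope nat_scope.

(** * Programs

    Pointer registers:
    - 0: the answer; 1, 2, 3, 20, 21: the constants 1, 2, 3, 4, 0;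
    - 4: [r]; 22: [r - 1]; 5: [q]; 6: the bit length [Len] of [q]; 7: the integral
      part of [sqrt q];
    - 8: [LIM], the end of the tree and the start of the table of powers of 2;
      9: [LIM + Len], the bottom of the stack; 23: [LIM + Len + 1];
    - 10: the first free node; 11: the end of the node under
      examination; 12: the index of a polynomial; 13: the root of the tree;
    - 14: the current node, or scratch; 15: the top of the stack; 16-18: scratch;
      19: scratch, and whether the searched key was found.

    Field registers:
    - 0: the element to be tested or inserted; 1: the element whose images are
      formed; 2: scratch; 3: the accumulator of the exponentiation; 4: -1; 5: 0. *)

Notation reg i := (inord i : 'I_24).

Definition upd (T : Type) (f : nat -> T) (a : nat) (v : T) : nat -> T :=
  fun i => if i == a then v else f i.

(** Registers given by functions on all numbers, so that reading after updates at numerals reduces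
    by computation. *)
Definition mkst (F : Type) (f : nat -> F) (p : nat -> nat) (m : nat -> F + nat) :
  state 24 F := State (fun i => f i) (fun i => p i) m.

(** The closing [Skip] costs no operation. *)
Definition seqp (ps : seq (prog 24)) : prog 24 := foldr (@Seq 24) Skip ps.

Section Runs.

Context (F : finFieldType) (le : rel F) (r : nat) (b c : 'I_r -> F) (M W : nat).
Local Notation state := (state 24 F).
Local Notation step := (step b c M W).
Local Notation exec := (exec le b c M W).
Implicit Types (f : nat -> F) (p : nat -> nat) (m : nat -> F + nat).
Implicit Types (Q : state -> Prop) (ps : seq (prog 24)) (n : nat).

(** Total correctness with a time bound. Specifications are chained in continuation style: the
    postcondition of a program is [runs] of the rest. *)
Definition runs (P : prog 24) (s : state) n Q : Prop :=
  exists n' s', [/\ n' <= n, exec P s n' s' & Q s'].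

Lemma runs_weaken P s n n' Q Q' :
  runs P s n Q -> n <= n' -> (forall s, Q s -> Q' s) -> runs P s n' Q'.
Proof.
move=> [k [s' [kn h q]]] nn' QQ; exists k, s'; split => //; last exact: QQ.
exact: leq_trans nn'.
Qed.

Lemma runs_le P s n n' Q : n <= n' -> runs P s n Q -> runs P s n' Q.
Proof. by move=> nn' h; apply: runs_weaken h nn' _. Qed.

Lemma runs_nil s n Q : Q s -> runs (seqp [::]) s n Q.
Proof. by move=> q; exists 0, s; split=> //; constructor. Qed.

Lemma runs_cons P ps s n1 n2 Q :
  runs P s n1 (fun s1 => runs (seqp ps) s1 n2 Q) -> runs (seqp (P :: ps)) s (n1 + n2) Q.
Proof.
move=> [k1 [s1 [k1n h1 [k2 [s2 [k2n h2 q]]]]]]; exists (k1 + k2), s2.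
by split=> //; [apply: leq_add | apply: ExecSeq h1 h2].
Qed.

Lemma runs_do e ps s s' n Q :
  step e s = Some s' -> runs (seqp ps) s' n Q -> runs (seqp (Do e :: ps)) s n.+1 Q.
Proof.
move=> h q; apply: (@runs_cons _ ps s 1 n); exists 1, s'; split=> //.
exact: ExecDo.
Qed.

Lemma runs_if t P1 P2 s n Q :
  (holds le t s -> runs P1 s n Q) -> (~~ holds le t s -> runs P2 s n Q) ->
  runs (If t P1 P2) s n.+1 Q.
Proof.
move=> h1 h2; case h: (holds le t s).
  have [k [s' [kn e q]]] := h1 h; exists k.+1, s'; split=> //.
  by apply: ExecIfTrue; rewrite ?h.
have [k [s' [kn e q]]] := h2 (negbT h); exists k.+1, s'; split=> //.
by apply: ExecIfFalse; rewrite ?h.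
Qed.

(** [j] bounds the remaining iterations; the loop may stop earlier. Each iteration pays 1 for its
    test, and the failing test gives the last 1. *)
Lemma runs_while (I : nat -> state -> Prop) t P cost j s Q :
  (forall j s, I j s -> holds le t s ->
     exists2 j', j = j'.+1 & runs P s cost (I j')) ->
  (forall j s, I j s -> ~~ holds le t s -> Q s) ->
  I j s -> runs (While t P) s (j * cost.+1).+1 Q.
Proof.
move=> hs hq; elim: j s => [|j IH] s Is.
  case ht: (holds le t s); first by have [] := hs _ _ Is ht.
  exists 1, s; split=> //; last by apply: hq Is _; rewrite ht.
  by apply: ExecWhileFalse; rewrite ht.
case ht: (holds le t s); last first.
  exists 1, s; split=> //; last by apply: hq Is _; rewrite ht.
  by apply: ExecWhileFalse; rewrite ht.
have [j' [<-] [n1 [s1 [n1c e1 I1]]]] := hs _ _ Is ht.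
have [n2 [s2 [n2c e2 q]]] := IH s1 I1.
exists (n1 + n2).+1, s2; split=> //; last by apply: ExecWhileTrue e1 e2; rewrite ht.
by rewrite ltnS mulSn addSn -addnS leq_add.
Qed.

Lemma mk_preg f p m a : a < 24 -> preg (mkst f p m) (reg a) = p a.
Proof. by move=> h; rewrite /= inordK. Qed.

Lemma mk_set_preg f p m a n : a < 24 -> n < W ->
  set_preg W (mkst f p m) (reg a) n = Some (mkst f (upd p a n) m).
Proof.
move=> h nW; rewrite /set_preg nW; congr (Some (State _ _ _)).
by apply/funext => i; rewrite /= /upd -val_eqE /= inordK.
Qed.

Lemma mk_set_freg f p m a v : a < 24 ->
  set_freg (mkst f p m) (reg a) v = Some (mkst (upd f a v) p m).
Proof.
move=> h; rewrite /set_freg; congr (Some (State _ _ _)).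
by apply/funext => i; rewrite /= /upd -val_eqE /= inordK.
Qed.

Lemma mk_store f p m a v : a < M ->
  store M (mkst f p m) a v = Some (mkst f p (upd m a v)).
Proof. by move=> h; rewrite /store h. Qed.

Lemma run_PConst ps f p m n Q a v : a < 24 -> v < W ->
  runs (seqp ps) (mkst f (upd p a v) m) n Q ->
  runs (seqp (Do (PConst (reg a) v) :: ps)) (mkst f p m) n.+1 Q.
Proof. by move=> ha hv; apply: runs_do; apply: mk_set_preg. Qed.

Lemma run_InR ps f p m n Q a : a < 24 -> r < W ->
  runs (seqp ps) (mkst f (upd p a r) m) n Q ->
  runs (seqp (Do (InR (reg a)) :: ps)) (mkst f p m) n.+1 Q.
Proof. by move=> ha hv; apply: runs_do; apply: mk_set_preg. Qed.

Lemma run_InQ ps f p m n Q a : a < 24 -> #|F| < W ->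
  runs (seqp ps) (mkst f (upd p a #|F|) m) n Q ->
  runs (seqp (Do (InQ (reg a)) :: ps)) (mkst f p m) n.+1 Q.
Proof. by move=> ha hv; apply: runs_do; apply: mk_set_preg. Qed.

Lemma run_PCopy ps f p m n Q a d : a < 24 -> d < 24 -> p d < W ->
  runs (seqp ps) (mkst f (upd p a (p d)) m) n Q ->
  runs (seqp (Do (PCopy (reg a) (reg d)) :: ps)) (mkst f p m) n.+1 Q.
Proof.
move=> ha hd hv; apply: runs_do; rewrite -[in RHS](mk_preg f p m hd).
by apply: mk_set_preg => //; rewrite mk_preg.
Qed.

Lemma run_PAdd ps f p m n Q a d e : a < 24 -> d < 24 -> e < 24 -> p d + p e < W ->
  runs (seqp ps) (mkst f (upd p a (p d + p e)) m) n Q ->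
  runs (seqp (Do (PAdd (reg a) (reg d) (reg e)) :: ps)) (mkst f p m) n.+1 Q.
Proof.
move=> ha hd he hv; apply: runs_do.
rewrite -[in RHS](mk_preg f p m hd) -[in RHS](mk_preg f p m he).
by apply: mk_set_preg => //; rewrite !mk_preg.
Qed.

Lemma run_PSub ps f p m n Q a d e : a < 24 -> d < 24 -> e < 24 -> p d - p e < W ->
  runs (seqp ps) (mkst f (upd p a (p d - p e)) m) n Q ->
  runs (seqp (Do (PSub (reg a) (reg d) (reg e)) :: ps)) (mkst f p m) n.+1 Q.
Proof.
move=> ha hd he hv; apply: runs_do.
rewrite -[in RHS](mk_preg f p m hd) -[in RHS](mk_preg f p m he).
by apply: mk_set_preg => //; rewrite !mk_preg.
Qed.

Lemma run_PLoad ps f p m n Q d a v : d < 24 -> a < 24 -> p a < M -> m (p a) = inr v -> v < W ->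
  runs (seqp ps) (mkst f (upd p d v) m) n Q ->
  runs (seqp (Do (PLoad (reg d) (reg a)) :: ps)) (mkst f p m) n.+1 Q.
Proof.
move=> hd ha hM hv vW; apply: runs_do => /=.
by rewrite inordK // /load hM /= hv mk_set_preg.
Qed.

Lemma run_PStore ps f p m n Q a d : a < 24 -> d < 24 -> p a < M ->
  runs (seqp ps) (mkst f p (upd m (p a) (inr (p d)))) n Q ->
  runs (seqp (Do (PStore (reg a) (reg d)) :: ps)) (mkst f p m) n.+1 Q.
Proof.
move=> ha hd hM; apply: runs_do => /=.
by rewrite !inordK // mk_store.
Qed.

Lemma run_FLoad ps f p m n Q x a v : x < 24 -> a < 24 -> p a < M -> m (p a) = inl v ->
  runs (seqp ps) (mkst (upd f x v) p m) n Q ->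
  runs (seqp (Do (FLoad (reg x) (reg a)) :: ps)) (mkst f p m) n.+1 Q.
Proof.
move=> hd ha hM hv; apply: runs_do => /=.
by rewrite inordK // /load hM /= hv mk_set_freg.
Qed.

Lemma run_FStore ps f p m n Q a x : a < 24 -> x < 24 -> p a < M ->
  runs (seqp ps) (mkst f p (upd m (p a) (inl (f x)))) n Q ->
  runs (seqp (Do (FStore (reg a) (reg x)) :: ps)) (mkst f p m) n.+1 Q.
Proof.
move=> ha hd hM; apply: runs_do => /=.
by rewrite !inordK // mk_store.
Qed.

Lemma run_FOne ps f p m n Q x : x < 24 ->
  runs (seqp ps) (mkst (upd f x 1%R) p m) n Q ->
  runs (seqp (Do (FOne (reg x)) :: ps)) (mkst f p m) n.+1 Q.
Proof. by move=> hx; apply: runs_do; apply: mk_set_freg. Qed.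

Lemma run_FAdd ps f p m n Q x y z : x < 24 -> y < 24 -> z < 24 ->
  runs (seqp ps) (mkst (upd f x (f y + f z)%R) p m) n Q ->
  runs (seqp (Do (FAdd (reg x) (reg y) (reg z)) :: ps)) (mkst f p m) n.+1 Q.
Proof. by move=> hx hy hz; apply: runs_do; rewrite /= !inordK // mk_set_freg. Qed.

Lemma run_FSub ps f p m n Q x y z : x < 24 -> y < 24 -> z < 24 ->
  runs (seqp ps) (mkst (upd f x (f y - f z)%R) p m) n Q ->
  runs (seqp (Do (FSub (reg x) (reg y) (reg z)) :: ps)) (mkst f p m) n.+1 Q.
Proof. by move=> hx hy hz; apply: runs_do; rewrite /= !inordK // mk_set_freg. Qed.

Lemma run_FMul ps f p m n Q x y z : x < 24 -> y < 24 -> z < 24 ->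
  runs (seqp ps) (mkst (upd f x (f y * f z)%R) p m) n Q ->
  runs (seqp (Do (FMul (reg x) (reg y) (reg z)) :: ps)) (mkst f p m) n.+1 Q.
Proof. by move=> hx hy hz; apply: runs_do; rewrite /= !inordK // mk_set_freg. Qed.

Lemma run_InB ps f p m n Q x a (i : 'I_r) : x < 24 -> a < 24 -> p a = i ->
  runs (seqp ps) (mkst (upd f x (b i)) p m) n Q ->
  runs (seqp (Do (InB (reg x) (reg a)) :: ps)) (mkst f p m) n.+1 Q.
Proof.
by move=> hx ha hi; apply: runs_do; rewrite /= inordK // hi /input valK /= mk_set_freg.
Qed.

Lemma run_InC ps f p m n Q x a (i : 'I_r) : x < 24 -> a < 24 -> p a = i ->
  runs (seqp ps) (mkst (upd f x (c i)) p m) n Q ->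
  runs (seqp (Do (InC (reg x) (reg a)) :: ps)) (mkst f p m) n.+1 Q.
Proof.
by move=> hx ha hi; apply: runs_do; rewrite /= inordK // hi /input valK /= mk_set_freg.
Qed.

Lemma holds_FEq f p m x y : x < 24 -> y < 24 ->
  holds le (FEq (reg x) (reg y)) (mkst f p m) = (f x == f y).
Proof. by move=> hx hy; rewrite /= !inordK. Qed.

Lemma holds_FLe f p m x y : x < 24 -> y < 24 ->
  holds le (FLe (reg x) (reg y)) (mkst f p m) = le (f x) (f y).
Proof. by move=> hx hy; rewrite /= !inordK. Qed.

Lemma holds_PEq f p m a d : a < 24 -> d < 24 ->
  holds le (PEq (reg a) (reg d)) (mkst f p m) = (p a == p d).
Proof. by move=> hx hy; rewrite /= !inordK. Qed.

Lemma holds_PLe f p m a d : a < 24 -> d < 24 ->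
  holds le (PLe (reg a) (reg d)) (mkst f p m) = (p a <= p d).
Proof. by move=> hx hy; rewrite /= !inordK. Qed.

End Runs.

(** * AA trees

    Andersson's balanced search trees: a 2-3 tree in which a 3-node is a node whose
    right child has the same level. *)

(** The first number is the index of the node in memory, the second its level. Keys are kept apart,
    as a function of the index, so that rotations do not concern them; index 0 stands for the absent
    child. *)
Inductive tree := Lf | Nd of nat & nat & tree & tree.

Definition root_id t := if t is Nd i _ _ _ then i else 0.
Definition level t := if t is Nd _ v _ _ then v else 0.
Definition right_child t := if t is Nd _ _ _ r then r else Lf.
(* the root is a 2-node *)
Definition is_two t := level (right_child t) < level t.

Fixpoint inorder t := if t is Nd i _ l r then inorder l ++ i :: inorder r else [::].
Fixpoint depth t := if t is Nd _ _ l r then (maxn (depth l) (depth r)).+1 else 0.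

Fixpoint aa t := if t is Nd _ v l r then
  [&& v == (level l).+1, (level r == v) || ((level r).+1 == v),
      level (right_child r) < v, aa l & aa r] else true.

Definition skew_tree t :=
  if t is Nd i v (Nd j w a b) r then
    if w == v then Nd j w a (Nd i v b r) else t
  else t.

Definition split_tree t :=
  if t is Nd i v l (Nd j w a b) then
    if level b == v then Nd j v.+1 (Nd i v l a) b else t
  else t.

(* A zipper is a list of frames, the innermost first. *)
Inductive frame := FrameL of nat & nat & tree | FrameR of nat & nat & tree.

Definition plug1 t fr :=
  match fr with FrameL i v r => Nd i v t r | FrameR i v l => Nd i v l t end.
Definition plug (z : seq frame) t := foldl plug1 t z.
Definition up (z : seq frame) t := foldl (fun t fr => split_tree (skew_tree (plug1 t fr))) t z.

Fixpoint lefts (z : seq frame) :=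
  match z with
  | [::] => [::]
  | FrameL i v r :: z => lefts z
  | FrameR i v l :: z => lefts z ++ rcons (inorder l) i
  end.
Fixpoint rights (z : seq frame) :=
  match z with
  | [::] => [::]
  | FrameL i v r :: z => (i :: inorder r) ++ rights z
  | FrameR i v l :: z => rights z
  end.

Lemma inorder_plug z t : inorder (plug z t) = lefts z ++ inorder t ++ rights z.
Proof.
elim: z t => [|[i v s|i v s] z IH] t /=; first by rewrite cats0.
  by rewrite IH /= -!catA cat_cons.
by rewrite IH /= -cats1 -!catA.
Qed.

Lemma inorder_skew t : inorder (skew_tree t) = inorder t.
Proof. by case: t => [|i v [|j w a b] r] //=; case: eqP => //= _; rewrite -!catA. Qed.

Lemma inorder_split t : inorder (split_tree t) = inorder t.
Proof. by case: t => [|i v l [|j w a b]] //=; case: eqP => //= _; rewrite -!catA. Qed.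

(* [t0] is a subtree before an insertion, [t] the rebalanced result.  The level
   increases only when a 3-node is split, and the new root is then a 2-node. *)
Definition grows t0 t :=
  aa t && ((level t == level t0) || [&& level t == (level t0).+1, is_two t & ~~ is_two t0]).

Lemma aa_plug z t : aa (plug z t) -> aa t.
Proof. by elim: z t => //= -[i v s|i v s] z IH t /IH /= /and5P[]. Qed.

Lemma aa_right t : aa t -> level (right_child t) <= level t.
Proof. by case: t => //= i v l r /and5P[_ h _ _ _]; lia. Qed.

(** A left subtree that rises to the level of its parent arrives as a 2-node, so [skew_tree] yields
    a right chain with a lower end, and one [split_tree] suffices. A right subtree level with its
    parent was a 2-node, hence cannot rise; it can only become a 3-node, which is split. *)
Lemma grows_step fr t0 t :
  aa (plug1 t0 fr) -> grows t0 t -> grows (plug1 t0 fr) (split_tree (skew_tree (plug1 t fr))).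
Proof.
case: fr => i v s; rewrite /grows /is_two; last first.
  rewrite [plug1 t _]/= [plug1 t0 _]/= [X in is_true X -> _]/= => /and5P[/eqP hv hs hr as_ a0] /andP[at_ hl].
  have -> : skew_tree (Nd i v s t) = Nd i v s t.
    by case: s hv {hs hr as_} => //= j w a b ->; rewrite ltn_eqF.
  case: t at_ hl => [|j w a b] /=; first by move=> _ hl; rewrite as_; lia.
  move=> /and5P[hw h1 h2 aa_ ab] hl.
  by have ra := aa_right aa_; case: eqP => e /=; rewrite as_ aa_ ab; lia.
move=> /= /and5P[/eqP hv hs hr a0 as_] /andP[at_ hl].
  case: t at_ hl => [|j w a b] /=.
    move=> _ /orP[/eqP h|//].
    by case: s hs hr as_ => [|k u p q] /= hs hr as_; rewrite ?(ltn_eqF hr) /=; lia.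
  move=> /and5P[hw h1 h2 aa_ ab] hl.
  have rb := aa_right ab; case: (w =P v) => [wv|wv]; [subst w | ]; case: s hs hr as_ => [|k u p q] /=.
  - by move=> hs hr _; case: eqP => /= e; lia.
  - by move=> hs hr /and5P[k1 k2 k3 k4 k5]; case: (u =P v) => [uv|uv] /=; lia.
  - by move=> hs hr _; lia.
  - by move=> hs hr /and5P[k1 k2 k3 k4 k5]; rewrite ltn_eqF //=; lia.
Qed.

(** A path meets at most two nodes of each level, and only one at the top if the root is a 2-node.
    With [aa_size] the depth is at most twice the binary logarithm of the number of nodes plus 1. *)
Lemma aa_depth t : aa t -> depth t + is_two t <= 2 * level t.
Proof.
rewrite /is_two; elim: t => //= i v l IHl r IHr /and5P[/eqP hv hs hr /IHl {}IHl /IHr {}IHr].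
move: hs hr IHl IHr; case: (level r < v) /idP; lia.
Qed.

Lemma aa_size t : aa t -> 2 ^ level t <= (size (inorder t)).+1.
Proof.
elim: t => //= i v l IHl r IHr /and5P[/eqP hv hs hr /IHl {}IHl /IHr {}IHr].
rewrite size_cat /= hv expnS.
have : 2 ^ level l <= 2 ^ level r by rewrite leq_exp2l //; lia.
by move: (2 ^ level l) (2 ^ level r) IHl IHr; lia.
Qed.

Lemma plug_depth z t : size z + depth t <= depth (plug z t).
Proof.
elim: z t => //= fr z IH t; have := IH (plug1 t fr).
have : depth t < depth (plug1 t fr) by case: fr => i v s /=; rewrite ltnS ?leq_maxl ?leq_maxr.
lia.
Qed.

Section Represent.
Implicit Types (L R V : nat -> nat).

Fixpoint rep L R V t : Prop := if t is Nd i v l r then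
  [/\ L i = root_id l, R i = root_id r, V i = v, rep L R V l & rep L R V r] else True.

(** The link of a frame towards the hole is left open: on the way up it is overwritten with the root
    of the rebuilt subtree. *)
Fixpoint repz L R V z : Prop :=
  match z with
  | [::] => True
  | FrameL i v r :: z => [/\ R i = root_id r, V i = v, rep L R V r & repz L R V z]
  | FrameR i v l :: z => [/\ L i = root_id l, V i = v, rep L R V l & repz L R V z]
  end.

Lemma rep_plug L R V z t : rep L R V (plug z t) -> rep L R V t /\ repz L R V z.
Proof. by elim: z t => [|[i v s|i v s] z IH] t //= /IH[] [*]. Qed.

Lemma rep_eq L R V L' R' V' t :
  {in inorder t, L' =1 L} -> {in inorder t, R' =1 R} -> {in inorder t, V' =1 V} ->
  rep L R V t -> rep L' R' V' t.
Proof.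
elim: t => //= i v l IHl r IHr hL hR hV [e1 e2 e3 e4 e5].
have hi : i \in inorder l ++ i :: inorder r by rewrite mem_cat mem_head orbT.
have il j : j \in inorder l -> j \in inorder l ++ i :: inorder r by rewrite mem_cat => ->.
have ir j : j \in inorder r -> j \in inorder l ++ i :: inorder r.
  by rewrite mem_cat in_cons => ->; rewrite !orbT.
split; rewrite ?hL ?hR ?hV //.
  by apply: IHl => // j /il; [apply: hL | apply: hR | apply: hV].
by apply: IHr => // j /ir; [apply: hL | apply: hR | apply: hV].
Qed.

Lemma repz_eq L R V L' R' V' z :
  {in lefts z ++ rights z, L' =1 L} -> {in lefts z ++ rights z, R' =1 R} ->
  {in lefts z ++ rights z, V' =1 V} -> repz L R V z -> repz L' R' V' z.
Proof.
elim: z => //= -[i v s|i v s] z IH hL hR hV /=.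
  have hi : i \in lefts z ++ i :: inorder s ++ rights z by rewrite mem_cat mem_head orbT.
  have hs j : j \in inorder s -> j \in lefts z ++ i :: inorder s ++ rights z.
    by rewrite mem_cat in_cons mem_cat => ->; rewrite !orbT.
  have hz j : j \in lefts z ++ rights z -> j \in lefts z ++ i :: inorder s ++ rights z.
    by rewrite !mem_cat in_cons mem_cat => /orP[] ->; rewrite ?orbT.
  case=> e2 e3 e4 e5; split; rewrite ?hR ?hV //.
    by apply: rep_eq e4 => // j /hs; [apply: hL | apply: hR | apply: hV].
  by apply: IH e5 => // j /hz; [apply: hL | apply: hR | apply: hV].
have hi : i \in (lefts z ++ rcons (inorder s) i) ++ rights z.
  by rewrite !mem_cat mem_rcons mem_head orbT.
have hs j : j \in inorder s -> j \in (lefts z ++ rcons (inorder s) i) ++ rights z.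
  by rewrite !mem_cat mem_rcons in_cons => ->; rewrite !orbT.
have hz j : j \in lefts z ++ rights z -> j \in (lefts z ++ rcons (inorder s) i) ++ rights z.
  by rewrite !mem_cat => /orP[] ->; rewrite ?orbT.
case=> e2 e3 e4 e5; split; rewrite ?hL ?hV //.
  by apply: rep_eq e4 => // j /hs; [apply: hL | apply: hR | apply: hV].
by apply: IH e5 => // j /hz; [apply: hL | apply: hR | apply: hV].
Qed.

Lemma upd_eq (T : Type) (f : nat -> T) a v : upd f a v a = v.
Proof. by rewrite /upd eqxx. Qed.

Lemma upd_neq (T : Type) (f : nat -> T) a v i : i != a -> upd f a v i = f i.
Proof. by rewrite /upd => /negbTE ->. Qed.

Lemma upd_in (T : Type) (f : nat -> T) a v (s : seq nat) :
  a \notin s -> {in s, upd f a v =1 f}.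
Proof. by move=> h i hi; rewrite upd_neq //; apply: contraNneq h => <-. Qed.

(* [V 0 = 0] makes the absent child count as a node of level 0. *)
Lemma rep_skew L R V i v l r :
  V 0 = 0 -> 0 < v -> uniq (inorder (Nd i v l r)) -> rep L R V (Nd i v l r) ->
  let t := skew_tree (Nd i v l r) in
  if V (L i) == V i then
    rep (upd L i (R (L i))) (upd R (L i) i) V t /\ root_id t = L i
  else rep L R V t /\ root_id t = i.
Proof.
move=> V0 v0 u [e1 e2 e3 e4 e5] /=.
case: l u e1 e4 => [|j w a b] u e1 e4; rewrite e1 /= ?V0 e3.
  by rewrite ltn_eqF //.
case: e4 => f1 f2 f3 f4 f5; rewrite f3.
case: eqP => [wv|_] //; split=> //.
move: u; rewrite /= -catA cat_uniq => /and3P[ua /hasPn ha].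
rewrite /= mem_cat in_cons => /andP[/norP[jb /norP[ji jr]] ].
rewrite cat_uniq => /and3P[ub /hasPn hb /= /andP[ir ur]].
have ib : i \notin inorder b by apply: hb; rewrite mem_head.
have ia : i \notin inorder a by apply: ha; rewrite in_cons mem_cat mem_head !orbT.
have ja : j \notin inorder a by apply: ha; rewrite mem_head.
split; rewrite ?upd_eq ?(upd_neq _ _ ji) ?f1 ?f3 //.
  by apply: rep_eq f4; apply: upd_in || done.
split; rewrite ?upd_eq ?(upd_neq _ _ (_ : i != j)) 1?eq_sym // ?f2 //.
  by apply: rep_eq f5 => //; apply: upd_in.
by apply: rep_eq e5 => //; apply: upd_in.
Qed.

Lemma rep_split L R V i v l r :
  V 0 = 0 -> R 0 = 0 -> 0 < v -> uniq (inorder (Nd i v l r)) -> rep L R V (Nd i v l r) ->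
  let t := split_tree (Nd i v l r) in
  if V (R (R i)) == V i then
    rep (upd L (R i) i) (upd R i (L (R i))) (upd V (R i) (V i).+1) t /\ root_id t = R i
  else rep L R V t /\ root_id t = i.
Proof.
move=> V0 R0 v0 u [e1 e2 e3 e4 e5] /=.
case: r u e2 e5 => [|j w a b] u e2 e5; rewrite e2 /= ?R0 ?V0 e3.
  by rewrite ltn_eqF //.
case: e5 => f1 f2 f3 f4 f5; rewrite f2.
have -> : V (root_id b) = level b by case: b f5 {u e2 f2} => //= ? ? ? ? [].
case: eqP => [wv|_] //; split=> //.
move: u; rewrite /= cat_uniq => /and3P[ul /hasPn hl].
rewrite /= mem_cat in_cons => /andP[/norP[ia /norP[ij ib]] ].
rewrite cat_uniq => /and3P[ua /hasPn hb /= /andP[jb ub]].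
have ja : j \notin inorder a by apply: hb; rewrite mem_head.
have jl : j \notin inorder l by apply: hl; rewrite in_cons mem_cat mem_head !orbT.
have il : i \notin inorder l by apply: hl; rewrite mem_head.
have ji : j != i by rewrite eq_sym.
split; rewrite ?upd_eq ?(upd_neq _ _ ji) ?f1 ?f3 //.
  split; rewrite ?upd_eq ?(upd_neq _ _ ij) //.
    by apply: rep_eq e4; apply: upd_in.
  by apply: rep_eq f4; apply: upd_in.
by apply: rep_eq f5; apply: upd_in.
Qed.

End Represent.

Definition padd a d e : prog 24 := Do (PAdd (reg a) (reg d) (reg e)).
Definition psub a d e : prog 24 := Do (PSub (reg a) (reg d) (reg e)).
Definition pcopy a d : prog 24 := Do (PCopy (reg a) (reg d)).
Definition pconst a v : prog 24 := Do (PConst (reg a) v).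
Definition pload d a : prog 24 := Do (PLoad (reg d) (reg a)).
Definition pstore a d : prog 24 := Do (PStore (reg a) (reg d)).
Definition fload x a : prog 24 := Do (FLoad (reg x) (reg a)).
Definition fstore a x : prog 24 := Do (FStore (reg a) (reg x)).
Definition fmul x y z : prog 24 := Do (FMul (reg x) (reg y) (reg z)).
Definition fadd x y z : prog 24 := Do (FAdd (reg x) (reg y) (reg z)).
Definition fsub x y z : prog 24 := Do (FSub (reg x) (reg y) (reg z)).

(* Left-to-right binary powering: register 3 holds [x ^+ (q / 2 ^ i)], register 16
   holds [q] modulo [2 ^ i], and [2 ^ i] is read from the table.  The powering stops
   before the lowest bit of [q], at [x ^+ ((q - 1) / 2)]. *)
Definition nonsquare_body : prog 24 := seqp
  [:: psub 17 17 1; fmul 3 3 3; pload 14 17;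
      If (PLe (reg 14) (reg 16)) (seqp [:: psub 16 16 14; fmul 3 3 0]) (seqp [::])].

Definition nonsquare_test : prog 24 := seqp
  [:: Do (FOne (reg 3)); pcopy 16 5; pcopy 17 9; padd 18 8 2;
      While (PLe (reg 18) (reg 17)) nonsquare_body;
      If (FEq (reg 3) (reg 4)) (seqp [::]) (seqp [:: pcopy 0 21])].

Ltac rd := rewrite ?/upd /=.
Ltac istep := match goal with
  | |- runs _ _ _ _ _ (seqp (Do (FOne _) :: _)) _ _ _ => apply: run_FOne; first by []
  | |- runs _ _ _ _ _ (seqp (pcopy _ _ :: _)) _ _ _ => apply: run_PCopy; [by []|by []|rd|]
  | |- runs _ _ _ _ _ (seqp (pconst _ _ :: _)) _ _ _ => apply: run_PConst; [by []|rd|]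
  | |- runs _ _ _ _ _ (seqp (padd _ _ _ :: _)) _ _ _ => apply: run_PAdd; [by []|by []|by []|rd|]
  | |- runs _ _ _ _ _ (seqp (psub _ _ _ :: _)) _ _ _ => apply: run_PSub; [by []|by []|by []|rd|]
  | |- runs _ _ _ _ _ (seqp (fmul _ _ _ :: _)) _ _ _ => apply: run_FMul; [by []|by []|by []|]
  | |- runs _ _ _ _ _ (seqp (fadd _ _ _ :: _)) _ _ _ => apply: run_FAdd; [by []|by []|by []|]
  | |- runs _ _ _ _ _ (seqp (fsub _ _ _ :: _)) _ _ _ => apply: run_FSub; [by []|by []|by []|]
  | |- runs _ _ _ _ _ (seqp (pstore _ _ :: _)) _ _ _ => apply: run_PStore; [by []|by []|rd|]
  | |- runs _ _ _ _ _ (seqp (fstore _ _ :: _)) _ _ _ => apply: run_FStore; [by []|by []|rd|]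
  end.

(** Frame condition: [X] lists the registers that a program may alter. *)
Definition eqx (T : Type) (X : seq nat) (p p' : nat -> T) := forall i, i \notin X -> p' i = p i.

Lemma eqx_refl (T : Type) X (p : nat -> T) : eqx X p p.
Proof. by []. Qed.

Lemma eqx_upd (T : Type) X (p p' : nat -> T) a v :
  a \in X -> eqx X p p' -> eqx X p (upd p' a v).
Proof. by move=> aX h i iX; rewrite upd_neq ?h //; apply: contraNneq iX => ->. Qed.

Lemma eqx_trans (T : Type) X (p p' p'' : nat -> T) :
  eqx X p p' -> eqx X p' p'' -> eqx X p p''.
Proof. by move=> h h' i iX; rewrite h' ?h. Qed.

Lemma eqx_sub (T : Type) X Y (p p' : nat -> T) :
  all (fun i => i \in Y) X -> eqx X p p' -> eqx Y p p'.
Proof. by move=> /allP h e i iY; apply: e; apply: contra iY => /h. Qed.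

Ltac eqxt := repeat (apply: eqx_upd; first by []); first [exact: eqx_refl | assumption | idtac].

(** One step of the powering loop, with [d] a power of 2: the comparison finds the bit to be
    appended to the exponent and removes it from the remainder. *)
Lemma divn_bit n d : 0 < d ->
  n %/ d = 2 * (n %/ (2 * d)) + (d <= n %% (2 * d)) /\
  n %% d = n %% (2 * d) - (d <= n %% (2 * d)) * d.
Proof.
move=> d0; set x := n %/ (2 * d); set y := n %% (2 * d); set e := nat_of_bool _.
have y2 : y < 2 * d by rewrite ltn_mod muln_gt0.
have ye : y - e * d < d /\ e * d <= y.
  by rewrite /e; case: (leqP d y) => h; rewrite ?mul1n ?mul0n; lia.
have -> : n = (2 * x + e) * d + (y - e * d).
  by rewrite {1}(divn_eq n (2 * d)) -/x -/y mulnDl -addnA subnKC; [lia | case: ye].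
by rewrite divnMDl // modnMDl divn_small ?modn_small ?addn0; case: ye.
Qed.

Section Verify.

Context (F : finFieldType) (le : rel F) (r : nat) (b c : 'I_r -> F) (M W : nat).
Context (Len LIM : nat).
Local Notation STK := (LIM + Len).
Local Notation q := #|F|.
Local Notation runs := (runs le b c M W).
Hypothesis Len1 : 1 <= Len.
Hypothesis qLen : q < 2 ^ Len.
Hypothesis lenq : 2 ^ Len <= 2 * q.
Hypothesis STK_M : STK + 2 < M.
Hypothesis MW : M <= W.
Hypothesis qW : 4 * q < W.
Hypothesis rW : r.+1 < W.

Definition konst (f : nat -> F) (p : nat -> nat) : Prop :=
  [/\ p 1 = 1, p 2 = 2, p 3 = 3 & p 4 = r] /\ [/\ p 5 = q, p 8 = LIM, p 9 = STK & p 20 = 4] /\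
  [/\ p 21 = 0, p 22 = r.-1, p 23 = STK.+1, f 4 = (-1)%R & f 5 = 0%R].

Lemma konst_eqx X Y f p f' p' :
  all (fun i => i \notin X) [:: 1; 2; 3; 4; 5; 8; 9; 20; 21; 22; 23] ->
  all (fun i => i \notin Y) [:: 4; 5] -> eqx X p p' -> eqx Y f f' -> konst f p -> konst f' p'.
Proof.
move=> /allP hX /allP hY ep ef [[? ? ? ?] [[? ? ? ?] [? ? ? ? ?]]].
have h i : i \in [:: 1; 2; 3; 4; 5; 8; 9; 20; 21; 22; 23] -> p' i = p i.
  by move=> hi; apply: ep; apply: (hX i hi).
have h' i : i \in [:: 4; 5] -> f' i = f i by move=> hi; apply: ef; apply: (hY i hi).
by rewrite /konst !h // !h'.
Qed.

Definition table (m : nat -> F + nat) := forall i, i < Len -> m (LIM + i) = inr (2 ^ i).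

(** The answer register is cleared or left alone, never set, so that it accumulates the conjunction
    of all tests. *)
Lemma nonsquare_test_spec f p m : konst f p -> table m ->
  runs nonsquare_test (mkst f p m) (7 * Len + 10) (fun s => exists f' p',
    [/\ s = mkst f' p' m, eqx [:: 0; 14; 16; 17; 18] p p', eqx [:: 3] f f'
      & p' 0 = if (f 0 ^+ (q./2) == -1)%R then p 0 else 0]).
Proof.
move=> [[k1 k2 k3 k4] [[k5 k8 k9 k20] [k21 k22 k23 kf4 kf5]]] tb.
have pw : 2 ^ Len <= 2 * q by [].
apply: (@runs_le _ _ _ _ _ _ _ _ _ (4 + ((Len.-1 * 7).+1 + 2))); first by lia.
rewrite /nonsquare_test.
istep.
istep; first by lia.
istep; first by lia.
istep; first by lia.
apply: runs_cons.
pose I j s := exists f' p',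
  [/\ s = mkst f' p' m, eqx [:: 0; 14; 16; 17; 18] p p', eqx [:: 3] f f' &
   [/\ p' 0 = p 0, p' 17 = LIM + j.+1, p' 18 = LIM + 2, j < Len &
       p' 16 = q %% 2 ^ j.+1 /\ f' 3 = (f 0 ^+ (q %/ 2 ^ j.+1))%R]].
apply: (runs_while (I := I) (cost := 6) (j := Len.-1)).
- move=> j _ [f' [p' [-> ep ef [e0 e17 e18 jL [e16 e3]]]]].
  rewrite holds_PLe // e17 e18 => hj; case: j e17 e3 e16 jL hj => [|j] e17 e3 e16 jL hj; first by lia.
  exists j => //; rewrite /nonsquare_body.
  have k1' : p' 1 = 1 by rewrite ep.
  have lt : 2 ^ j.+1 < W.
    apply: (@leq_ltn_trans (2 ^ Len)); [by rewrite leq_exp2l // ltnW | lia].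
  istep; first by lia.
  istep.
  have ej : upd p' 17 (p' 17 - p' 1) 17 = LIM + j.+1 by rd; rewrite k1' e17; lia.
  apply: (run_PLoad (v := 2 ^ j.+1)) => //.
  - by rewrite ej; lia.
  - by rewrite ej tb // ltnW.
  apply: (@runs_cons _ _ _ _ _ _ _ _ _ _ 3 0).
  have dq : q %/ 2 ^ j.+1 = 2 * (q %/ 2 ^ j.+2) + (2 ^ j.+1 <= q %% 2 ^ j.+2).
    by rewrite (expnS 2 j.+1); case: (divn_bit q (_ : 0 < 2 ^ j.+1)); rewrite ?expn_gt0.
  have mq : q %% 2 ^ j.+1 = q %% 2 ^ j.+2 - (2 ^ j.+1 <= q %% 2 ^ j.+2) * 2 ^ j.+1.
    by rewrite (expnS 2 j.+1); case: (divn_bit q (_ : 0 < 2 ^ j.+1)); rewrite ?expn_gt0.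
  apply: runs_if; rewrite holds_PLe // => hl;
    [have {}hl : 2 ^ j.+1 <= q %% 2 ^ j.+2 by move: hl; rd; rewrite e16
    |have {}hl : ~~ (2 ^ j.+1 <= q %% 2 ^ j.+2) by move: hl; rd; rewrite e16].
    istep; first by rewrite e16; lia.
    istep. apply: runs_nil. apply: runs_nil.
    eexists _, _; split; first reflexivity; [by eqxt|by eqxt|].
    split; rd; rewrite ?e0 ?e18 ?e17 ?k1' //; [lia|lia|].
    rewrite e16 mq hl mul1n; split=> //; rewrite dq hl exprD e3 expr1.
    by rewrite mulnC exprM expr2 ef.
  apply: runs_nil. apply: runs_nil.
  eexists _, _; split; first reflexivity; [by eqxt|by eqxt|].
  split; rd; rewrite ?e0 ?e18 ?e17 ?k1' //; [lia|lia|].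
  rewrite e16 mq (negbTE hl) mul0n subn0; split=> //.
  by rewrite dq (negbTE hl) addn0 e3 mulnC exprM expr2.
- move=> j _ [f' [p' [-> ep ef [e0 e17 e18 jL [e16 e3]]]]].
  rewrite holds_PLe // e17 e18 => hj; have j0 : j = 0 by lia.
  apply: (@runs_cons _ _ _ _ _ _ _ _ _ _ 2 0).
  have e3' : f' 3 = (f 0 ^+ q./2)%R by rewrite e3 j0 divn2.
  have e4' : f' 4 = (-1)%R by rewrite ef.
  apply: runs_if; rewrite holds_FEq // e3' e4' => hh.
    by apply: runs_nil; apply: runs_nil; exists f', p'; split => //; rewrite hh.
  istep; first by rewrite ep // k21; lia.
  apply: runs_nil; apply: runs_nil; eexists _, _; split; first reflexivity; [by eqxt|by eqxt|].
  by rewrite (negbTE hh); rd; rewrite ep.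
- eexists _, _; split; first reflexivity; [by eqxt|by eqxt|].
  split; rd; rewrite ?k5 ?k8 ?k9 ?k2 //; [lia|lia|].
  by rewrite prednK // modn_small // divn_small // expr0.
Qed.
End Verify.

(** * The tree in memory

    The node [i >= 1] occupies the addresses [4 i], ..., [4 i + 3]: key, left child,
    right child and level; children are stored as the addresses of their nodes.  The
    absent child is node 0, of level 0 and without key. *)

Definition skew_code : prog 24 := seqp
  [:: padd 16 14 1; pload 17 16; padd 18 17 3; pload 18 18; padd 19 14 3; pload 19 19;
      If (PEq (reg 18) (reg 19))
        (seqp [:: padd 18 17 2; pload 19 18; pstore 16 19; pstore 18 14; pcopy 14 17])
        (seqp [::])].

Definition split_code : prog 24 := seqp
  [:: padd 16 14 2; pload 17 16; padd 18 17 2; pload 18 18; padd 18 18 3; pload 18 18;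
      padd 19 14 3; pload 19 19;
      If (PEq (reg 18) (reg 19))
        (seqp [:: padd 18 17 1; pload 19 18; pstore 16 19; pstore 18 14; padd 16 14 3;
                  pload 19 16; padd 19 19 1; padd 16 17 3; pstore 16 19; pcopy 14 17])
        (seqp [::])].

Ltac pl v0 := apply: (run_PLoad (v := v0)); [by []|by []|rd|rd|rd|].

Section HeapDef.

Context (F : finFieldType) (cap : nat).
Implicit Types (L R V : nat -> nat) (key : nat -> F) (m : nat -> F + nat).

(** The bounds on [L i], [R i] and [V i] keep loaded pointers inside the memory and below [W]. Node
    0 has fields but no key. *)
Definition heap m n key L R V : Prop :=
  [/\ n <= cap, [/\ L 0 = 0, R 0 = 0 & V 0 = 0],
      forall i, i <= n -> [/\ m (4 * i + 1) = inr (4 * L i), m (4 * i + 2) = inr (4 * R i),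
                             m (4 * i + 3) = inr (V i) & L i <= n /\ R i <= n /\ V i <= n]
    & forall i, 0 < i <= n -> m (4 * i) = inl (key i)].

Definition eq_above B (m m' : nat -> F + nat) := forall a, B <= a -> m' a = m a.
Definition eq_below B (m m' : nat -> F + nat) := forall a, a < B -> m' a = m a.

Lemma heap_updL m n key L R V i x : 0 < i <= n -> x <= n -> heap m n key L R V ->
  heap (upd m (4 * i + 1) (inr (4 * x))) n key (upd L i x) R V.
Proof.
move=> /andP[i0 il] xn [nc [l0 r0 v0] h hk]; split=> //.
- by split=> //; rewrite upd_neq // neq_ltn i0.
- move=> j jn; have [h1 h2 h3 [h4 [h5 h6]]] := h j jn.
  have [->|ji] := eqVneq j i.
    have [g1 g2 g3 [g4 [g5 g6]]] := h i il.
    by rewrite !upd_eq !upd_neq //; lia.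
  by rewrite ![upd L i x j]upd_neq // !upd_neq //; lia.
- by move=> j jn; rewrite upd_neq ?hk //; lia.
Qed.

Lemma heap_updR m n key L R V i x : 0 < i <= n -> x <= n -> heap m n key L R V ->
  heap (upd m (4 * i + 2) (inr (4 * x))) n key L (upd R i x) V.
Proof.
move=> /andP[i0 il] xn [nc [l0 r0 v0] h hk]; split=> //.
- by split=> //; rewrite upd_neq // neq_ltn i0.
- move=> j jn; have [h1 h2 h3 [h4 [h5 h6]]] := h j jn.
  have [->|ji] := eqVneq j i.
    have [g1 g2 g3 [g4 [g5 g6]]] := h i il.
    by rewrite !upd_eq !upd_neq //; lia.
  by rewrite ![upd R i x j]upd_neq // !upd_neq //; lia.
- by move=> j jn; rewrite upd_neq ?hk //; lia.
Qed.

Lemma heap_updV m n key L R V i x : 0 < i <= n -> x <= n -> heap m n key L R V ->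
  heap (upd m (4 * i + 3) (inr x)) n key L R (upd V i x).
Proof.
move=> /andP[i0 il] xn [nc [l0 r0 v0] h hk]; split=> //.
- by split=> //; rewrite upd_neq // neq_ltn i0.
- move=> j jn; have [h1 h2 h3 [h4 [h5 h6]]] := h j jn.
  have [->|ji] := eqVneq j i.
    have [g1 g2 g3 [g4 [g5 g6]]] := h i il.
    by rewrite !upd_eq !upd_neq //; lia.
  by rewrite ![upd V i x j]upd_neq // !upd_neq //; lia.
- by move=> j jn; rewrite upd_neq ?hk //; lia.
Qed.

Lemma heap_eq m m' n key L R V : eq_below (4 * cap.+1) m m' ->
  heap m n key L R V -> heap m' n key L R V.
Proof.
move=> e [nc h0 h hk]; split=> // [j jn|j /andP[j0 jn]].
  by have [h1 h2 h3 h4] := h j jn; rewrite !e //; lia.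
by rewrite e ?hk ?j0 //; lia.
Qed.

Lemma eq_above_upd B m m' a x : a < B -> eq_above B m m' -> eq_above B m (upd m' a x).
Proof. by move=> aB h i iB; rewrite upd_neq ?h //; lia. Qed.

End HeapDef.

Section Heap.

Context (F : finFieldType) (le : rel F) (r : nat) (b c : 'I_r -> F) (M W : nat).
Context (Len LIM cap : nat).
Local Notation heap := (heap cap).
Local Notation runs := (runs le b c M W).
Hypothesis MW : M <= W.
Hypothesis LIM_cap : LIM = 4 * cap.+1.
Hypothesis LIM_M : LIM + Len + 2 < M.
Implicit Types (L R V : nat -> nat) (key : nat -> F) (m : nat -> F + nat).

Lemma skew_code_spec f p m n key L R V i v l s :
  p 1 = 1 -> p 2 = 2 -> p 3 = 3 -> heap m n key L R V -> 0 < v ->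
  uniq (inorder (Nd i v l s)) -> all (fun i => 0 < i <= n) (inorder (Nd i v l s)) ->
  rep L R V (Nd i v l s) -> p 14 = 4 * i ->
  runs skew_code (mkst f p m) 12 (fun st => exists p' m' L' R',
    [/\ st = mkst f p' m', eqx [:: 14; 16; 17; 18; 19] p p', eq_above LIM m m',
        heap m' n key L' R' V &
        [/\ rep L' R' V (skew_tree (Nd i v l s)), p' 14 = 4 * root_id (skew_tree (Nd i v l s)),
            forall j, j \notin inorder (Nd i v l s) -> L' j = L j &
            forall j, j \notin inorder (Nd i v l s) -> R' j = R j]]).
Proof.
move=> k1 k2 k3 H v0 u al hr e14; have [nc [L0 R0 V0] h hk] := H.
have hi : i \in inorder (Nd i v l s) by rewrite /= mem_cat mem_head orbT.
have /andP[i0 il] := allP al _ hi.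
have [h1 h2 h3 [h4 [h5 h6]]] := h i il.
have [g1 g2 g3 [g4 [g5 g6]]] := h (L i) h4.
have lim : 4 * n + 3 < LIM by lia.
apply: (@runs_le _ _ _ _ _ _ _ _ _ (6 + (6 + 0))); first by [].
rewrite /skew_code; istep; first by lia.
pl (4 * L i); [lia|by rewrite e14 k1 h1|lia|].
istep; first by lia.
pl (V (L i)); [lia|by rewrite k3 g3|lia|].
istep; first by lia.
pl (V i); [lia|by rewrite e14 k3 h3|lia|].
have sk := rep_skew V0 v0 u hr.
apply: runs_cons; apply: runs_if; rewrite holds_PEq // => hh.
- have {}hh : V (L i) == V i by move: hh; rd.
  rewrite hh in sk; case: sk => sk1 sk2.
  have li0 : L i != 0.
    apply/eqP => li; move/eqP: hh; rewrite li V0; case: hr => _ _ -> _ _; lia.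
  have li : L i \in inorder (Nd i v l s).
    by case: hr li0 => -> _ _ _ _; case: (l) => //= j w a d _; rewrite !mem_cat mem_head orbT.
  istep; first by lia.
  pl (4 * R (L i)); [lia|by rewrite k2 g2|lia|].
  istep; first by lia.
  istep; first by lia.
  istep; first by lia.
  apply: runs_nil; apply: runs_nil.
  eexists _, _, (upd L i (R (L i))), (upd R (L i) i); split; first reflexivity; [by eqxt| | |].
  + apply: eq_above_upd; first by rd; lia.
    by apply: eq_above_upd => //; rd; lia.
  + rd; rewrite e14 k1 k2; apply: heap_updR; [lia|lia|].
    by apply: heap_updL; [lia|lia|].
  + split; rewrite ?sk2 //.
      by move=> j jn; rewrite upd_neq //; apply: contraNneq jn => ->.
    by move=> j jn; rewrite upd_neq //; apply: contraNneq jn => ->.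
- have {}hh : (V (L i) == V i) = false by apply/negbTE; move: hh; rd.
  rewrite hh in sk; case: sk => sk1 sk2.
  apply: runs_nil; apply: runs_nil.
  eexists _, _, L, R; split; first reflexivity; [by eqxt| by [] | by [] |].
  by split => //; rewrite sk2; rd.
Qed.

(** [v < n] leaves room for the incremented level within the bound on levels in [heap]. *)
Lemma split_code_spec f p m n key L R V i v l s :
  p 1 = 1 -> p 2 = 2 -> p 3 = 3 -> heap m n key L R V -> 0 < v -> v < n ->
  uniq (inorder (Nd i v l s)) -> all (fun i => 0 < i <= n) (inorder (Nd i v l s)) ->
  rep L R V (Nd i v l s) -> p 14 = 4 * i ->
  runs split_code (mkst f p m) 19 (fun st => exists p' m' L' R' V',
    [/\ st = mkst f p' m', eqx [:: 14; 16; 17; 18; 19] p p', eq_above LIM m m',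
        heap m' n key L' R' V' &
        [/\ rep L' R' V' (split_tree (Nd i v l s)), p' 14 = 4 * root_id (split_tree (Nd i v l s)),
            forall j, j \notin inorder (Nd i v l s) -> L' j = L j,
            forall j, j \notin inorder (Nd i v l s) -> R' j = R j &
            forall j, j \notin inorder (Nd i v l s) -> V' j = V j]]).
Proof.
move=> k1 k2 k3 H v0 vn u al hr e14; have [nc [L0 R0 V0] h hk] := H.
have hi : i \in inorder (Nd i v l s) by rewrite /= mem_cat mem_head orbT.
have /andP[i0 il] := allP al _ hi.
have [h1 h2 h3 [h4 [h5 h6]]] := h i il.
have [g1 g2 g3 [g4 [g5 g6]]] := h (R i) h5.
have [d1 d2 d3 [d4 [d5 d6]]] := h (R (R i)) g5.
have lim : 4 * n + 3 < LIM by lia.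
have Vi : V i = v by case: hr.
apply: (@runs_le _ _ _ _ _ _ _ _ _ (8 + (11 + 0))); first by [].
rewrite /split_code; istep; first by lia.
pl (4 * R i); [lia|by rewrite e14 k2 h2|lia|].
istep; first by lia.
pl (4 * R (R i)); [lia|by rewrite k2 g2|lia|].
istep; first by lia.
pl (V (R (R i))); [lia|by rewrite k3 d3|lia|].
istep; first by lia.
pl (V i); [lia|by rewrite e14 k3 h3|lia|].
have sk := rep_split V0 R0 v0 u hr.
apply: runs_cons; apply: runs_if; rewrite holds_PEq // => hh.
- have {}hh : V (R (R i)) == V i by move: hh; rd.
  rewrite hh in sk; case: sk => sk1 sk2.
  have ri0 : R i != 0.
    apply/eqP => ri; move/eqP: hh; rewrite ri R0 V0; lia.
  have ri : R i \in inorder (Nd i v l s).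
    by case: hr ri0 => _ -> _ _ _; case: (s) => //= j w a d _; rewrite !(mem_cat, in_cons) eqxx !orbT.
  istep; first by lia.
  pl (4 * L (R i)); [lia|by rewrite k1 g1|lia|].
  istep; first by lia.
  istep; first by lia.
  istep; first by lia.
  pl (V i); [lia| by rewrite e14 k1 k2 k3 ifF ?ifF ?h3 //; lia |lia|].
  istep; first by lia.
  istep; first by lia.
  istep; first by lia.
  istep; first by lia.
  apply: runs_nil; apply: runs_nil.
  eexists _, _, (upd L (R i) i), (upd R i (L (R i))), (upd V (R i) (V i).+1).
  split; first reflexivity; [by eqxt| | |].
  + do 3 (apply: eq_above_upd; first by rd; lia).
    by [].
  + rd; rewrite e14 k1 k2 k3 addn1; apply: heap_updV; [lia|lia|].
    apply: heap_updL; [lia|lia|].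
    by apply: heap_updR; [lia|lia|].
  + split; rewrite ?sk2 //.
    * by move=> j jn; rewrite upd_neq //; apply: contraNneq jn => ->.
    * by move=> j jn; rewrite upd_neq //; apply: contraNneq jn => ->.
    * by move=> j jn; rewrite upd_neq //; apply: contraNneq jn => ->.
- have {}hh : (V (R (R i)) == V i) = false by apply/negbTE; move: hh; rd.
  rewrite hh in sk; case: sk => sk1 sk2.
  apply: runs_nil; apply: runs_nil.
  eexists _, _, L, R, V; split; first reflexivity; [by eqxt| by [] | by [] |].
  by split => //; rewrite sk2; rd.
Qed.

End Heap.

(** * Rebalancing along the stack *)

Definition frame_id fr := match fr with FrameL i _ _ => i | FrameR i _ _ => i end.
Definition frame_level fr := match fr with FrameL _ v _ => v | FrameR _ v _ => v end.
Definition frame_slot fr :=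
  match fr with FrameL i _ _ => 4 * i + 1 | FrameR i _ _ => 4 * i + 2 end.

Definition up_body : prog 24 := seqp
  [:: psub 15 15 1; pload 16 15; psub 15 15 1; pload 17 15; pstore 16 14; pcopy 14 17;
      skew_code; split_code].

Lemma inorder_plug1 z fr t :
  inorder (plug (fr :: z) t) = lefts z ++ inorder (plug1 t fr) ++ rights z.
Proof. by rewrite -inorder_plug. Qed.

Lemma frame_in_plug1 fr t : frame_id fr \in inorder (plug1 t fr).
Proof. by case: fr => i v s /=; rewrite mem_cat mem_head orbT. Qed.

Lemma uniq_plug1 (z : seq frame) fr t : uniq (inorder (plug (fr :: z) t)) ->
  uniq (inorder (plug1 t fr)) /\
  {in lefts z ++ rights z, forall j, j \notin inorder (plug1 t fr)}.
Proof.
rewrite inorder_plug1 cat_uniq => /and3P[_ /hasPn h1]; rewrite cat_uniq => /and3P[u /hasPn h2 _].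
split=> // j; rewrite mem_cat => /orP[jl|jr]; last by apply: h2.
by apply/negP => jp; have := h1 j; rewrite mem_cat jp /= jl => /(_ isT).
Qed.

Lemma rep_attach L R V (z : seq frame) fr t : uniq (inorder (plug (fr :: z) t)) ->
  rep L R V t -> repz L R V (fr :: z) ->
  match fr with
  | FrameL i _ _ => rep (upd L i (root_id t)) R V (plug1 t fr) /\ repz (upd L i (root_id t)) R V z
  | FrameR i _ _ => rep L (upd R i (root_id t)) V (plug1 t fr) /\ repz L (upd R i (root_id t)) V z
  end.
Proof.
move=> u ht; have [u1 hz] := uniq_plug1 u.
have iz : frame_id fr \notin lefts z ++ rights z.
  by apply/negP => /hz; rewrite frame_in_plug1.
case: fr u u1 hz iz => i v s u; rewrite /= cat_uniq /= => /and3P[_ + /andP[is_ _]] hz iz.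
  rewrite negb_or => /andP[it _] [e2 e3 hs hzz]; split.
    split; rewrite ?upd_eq //; first by apply: rep_eq ht => //; apply: upd_in.
    by apply: rep_eq hs => //; apply: upd_in.
  by apply: repz_eq hzz => //; apply: upd_in.
rewrite negb_or => /andP[it _] [e2 e3 hs hzz]; split.
  split; rewrite ?upd_eq //; first by apply: rep_eq hs => //; apply: upd_in.
  by apply: rep_eq ht => //; apply: upd_in.
by apply: repz_eq hzz => //; apply: upd_in.
Qed.

Lemma plug1E fr t : exists l s, plug1 t fr = Nd (frame_id fr) (frame_level fr) l s.
Proof. by case: fr => i v s /=; eexists; eexists. Qed.

Lemma skew_treeE i v l s : exists i' l' s', skew_tree (Nd i v l s) = Nd i' v l' s'.
Proof.
case: l => [|j w a d] /=; first by do 3 eexists.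
by case: eqP => [->|_]; do 3 eexists.
Qed.

Section Up.

Context (F : finFieldType) (le : rel F) (r : nat) (b c : 'I_r -> F) (M W : nat).
Context (Len LIM cap : nat).
Local Notation STK := (LIM + Len).
Local Notation runs := (runs le b c M W).
Hypothesis MW : M <= W.
Hypothesis LIM_cap : LIM = 4 * cap.+1.
Hypothesis LIM_M : LIM + Len + 2 < M.

(* A frame is stacked as its node and the address of the child that was followed. *)
Fixpoint stk (m : nat -> F + nat) (z : seq frame) : Prop := if z is fr :: z then
  [/\ m (STK + 2 * size z) = inr (4 * frame_id fr),
      m (STK + 2 * size z + 1) = inr (frame_slot fr) & stk m z] else True.

Lemma stk_eq m m' z : eq_above STK m m' -> stk m z -> stk m' z.
Proof.
clear MW LIM_cap LIM_M.
move=> e; elim: z => //= fr z IH [h1 h2 /IH h3]; split => //; rewrite e //; lia.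
Qed.

Lemma stk_eq_below m m' z : eq_below (STK + 2 * size z) m m' -> stk m z -> stk m' z.
Proof.
clear MW LIM_cap LIM_M.
elim: z => //= fr z IH e [h1 h2 h3]; split; rewrite ?e //; try lia.
by apply: IH h3 => a h; apply: e; lia.
Qed.

(** Invariant of the way up: [z] is still stacked, [t] is the rebuilt subtree and [t0] the same
    subtree before the insertion. [T'] and [Is] fix the final tree and its order; the size of the
    old tree bounds the levels. *)
Definition up_state f p m n key (T' : tree) (Is : seq nat) (j : nat) (st : state 24 F) :=
  exists p' m' L R V z t0 t,
    [/\ st = mkst f p' m', eqx [:: 14; 15; 16; 17; 18; 19] p p', eq_above LIM m m',
        heap cap m' n key L R V &
    [/\ [/\ rep L R V t, repz L R V z, p' 15 = STK + 2 * size z & p' 14 = 4 * root_id t],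
        [/\ aa (plug z t0), grows t0 t, up z t = T' & inorder (plug z t) = Is],
        size (inorder (plug z t0)) < n, stk m z & j = size z]].

Lemma up_step f p m n key T' Is j st :
  p 1 = 1 -> p 2 = 2 -> p 3 = 3 ->
  uniq Is -> all (fun i => 0 < i <= n) Is -> STK + 2 * j.+1 < M ->
  up_state f p m n key T' Is j.+1 st ->
  runs up_body st 37 (up_state f p m n key T' Is j).
Proof.
move=> k1 k2 k3 u al jM [p' [m' [L [R [V [z [t0 [t]]]]]]]].
case=> -> ep em H [[ht hz e15 e14] [ha hg hT hI] hsz hs hj].
case: z hz e15 ha hT hI hsz hs hj => // fr z hz e15 ha hT hI hsz hs [hj].
have em' : eq_above STK m m' by move=> a aS; apply: em; lia.
have [s1 s2 s3] := stk_eq em' hs.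
have [nc [L0 R0 V0] h hk] := H.
have u' : uniq (inorder (plug (fr :: z) t)) by rewrite hI.
have [u1 hu] := uniq_plug1 u'.
have al1 : all (fun i => 0 < i <= n) (inorder (plug1 t fr)).
  apply/allP=> i hi; apply: (allP al); rewrite -hI inorder_plug1.
  by rewrite !mem_cat hi orbT.
have hi : 0 < frame_id fr <= n by apply: (allP al1); apply: frame_in_plug1.
have hsl : frame_slot fr < LIM by case: (fr) hi => i v s /=; lia.
have [k1' k2' k3'] : [/\ p' 1 = 1, p' 2 = 2 & p' 3 = 3] by rewrite !ep.
have htn : root_id t <= n.
  case: (t) al1 => //= i v l s al1; suff : 0 < i <= n by lia.
  by apply: (allP al1); case: (fr) => *; rewrite /= !(mem_cat, in_cons) eqxx ?orbT.
move: e15 => /= e15.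
apply: (@runs_le _ _ _ _ _ _ _ _ _ (6 + (12 + (19 + 0)))); first by [].
rewrite /up_body; istep; first by lia.
pl (frame_slot fr); [lia|by rewrite -s2 k1' e15; congr m'; lia|lia|].
istep; first by lia.
pl (4 * frame_id fr); [lia|by rewrite -s1 k1' e15; congr m'; lia|lia|].
istep; first by lia.
istep; first by lia.
set p1 := upd _ 14 _; set m1 := upd m' _ _.
have m1E : m1 = upd m' (frame_slot fr) (inr (4 * root_id t)).
  by rewrite /m1; congr upd; rd; rewrite e14.
have [L1 [R1 [H1 [rt1 rz1]]]] : exists L1 R1, heap cap m1 n key L1 R1 V /\
     (rep L1 R1 V (plug1 t fr) /\ repz L1 R1 V z).
  have := rep_attach u' ht hz; rewrite m1E.
  case: (fr) hi => i v s hi hh.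
    exists (upd L i (root_id t)), R; split=> //.
    exact: (heap_updL hi htn H).
  exists L, (upd R i (root_id t)); split=> //.
  exact: (heap_updR hi htn H).
have em1 : eq_above LIM m m1.
  by rewrite m1E; apply: eq_above_upd.
have ha1 := aa_plug (z := z) ha.
have v0 : 0 < frame_level fr.
  by case: (fr) ha1 => i v s /= /and5P[/eqP -> _ _ _ _].
(* A tree of level [v] has at least [2 ^ v - 1 >= v] nodes, and the old tree has fewer than [n]. *)
have vn : frame_level fr < n.
  have := aa_size ha1; move: (hsz); rewrite inorder_plug1 !size_cat.
  have -> : level (plug1 t0 fr) = frame_level fr by case: (fr).
  have := ltn_expl (frame_level fr) (isT : 1 < 2).
  move: (2 ^ _) => x; lia.
have [l [s eT]] := plug1E fr t.
have {}eT : plug1 t fr = Nd (frame_id fr) (frame_level fr) l s by [].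
rewrite eT in u1 al1 rt1 hu.
apply: runs_cons; apply: (runs_weaken (skew_code_spec le b c MW LIM_cap LIM_M f _ _ _ H1 v0 u1 al1 rt1 _)) => //.
move=> _ [p2 [m2 [L2 [R2 [-> ep2 em2 H2 [rt2 e14' hL2 hR2]]]]]].
have rz2 : repz L2 R2 V z.
  by apply: repz_eq rz1 => // i /hu; [apply: hL2|apply: hR2].
have u2 : uniq (inorder (skew_tree (plug1 t fr))) by rewrite inorder_skew eT.
have al2 : all (fun i => 0 < i <= n) (inorder (skew_tree (plug1 t fr))) by rewrite inorder_skew eT.
have [i3 [l3 [s3' eT3]]] := skew_treeE (frame_id fr) (frame_level fr) l s.
rewrite eT eT3 in u2 al2; rewrite eT3 in rt2 e14'.
have [q1 q2 q3] : [/\ p2 1 = 1, p2 2 = 2 & p2 3 = 3] by rewrite !ep2.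
apply: runs_cons; apply: (runs_weaken (split_code_spec le b c MW LIM_cap LIM_M f q1 q2 q3 H2 v0 vn u2 al2 rt2 e14')) => //.
move=> _ [p3 [m3 [L3 [R3 [V3 [-> ep3 em3 H3 [rt3 e14'' hL3 hR3 hV3]]]]]]].
have i3E : inorder (Nd i3 (frame_level fr) l3 s3') = inorder (Nd (frame_id fr) (frame_level fr) l s).
  by rewrite -eT3 inorder_skew.
have rz3 : repz L3 R3 V3 z.
  by apply: repz_eq rz2 => // i /hu; rewrite -i3E; [apply: hL3|apply: hR3|apply: hV3].
apply: runs_nil; exists p3, m3, L3, R3, V3, z, (plug1 t0 fr), (split_tree (skew_tree (plug1 t fr))).
split=> //.
- apply: (eqx_trans ep); apply: (eqx_trans (p' := p1)); first by rewrite /p1; eqxt.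
  apply: (eqx_trans (p' := p2)); first by apply: eqx_sub ep2.
  by apply: eqx_sub ep3.
- by move=> a aL; rewrite em3 // em2 // em1.
split=> //; first split=> //.
- by rewrite eT eT3.
- by rewrite ep3 // ep2 // /p1; rd; rewrite k1' e15; lia.
- by rewrite eT eT3.
split=> //.
  by apply: grows_step.
by rewrite -hI inorder_plug inorder_split inorder_skew inorder_plug1.
by case: hs.
Qed.

End Up.

(** * Search and insertion *)

Definition descend_body : prog 24 := seqp
  [:: fload 2 14;
      If (FEq (reg 2) (reg 0))
        (seqp [:: pcopy 19 1; pcopy 14 21])
        (seqp [:: If (FLe (reg 0) (reg 2)) (seqp [:: padd 16 14 1]) (seqp [:: padd 16 14 2]);
                  pstore 15 14; padd 15 15 1; pstore 15 16; padd 15 15 1; pload 14 16])].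

Definition insert_node : prog 24 := seqp
  [:: pcopy 14 10; fstore 14 0; padd 16 14 1; pstore 16 21; padd 16 14 2; pstore 16 21;
      padd 16 14 3; pstore 16 1; padd 10 10 20;
      While (PLe (reg 23) (reg 15)) up_body; pcopy 13 14].

(* When the memory for the nodes is full, the orbit is too large and the answer
   becomes negative. *)
Definition insert : prog 24 := seqp
  [:: pcopy 14 13; pcopy 15 9; pcopy 19 21;
      While (PLe (reg 1) (reg 14)) descend_body;
      If (PEq (reg 19) (reg 1)) (seqp [::])
        (seqp [:: If (PEq (reg 10) (reg 8)) (seqp [:: pcopy 0 21]) insert_node])].

Section Insert.

Context (F : finFieldType) (le : rel F) (r : nat) (b c : 'I_r -> F) (M W : nat).
Context (Len LIM cap D : nat).
Local Notation STK := (LIM + Len).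
Local Notation runs := (runs le b c M W).
Local Notation konst := (konst r Len LIM).
Local Notation stk := (@stk F Len LIM).
Hypothesis letot : total le.
Hypothesis leasym : antisymmetric le.
Hypothesis letr : transitive le.
Hypothesis MW : M <= W.
Hypothesis LIM_cap : LIM = 4 * cap.+1.
Hypothesis LIM_M : STK + 2 * D + 2 < M.
Hypothesis capD : forall v, 2 ^ v <= cap.+1 -> 2 * v <= D.

Let LIM_M' : STK + 2 < M. Proof. lia. Qed.

Definition klt (x y : F) := (x != y) && le x y.

Lemma klt_trans : transitive klt.
Proof.
move=> y x z /andP[xy lxy] /andP[yz lyz]; rewrite /klt (letr lxy lyz) andbT.
by apply: contraNneq xy => xz; apply/eqP/leasym; rewrite lxy xz lyz.
Qed.

Definition bst (key : nat -> F) T := pairwise (fun i j => klt (key i) (key j)) (inorder T).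

(** Either the key was found, and register 14 was cleared to leave the loop, or [z] is the path to
    the current subtree [t]. The last clause compares the searched key with all keys outside [t]; at
    a leaf it shows both that the key is new and that inserting it there keeps the order. *)
Definition descent (f : nat -> F) p m key T j (st : state 24 F) :=
  exists f' p' m', [/\ st = mkst f' p' m', eqx [:: 14; 15; 16; 19] p p', eqx [:: 2] f f',
    eq_below STK m m' &
   [/\ p' 19 = 1, p' 14 = 0 & exists2 i, i \in inorder T & key i = f 0] \/
   exists z t, [/\ p' 19 = 0, [/\ plug z t = T, depth t <= j & p' 14 = 4 * root_id t],
     p' 15 = STK + 2 * size z, stk m' z &
     {in lefts z, forall i, klt (key i) (f 0)} /\ {in rights z, forall i, klt (f 0) (key i)}]].

Lemma descent_step f p m n key L R V T j st :
  konst f p -> heap cap m n key L R V -> rep L R V T -> bst key T ->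
  all (fun i => 0 < i <= n) (inorder T) -> depth T <= D ->
  descent f p m key T j st -> holds le (PLe (reg 1) (reg 14)) st ->
  exists2 j', j = j'.+1 & runs descend_body st 9 (descent f p m key T j').
Proof.
move=> hk H hr hb al dT [f' [p' [m' [-> ep ef em alt]]]].
have hk' : konst f' p' by apply: konst_eqx ep ef hk.
have [[k1 k2 k3 k4] [[k5 k8 k9 k20] [k21 k22 k23 kf4 kf5]]] := hk'.
rewrite holds_PLe // k1 => h14.
case: alt => [[_ e0 _]|[z [t [e19 [hp dj e14] e15 hs [hl hrt]]]]]; first by move: h14; rewrite e0.
case: t e14 hp dj => [|i w l s] /= e14 hp dj; first by move: h14; rewrite e14.
case: j dj => // j dj; exists j => //.
have H' : heap cap m' n key L R V.
  by apply: heap_eq H; move=> a aL; apply: em; lia.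
have [nc [L0 R0 V0] h hkey] := H'.
have [ht hz] : rep L R V (Nd i w l s) /\ repz L R V z by apply: rep_plug; rewrite hp.
have it : i \in inorder T by rewrite -hp inorder_plug /= !(mem_cat, in_cons) eqxx !orbT.
have /andP[i0 il] := allP al _ it.
have [h1 h2 h3 [h4 [h5 h6]]] := h i il.
have zd : size z < depth T.
  by have := plug_depth z (Nd i w l s); rewrite hp /=; lia.
have bp : pairwise (fun i j => klt (key i) (key j)) (inorder l ++ i :: inorder s).
  move: hb; rewrite /bst -hp inorder_plug pairwise_cat => /and3P[_ _].
  by rewrite pairwise_cat => /and3P[_ + _].
move: bp; rewrite pairwise_cat /= => /and3P[bl _ /andP[/allP br _]].
move: bl; rewrite allrel_consr => /andP[/allP bl _].
rewrite /descend_body.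
apply: (@run_FLoad _ _ _ _ _ _ _ _ _ _ _ 8 _ _ _ (key i)) => //.
- by rewrite e14; lia.
- by rewrite e14 hkey // i0.
have f0 : f' 0 = f 0 by rewrite ef.
apply: (@runs_cons _ _ _ _ _ _ _ _ _ _ 8 0).
apply: runs_if; rewrite holds_FEq // => hh.
- have {}hh : key i == f 0 by rewrite -f0; move: hh; rd.
  istep; first by lia.
  istep; first by lia.
  apply: runs_nil; apply: runs_nil.
  eexists _, _, _; split; first reflexivity; [by eqxt|by eqxt|exact: em|left].
  by split; rd; rewrite ?k1 //; exists i => //; apply/eqP.
have {}hh : key i != f 0 by rewrite -f0; move: hh; rd.
(* Pushing a frame and following the link, common to both directions. *)
have suf fr t2 : plug1 t2 fr = Nd i w l s -> plug (fr :: z) t2 = T ->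
   depth t2 <= j -> m' (frame_slot fr) = inr (4 * root_id t2) ->
   frame_id fr = i -> frame_slot fr < LIM ->
   {in lefts (fr :: z), forall i, klt (key i) (f 0)} ->
   {in rights (fr :: z), forall i, klt (f 0) (key i)} ->
   forall f1, eqx [:: 2] f f1 -> forall p1, eqx [:: 16] p' p1 -> p1 16 = frame_slot fr ->
   runs (seqp [:: pstore 15 14; padd 15 15 1; pstore 15 16; padd 15 15 1; pload 14 16])
     (mkst f1 p1 m') 5 (descent f p m key T j).
  move=> e1 e2 dt2 hm fi fs hll hrr f1 ef1 p1 ep1 e16.
  have [r1 r14 r15 r19] : [/\ p1 1 = 1, p1 14 = 4 * i, p1 15 = STK + 2 * size z & p1 19 = 0].
    by rewrite !ep1.
  istep; first by lia.
  istep; first by lia.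
  istep; first by lia.
  istep; first by lia.
  have fa : frame_slot fr < p1 15 by lia.
  pl (4 * root_id t2).
  - by rewrite e16; lia.
  - by rewrite e16 ifF ?ifF ?hm //; lia.
  - have rn : root_id t2 <= n.
      case: (t2) e2 => //= i2 w2 l2 s2 e2; suff : 0 < i2 <= n by lia.
      apply: (allP al); rewrite -e2 inorder_plug !mem_cat.
      by case: (fr) => * /=; rewrite !(mem_cat, in_cons) eqxx ?orbT.
    by lia.
  apply: runs_nil.
  eexists _, _, _; split; first reflexivity.
  - by apply: (eqx_trans ep); apply: (eqx_trans (p' := p1)); [apply: eqx_sub ep1 | eqxt].
  - exact: ef1.
  - move=> a aS; rewrite upd_neq; last by rd; lia.
    by rewrite upd_neq ?em //; rd; lia.
  right; exists (fr :: z), t2; split=> //.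
  - by rd; rewrite r1 r15 /=; lia.
  - split.
    + by rewrite upd_neq ?upd_eq ?fi; [rewrite /upd /= r15 eqxx r14|rd; rewrite r1 r15; lia].
    + rewrite (_ : STK + 2 * size z + 1 = upd p1 15 (p1 15 + p1 1) 15) ?upd_eq.
        by rd; rewrite e16.
      by rd; rewrite r1 r15.
    + apply: stk_eq_below hs => a ha; rewrite upd_neq; last by rd; lia.
      by rewrite upd_neq //; rd; lia.
have al_l : depth l <= j by lia.
have al_s : depth s <= j by lia.
have li : 4 * i + 2 < LIM by lia.
case: ht => t1 t2 t3 t4 t5.
apply: (runs_weaken (Q := descent f p m key T j) (n := 7)) => //; last by move=> s1; apply: runs_nil.
apply: (@runs_cons _ _ _ _ _ _ _ _ _ _ 2 5); apply: runs_if; rewrite holds_FLe // => h0.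
- have {}h0 : le (f 0) (key i) by rewrite -f0; move: h0; rd.
  istep; first by lia.
  apply: runs_nil; apply: (suf (FrameL i w s) l) => //=.
  + by rewrite h1 t1.
  + by lia.
  + move=> x; rewrite in_cons mem_cat => xx.
    have kl : klt (f 0) (key i) by rewrite /klt eq_sym hh.
    case/orP: xx => [/eqP -> //|/orP[/br|xr]]; first exact: klt_trans.
    exact: hrt.
  + by eqxt.
  + by eqxt.
  + by rd; rewrite e14 k1.
- have {}h0 : ~~ le (f 0) (key i) by rewrite -f0; move: h0; rd.
  istep; first by lia.
  apply: runs_nil; apply: (suf (FrameR i w l) s) => //=.
  + by rewrite h2 t2.
  + move=> x; rewrite mem_cat mem_rcons in_cons => xx.
    have kl : klt (key i) (f 0).
      by rewrite /klt hh; case/orP: (letot (key i) (f 0)) => // h'; rewrite h' in h0.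
    case/orP: xx => [xl|/orP[/eqP -> //|/bl kx]]; first exact: hl.
    exact: klt_trans kx kl.
  + by eqxt.
  + by eqxt.
  + by rd; rewrite e14 k2.
Qed.

End Insert.

Lemma heap_new (F : finFieldType) cap (m : nat -> F + nat) n key L R V (v : F) :
  n < cap -> heap cap m n key L R V ->
  heap cap (upd (upd (upd (upd m (4 * n.+1) (inl v)) (4 * n.+1 + 1) (inr 0))
                (4 * n.+1 + 2) (inr 0)) (4 * n.+1 + 3) (inr 1))
    n.+1 (upd key n.+1 v) (upd L n.+1 0) (upd R n.+1 0) (upd V n.+1 1).
Proof.
move=> nc [_ h0 h hk]; split=> //.
  move=> j; rewrite leq_eqVlt => /orP[/eqP ->|jn].
    rewrite ![upd _ n.+1 _ n.+1]upd_eq muln0 upd_eq.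
    rewrite (upd_neq _ _ (_ : _ != 4 * n.+1 + 3)) ?(upd_neq _ _ (_ : _ != 4 * n.+1 + 2)) ?upd_eq; try lia.
    by rewrite (upd_neq _ _ (_ : 4 * n.+1 + 2 != 4 * n.+1 + 3)) ?upd_eq //; lia.
  have [h1 h2 h3 h4] := h j jn.
  rewrite !(upd_neq _ _ (_ : j != n.+1)); try lia.
  by split; [rewrite 4?upd_neq | rewrite 4?upd_neq | rewrite 4?upd_neq | ]; lia || done.
move=> j /andP[j0]; rewrite leq_eqVlt => /orP[/eqP ->|jn].
  by rewrite 3?upd_neq ?upd_eq //; lia.
by rewrite 5?upd_neq ?hk ?j0 //; lia.
Qed.

Lemma eq_pairwise_key (T : Type) (lt : rel T) (key key' : nat -> T) s :
  {in s, key' =1 key} ->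
  pairwise (fun i j => lt (key' i) (key' j)) s = pairwise (fun i j => lt (key i) (key j)) s.
Proof.
move=> h; apply: (@eq_in_pairwise _ (mem s)); last exact/allP.
by move=> i j hi hj /=; rewrite !h.
Qed.

Section InsertSpec.

Context (F : finFieldType) (le : rel F) (r : nat) (b c : 'I_r -> F) (M W : nat).
Context (Len LIM cap D : nat).
Local Notation STK := (LIM + Len).
Local Notation runs := (runs le b c M W).
Local Notation konst := (@konst F r Len LIM).
Local Notation table := (@table F Len LIM).
Hypothesis letot : total le.
Hypothesis leasym : antisymmetric le.
Hypothesis letr : transitive le.
Hypothesis MW : M <= W.
Hypothesis LIM_cap : LIM = 4 * cap.+1.
Hypothesis LIM_M : STK + 2 * D + 2 < M.
Hypothesis capD : forall v, 2 ^ v <= cap.+1 -> 2 * v <= D.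

(** Nodes are numbered 1 to [n] by insertion, so the in-order sequence is a permutation of them and
    register 10 is the end of node [n]. *)
Definition ginv f p m n key L R V T (a : bool) : Prop :=
  [/\ konst f p, p 10 = 4 * n.+1, p 13 = 4 * root_id T & p 0 = a] /\
  [/\ heap cap m n key L R V, table m, rep L R V T & aa T] /\
  bst le key T /\ perm_eq (inorder T) (iota 1 n).

Lemma ginv_ids f p m n key L R V T a : ginv f p m n key L R V T a ->
  all (fun i => 0 < i <= n) (inorder T) /\ size (inorder T) = n /\ depth T <= D.
Proof.
move=> [_ [[[nc _ _ _] _ _ aT] [_ hp]]].
have sz : size (inorder T) = n by rewrite (perm_size hp) size_iota.
split; first by rewrite (perm_all _ hp); apply/allP => i; rewrite mem_iota add1n ltnS.
split=> //; have := aa_depth aT; have := aa_size aT; rewrite sz => h.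
have : 2 * level T <= D by apply: capD; apply: leq_trans h _; rewrite ltnS.
lia.
Qed.

Definition insert_post f p n key (v : F) (a : bool) (st : state 24 F) : Prop :=
  exists f' p' m' n' key' L R V T a',
  [/\ st = mkst f' p' m', ginv f' p' m' n' key' L R V T a',
      eqx [:: 0; 10; 13; 14; 15; 16; 17; 18; 19] p p', eqx [:: 2] f f' &
   [\/ [/\ exists2 i, 0 < i <= n & key i = v, n' = n, key' = key & a' = a],
       [/\ forall i, 0 < i <= n -> key i != v, n < cap, n' = n.+1 & key' = upd key n.+1 v /\ a' = a] |
       [/\ forall i, 0 < i <= n -> key i != v, n = cap, n' = n & key' = key /\ a' = false]]].

Lemma insert_spec f p m n key L R V T a : ginv f p m n key L R V T a ->
  runs insert (mkst f p m) (48 * D + 20) (insert_post f p n key (f 0) a).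
Proof.
move=> G; have [al [sz dT]] := ginv_ids G.
have [[hk e10 e13 e0] [[H tb hr aT] [hb hp]]] := G.
have [[k1 k2 k3 k4] [[k5 k8 k9 k20] [k21 k22 k23 kf4 kf5]]] := hk.
have [nc _ _ _] := H.
have LIM_M' : LIM + Len + 2 < M by lia.
have rT : root_id T <= n.
  case: (T) al => //= i w l s /allP /(_ i); rewrite mem_cat mem_head orbT.
  by move=> /(_ isT); lia.
(* 10 operations per level on the way down and 38 on the way up, loop tests included. *)
apply: (@runs_le _ _ _ _ _ _ _ _ _ (3 + ((D * 10).+1 + (D * 38 + 15)))); first by lia.
rewrite /insert; istep; first by lia.
istep; first by lia.
istep; first by lia.
apply: runs_cons.
apply: (runs_while (I := descent le Len LIM f p m key T) (cost := 9) (j := D)).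
- move=> j st hd ht.
  exact: (descent_step b c letot leasym letr MW LIM_cap LIM_M hk H hr hb al dT hd ht).
- move=> j _ [f' [p' [m' [-> ep ef em alt]]]].
  have hk' : konst f' p' by apply: konst_eqx ep ef hk.
  have [[k1' k2' k3' k4'] [[k5' k8' k9' k20'] [k21' k22' k23' kf4' kf5']]] := hk'.
  rewrite holds_PLe // k1' -eqn0Ngt => /eqP e14'.
  have f0 : f' 0 = f 0 by rewrite ef.
  have H' : heap cap m' n key L R V.
    by apply: heap_eq H; move=> x xL; apply: em; lia.
  have tb' : table m' by move=> i iL; rewrite em ?tb //; lia.
  apply: (@runs_le _ _ _ _ _ _ _ _ _ ((D * 38 + 15) + 0)); first by rewrite addn0.
  apply: runs_cons.
  case: alt => [[e19 _ [i iT ki]]|[z [t [e19 [hpl dj e14] e15 hs [hl hrt]]]]].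
    apply: (@runs_le _ _ _ _ _ _ _ _ _ 1); first by lia.
    apply: runs_if; rewrite holds_PEq // e19 k1' => // _.
    apply: runs_nil; apply: runs_nil.
    exists f', p', m', n, key, L, R, V, T, a; split=> //; last first.
    - by apply: Or31; split=> //; exists i => //; apply: (allP al).
    - by apply: eqx_sub ep.
    split; last by [].
    by split=> //; rewrite ep.
  (* No inserted node has address 0, so the descent ended at an absent child. *)
  have {dj} t0 : t = Lf.
    case: t e14 hpl {dj} => // i w l s; rewrite e14' /= => e hpl.
    have : 0 < i <= n.
      by apply: (allP al); rewrite -hpl inorder_plug /= !(mem_cat, in_cons) eqxx !orbT.
    lia.
  have inT : inorder T = lefts z ++ rights z by rewrite -hpl t0 inorder_plug.
  have new i : 0 < i <= n -> key i != f 0.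
    move=> hi; have : i \in inorder T by rewrite (perm_mem hp) mem_iota add1n ltnS.
    by rewrite inT mem_cat => /orP[/hl|/hrt] /andP[+ _] => //; rewrite eq_sym.
  apply: (@runs_le _ _ _ _ _ _ _ _ _ (D * 38 + 14).+1); first by lia.
  apply: runs_if; rewrite holds_PEq // e19 k1' => // _.
  apply: (@runs_le _ _ _ _ _ _ _ _ _ ((D * 38 + 14) + 0)); first by rewrite addn0.
  apply: runs_cons.
  have [p10 p13 p0] : [/\ p' 10 = 4 * n.+1, p' 13 = 4 * root_id T & p' 0 = a] by rewrite !ep.
  apply: (@runs_le _ _ _ _ _ _ _ _ _ (D * 38 + 13).+1); first by lia.
  apply: runs_if; rewrite holds_PEq // p10 k8' LIM_cap => ncap.
    apply: (@runs_le _ _ _ _ _ _ _ _ _ 1); first by lia.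
    istep; first by lia.
    apply: runs_nil; apply: runs_nil; apply: runs_nil.
    exists f', (upd p' 0 (p' 21)), m', n, key, L, R, V, T, false; split=> //.
    - by apply: eqx_upd => //; apply: eqx_sub ep.
    by apply: Or33; split=> //; move/eqP: ncap; lia.
  have ltc : n < cap by move: ncap; lia.
  apply: (@runs_le _ _ _ _ _ _ _ _ _ (9 + ((size z * 38).+1 + 1))).
    have : size z <= D by apply: leq_trans dT; have := plug_depth z t; rewrite hpl; lia.
    lia.
  rewrite /insert_node.
  istep; first by lia.
  do 8 (istep; first by lia).
  apply: runs_cons.
  set m1 := upd _ _ (inr (upd _ 16 _ 1)); set p1 := upd _ 10 _.
  have m1E : m1 = upd (upd (upd (upd m' (4 * n.+1) (inl (f 0))) (4 * n.+1 + 1) (inr 0))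
                (4 * n.+1 + 2) (inr 0)) (4 * n.+1 + 3) (inr 1).
    by rewrite /m1; congr (upd (upd (upd (upd _ _ _) _ _) _ _) _ _); rd;
      rewrite ?p10 ?k1' ?k2' ?k3' ?k21' ?f0.
  have H1 := heap_new (f 0) ltc H'; rewrite -m1E in H1.
  have em1 : eq_above LIM m' m1.
    by rewrite m1E; do 4 (apply: eq_above_upd; first by lia).
  have ep1 : eqx [:: 10; 14; 16] p' p1 by rewrite /p1; eqxt.
  have p1_10 : p1 10 = 4 * n.+2 by rewrite /p1; rd; rewrite p10 k20'; clear; lia.
  have p1_14 : p1 14 = 4 * n.+1 by rewrite /p1; rd.
  clearbody p1 m1.
  have nT : n.+1 \notin inorder T by apply/negP => /(allP al); rewrite ltnn andbF.
  have [htT hzT] : rep L R V t /\ repz L R V z by apply: rep_plug; rewrite hpl.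
  have [N NE] : exists N, N = Nd n.+1 1 Lf Lf by eexists.
  have [Is IsE] : exists Is, Is = lefts z ++ n.+1 :: rights z by eexists.
  have pIs : perm_eq Is (iota 1 n.+1).
    rewrite -[X in iota 1 X]addn1 iotaD cats1 perm_sym perm_rcons perm_sym add1n.
    by rewrite IsE -cat1s perm_catCA /= perm_cons -inT.
  have uIs : uniq Is by rewrite (perm_uniq pIs) iota_uniq.
  have aIs : all (fun i => 0 < i <= n.+1) Is.
    by rewrite (perm_all _ pIs); apply/allP => i; rewrite mem_iota add1n ltnS.
  have [q1 q2 q3] : [/\ p1 1 = 1, p1 2 = 2 & p1 3 = 3] by rewrite !ep1.
  have szD : size z <= D by apply: leq_trans dT; have := plug_depth z t; rewrite hpl; clear; lia.
  have inz i : i \in lefts z ++ rights z -> i != n.+1.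
    by rewrite -inT => iT; apply: contraNneq nT => <-.
  (* [j] counts the stacked frames; [j <= D] keeps the stack inside the memory. *)
  apply: (runs_while (I := fun j st =>
      up_state Len LIM cap f' p1 m1 n.+1 (upd key n.+1 (f 0)) (up z N) Is j st /\ j <= D)
    (cost := 37) (j := size z)).
  + move=> j0 st [us jD] ht; case: j0 us jD => [|j0] us jD.
      case: us ht => p2 [m2 [L2 [R2 [V2 [z2 [t2 [t3]]]]]]].
      case=> -> ep2 em2 _ [[_ _ e15' _] _ _ _ zz].
      rewrite holds_PLe // e15' -zz ep2 // ep1 // k23'; clear; lia.
    exists j0 => //.
    have st2 : STK + 2 * j0.+1 < M by move: LIM_M jD; clear; lia.
    apply: (runs_weaken (up_step le b c MW LIM_cap LIM_M' q1 q2 q3 uIs aIs st2 us)) => //.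
    by move=> s us'; split => //; move: jD; clear; lia.
  + move=> j0 st [us jD]; case: us => p2 [m2 [L2 [R2 [V2 [z2 [t2 [t3]]]]]]].
    case=> -> ep2 em2 H2 [[rt _ e15' e14''] [a2 g2 u2 i2] _ _ zz].
    rewrite holds_PLe // ep2 // ep1 // k23' e15' => hz2.
    have {zz} z20 : z2 = [::] by move: hz2; clear; case: z2 => //= *; lia.
    rewrite z20 /= in u2 i2 g2.
    istep.
      rewrite e14''; have : root_id t3 <= n.+1.
        case: (t3) i2 => //= i w l s i2; suff : 0 < i <= n.+1 by clear; lia.
        by apply: (allP aIs); rewrite -i2 mem_cat mem_head orbT.
      move: ltc LIM_cap LIM_M MW; clear; lia.
    apply: runs_nil; apply: runs_nil; apply: runs_nil.
    have epf : eqx [:: 10; 13; 14; 15; 16; 17; 18; 19] p' (upd p2 13 (p2 14)).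
      apply: eqx_upd => //; apply: (eqx_trans (p' := p1)); first by apply: eqx_sub ep1.
      by apply: eqx_sub ep2.
    exists f', (upd p2 13 (p2 14)), m2, n.+1, (upd key n.+1 (f 0)), L2, R2, V2, t3, a.
    split=> //; last by apply: Or32.
    - split; [|split; [|split]].
      + split.
        * by apply: (konst_eqx (Y := [::])) epf _ hk'.
        * by rd; rewrite ep2 // p1_10.
        * by rewrite upd_eq e14''.
        * by rd; rewrite ep2 // ep1.
      + split=> //; last by case/andP: g2.
        by move=> i iL; rewrite em2 ?em1 ?tb' //; clear; lia.
      + rewrite /bst i2 IsE pairwise_cat /= allrel_consr.
        have keq i : i \in lefts z ++ rights z -> upd key n.+1 (f 0) i = key i.
          by move=> /inz; apply: upd_neq.
        have inl_ i : i \in lefts z -> upd key n.+1 (f 0) i = key i.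
          by move=> h; apply: keq; rewrite mem_cat h.
        have inr_ i : i \in rights z -> upd key n.+1 (f 0) i = key i.
          by move=> h; apply: keq; rewrite mem_cat h orbT.
        move: hb; rewrite /bst inT pairwise_cat => /and3P[b1 b2 b3].
        rewrite upd_eq; apply/and3P; split; [apply/andP; split| |apply/andP; split].
        * by apply/allP => i hi; rewrite inl_ ?hl.
        * apply/allrelP => i j' hi hj'; rewrite inl_ ?inr_ //.
          exact: (allrelP b1).
        * by rewrite (eq_pairwise_key _ inl_).
        * by apply/allP => i hi; rewrite inr_ ?hrt.
        * by rewrite (eq_pairwise_key _ inr_).
      + by rewrite i2.
    - apply: (eqx_trans (p' := p')); first by apply: eqx_sub ep.
      by apply: eqx_sub epf.
  + split=> //.
    exists p1, m1, (upd L n.+1 0), (upd R n.+1 0), (upd V n.+1 1), z, Lf, N.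
    split=> //; split=> //.
    * split.
      - by rewrite NE; split; rewrite ?upd_eq.
      - by apply: repz_eq hzT => i /inz; apply: upd_neq.
      - by rewrite ep1.
      - by rewrite p1_14 NE.
    * split=> //; [by rewrite -t0 hpl | by rewrite NE | by rewrite inorder_plug IsE NE].
    * by rewrite -t0 hpl sz.
    * apply: stk_eq hs; move=> x xS; apply: em1; move: xS; clear; lia.
- exists f, (upd (upd (upd p 14 (p 13)) 15 (upd p 14 (p 13) 9)) 19
      (upd (upd p 14 (p 13)) 15 (upd p 14 (p 13) 9) 21)), m.
  split=> //; [by eqxt | right].
  exists [::], T; split=> //.
  by rd; rewrite k9 muln0 addn0.
Qed.

End InsertSpec.

(** * The search

    Nodes are numbered in the order of insertion, so that the tree is its own queue. *)

Definition roots_body : prog 24 := seqp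
  [:: Do (InC (reg 1) (reg 12)); fsub 0 5 1; nonsquare_test;
      Do (InC (reg 0) (reg 12)); insert; padd 12 12 1].

Definition children_body : prog 24 := seqp
  [:: Do (InB (reg 2) (reg 12)); fsub 0 1 2; fmul 0 0 0; Do (InC (reg 2) (reg 12));
      fadd 0 0 2; nonsquare_test; insert; padd 12 12 1].

Definition node_body : prog 24 := seqp
  [:: psub 16 11 20; fload 1 16; pcopy 12 21; While (PLe (reg 12) (reg 22)) children_body;
      padd 11 11 20].

Definition search : prog 24 := seqp
  [:: pcopy 12 21; While (PLe (reg 12) (reg 22)) roots_body;
      padd 11 20 20; While (PLe (reg 11) (reg 10)) node_body].

Section Search.

Context (F : finFieldType) (le : rel F) (r : nat) (b c : 'I_r -> F) (M W : nat).
Context (Len LIM cap D : nat).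
Local Notation STK := (LIM + Len).
Local Notation q := #|F|.
Local Notation runs := (runs le b c M W).
Local Notation konst := (@konst F r Len LIM).
Local Notation table := (@table F Len LIM).
Local Notation ginv := (@ginv F le r Len LIM cap).
Hypothesis letot : total le.
Hypothesis leasym : antisymmetric le.
Hypothesis letr : transitive le.
Hypothesis oF : odd q.
Hypothesis r0 : 0 < r.
Hypothesis Len1 : 1 <= Len.
Hypothesis qLen : q < 2 ^ Len.
Hypothesis lenq : 2 ^ Len <= 2 * q.
Hypothesis MW : M <= W.
Hypothesis qW : 4 * q < W.
Hypothesis rW : r.+1 < W.
Hypothesis LIM_cap : LIM = 4 * cap.+1.
Hypothesis LIM_M : STK + 2 * D + 2 < M.
Hypothesis capD : forall v, 2 ^ v <= cap.+1 -> 2 * v <= D.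

Let DI := dynamically_irreducible (fun i => quadratic (b i) (c i)).
Hypothesis orbit_cap : DI -> forall A : {set F},
  (forall u, u \in A -> reachable b c u) -> #|A| <= cap.

Lemma reachable_root j : reachable b c (c j).
Proof. by exists [::], j; rewrite /= hornerX. Qed.

Definition qval (j : 'I_r) (u : F) : F := ((u - b j) ^+ 2 + c j)%R.

Lemma reachable_qval j u : reachable b c u -> reachable b c (qval j u).
Proof.
case=> s [i ->]; exists (j :: s), i.
by rewrite /= -/(comp_along _ _) horner_comp horner_quadratic.
Qed.

Definition stored (n : nat) (key : nat -> F) (u : F) := exists2 k, 0 < k <= n & key k = u.
Definition all_reachable (n : nat) (key : nat -> F) := forall u, stored n key u -> reachable b c u.
Definition extends (n : nat) (key : nat -> F) n' key' :=
  n <= n' /\ forall k, 0 < k <= n -> key' k = key k.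

Lemma stored_ext n key n' key' u : extends n key n' key' -> stored n key u -> stored n' key' u.
Proof. by move=> [nn h] [k kn e]; exists k; [lia | rewrite h]. Qed.

Lemma ginv_table f p m n key L R V T a : ginv f p m n key L R V T a -> table m.
Proof. by case=> _ [[]]. Qed.

Lemma DI_nonsquare_root j : DI -> ~~ is_square (- c j)%R.
Proof. by move=> /(dynamically_irreducibleP _ _ oF)[h _]; apply: h. Qed.

Lemma DI_nonsquare_qval j u : DI -> reachable b c u -> ~~ is_square (qval j u).
Proof.
move=> /(dynamically_irreducibleP _ _ oF)[_ h] [s [i ->]]; have := h j s i.
by rewrite /= -/(comp_along _ _) horner_comp horner_quadratic.
Qed.

Lemma nonsquare_step f p m n key L R V T a : ginv f p m n key L R V T a ->
  runs nonsquare_test (mkst f p m) (7 * Len + 10) (fun st => exists f' p',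
    [/\ st = mkst f' p' m, ginv f' p' m n key L R V T (a && ~~ is_square (f 0)),
        eqx [:: 0; 14; 16; 17; 18] p p' & eqx [:: 3] f f']).
Proof.
move=> G; have [[hk e10 e13 e0] G2] := G.
have LIM_M' : STK + 2 < M by lia.
have [[k1 k2 k3 k4] [[k5 k8 k9 k20] [k21 k22 k23 kf4 kf5]]] := hk.
apply: (runs_weaken (nonsquare_test_spec le b c Len1 qLen lenq LIM_M' MW qW rW hk (ginv_table G))) => //.
move=> _ [f' [p' [-> ep ef e]]]; exists f', p'; split=> //; split; last by [].
split; [exact: konst_eqx ep ef hk| by rewrite ep | by rewrite ep |].
by rewrite e e0 -euler_nonsquare //; case: a {G e0}; case: (is_square _).
Qed.

(** The two directions of correctness are carried separately: a positive answer certifies that the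
    element is stored, and under [DI] the answer is never cleared. *)
Lemma insert_step f p m n key L R V T a : ginv f p m n key L R V T a -> reachable b c (f 0) ->
  all_reachable n key ->
  runs insert (mkst f p m) (48 * D + 20) (fun st => exists f' p' m' n' key' L' R' V' T' a',
    [/\ st = mkst f' p' m', ginv f' p' m' n' key' L' R' V' T' a',
        eqx [:: 0; 10; 13; 14; 15; 16; 17; 18; 19] p p', eqx [:: 2] f f' &
    [/\ extends n key n' key', all_reachable n' key',
        a' -> a /\ stored n' key' (f 0) & DI -> a -> a']]).
Proof.
move=> G of0 on.
apply: (runs_weaken (insert_spec b c letot leasym letr MW LIM_cap LIM_M capD G)) => //.
move=> _ [f' [p' [m' [n' [key' [L' [R' [V' [T' [a' [-> G' ep ef alt]]]]]]]]]]].
exists f', p', m', n', key', L', R', V', T', a'; split=> //.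
case: alt => [[st -> -> ->]|[new nc -> [-> ->]]|[new nc -> [-> ->]]]; first by split.
  split=> //.
  - by split=> // k kn; rewrite upd_neq //; lia.
  - move=> u [k kn]; case: (eqVneq k n.+1) => [->|kn']; first by rewrite upd_eq => <-.
    by rewrite upd_neq // => e; apply: on; exists k => //; lia.
  - by move=> ->; split=> //; exists n.+1; rewrite ?upd_eq //; lia.
(* The memory is full: the [cap] stored keys and the new one are distinct reachable elements, more
   than [DI] allows. *)
split=> // di _.
have [_ [_ [hb hp]]] := G.
pose s := f 0 :: [seq key i | i <- iota 1 n].
have us : uniq s.
  rewrite /=; apply/andP; split.
    apply/mapP => -[k]; rewrite mem_iota add1n ltnS => /new + e.
    by rewrite e eqxx.
  rewrite -(perm_uniq (perm_map key hp)) uniq_pairwise pairwise_map.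
  by apply: sub_pairwise hb => i j /andP[].
have := orbit_cap di (A := [set x in s]).
have -> : #|[set x in s]| = n.+1 by rewrite cardsE (card_uniqP us) /= size_map size_iota.
rewrite nc ltnn; apply=> u; rewrite inE in_cons => /orP[/eqP -> //|/mapP[k hk ->]].
by apply: on; exists k => //; move: hk; rewrite mem_iota add1n ltnS.
Qed.

Lemma ginv_eqx X Y f p f' p' m n key L R V T a :
  all (fun i => i \notin X) [:: 0; 1; 2; 3; 4; 5; 8; 9; 10; 13; 20; 21; 22; 23] ->
  all (fun i => i \notin Y) [:: 4; 5] -> eqx X p p' -> eqx Y f f' ->
  ginv f p m n key L R V T a -> ginv f' p' m n key L R V T a.
Proof.
move=> /allP hX hY ep ef [[hk e10 e13 e0] G2]; split=> //.
have h i : i \in [:: 0; 1; 2; 3; 4; 5; 8; 9; 10; 13; 20; 21; 22; 23] -> p' i = p i.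
  by move=> hi; apply: ep; apply: (hX i hi).
split; rewrite ?h //; apply: konst_eqx ep ef hk => //.
apply/allP => i hi; apply: (hX i); move: i hi.
by apply/allP.
Qed.

Definition roots_ok n key i :=
  forall j : 'I_r, j < i -> ~~ is_square (- c j)%R /\ stored n key (c j).
Definition children_ok n key u i :=
  forall j : 'I_r, j < i -> ~~ is_square (qval j u) /\ stored n key (qval j u).

Lemma roots_ok_ext n key n' key' i :
  extends n key n' key' -> roots_ok n key i -> roots_ok n' key' i.
Proof. by move=> e h j /h[h1 h2]; split=> //; apply: stored_ext h2. Qed.

Lemma children_ok_ext n key n' key' u i :
  extends n key n' key' -> children_ok n key u i -> children_ok n' key' u i.
Proof. by move=> e h j /h[h1 h2]; split=> //; apply: stored_ext h2. Qed.

Definition body_cost := 7 * Len + 48 * D + 36.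

(** [j] polynomials remain. A positive answer vouches for those already treated, while [DI] forces
    the answer to be positive still. *)
Definition roots_inv j st := exists f p m n key L R V T a,
  [/\ st = mkst f p m, ginv f p m n key L R V T a, all_reachable n key, p 12 = r - j /\ j <= r &
      (a -> roots_ok n key (r - j)) /\ (DI -> a)].

Lemma roots_step j st : roots_inv j st -> holds le (PLe (reg 12) (reg 22)) st ->
  exists2 j', j = j'.+1 & runs roots_body st body_cost (roots_inv j').
Proof.
move=> [f [p [m [n [key [L [R [V [T [a [-> G on [e12 jr] [ha da]]]]]]]]]]]].
have [[hk e10 e13 e0] _] := G.
have [[k1 k2 k3 k4] [[k5 k8 k9 k20] [k21 k22 k23 kf4 kf5]]] := hk.
rewrite holds_PLe // e12 k22 => hj.
case: j jr e12 hj ha => [|j] jr e12 hj ha; first by lia.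
exists j => //.
have ir : r - j.+1 < r by lia.
pose i := Ordinal ir.
apply: (@runs_le _ _ _ _ _ _ _ _ _ (2 + ((7 * Len + 10) + (1 + ((48 * D + 20) + 1))))).
  by rewrite /body_cost; lia.
rewrite /roots_body.
apply: (@run_InC _ _ _ _ _ _ _ _ _ _ _ _ _ _ _ i) => //.
istep.
set f1' := upd _ 0 (_ - _)%R.
have f10 : f1' 0 = (- c i)%R by rewrite /f1'; rd; rewrite kf5 sub0r.
have ef1 : eqx [:: 0; 1] f f1' by rewrite /f1'; eqxt.
clearbody f1'.
have G1 : ginv f1' p m n key L R V T a.
  by apply: (ginv_eqx (X := [::]) (Y := [:: 0; 1])) G => //; eqxt.
apply: runs_cons; apply: (runs_weaken (nonsquare_step G1)) => //.
move=> _ [f2 [p2 [-> G2 ep2 ef2]]]; rewrite f10 in G2.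
apply: (@run_InC _ _ _ _ _ _ _ _ _ _ _ _ _ _ _ i) => //; first by rewrite ep2.
have G3 : ginv (upd f2 0 (c i)) p2 m n key L R V T (a && ~~ is_square (- c i)%R).
  by apply: (ginv_eqx (X := [::]) (Y := [:: 0])) G2 => //; eqxt.
apply: runs_cons; apply: (runs_weaken (insert_step G3 (reachable_root i) on)) => //.
move=> _ [f4 [p4 [m4 [n4 [key4 [L4 [R4 [V4 [T4 [a4 [-> G4 ep4 ef4 [ext4 on4 as4 da4]]]]]]]]]]]].
have aa4 h := (as4 h).1; have st4 h := (as4 h).2.
have p41 : p4 1 = 1 by rewrite ep4 // ep2.
have p412 : p4 12 = r - j.+1 by rewrite ep4 // ep2.
istep; first by lia.
apply: runs_nil.
exists f4, (upd p4 12 (p4 12 + p4 1)), m4, n4, key4, L4, R4, V4, T4, a4; split=> //.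
- by rewrite upd_eq p41 p412; lia.
split.
  move=> ha4; have /andP[ha0 nsq] := aa4 ha4.
  have ro := roots_ok_ext ext4 (ha ha0).
  move=> x xj; have [xi|xi] : x < r - j.+1 \/ x = i :> nat by rewrite /=; lia.
    exact: ro.
  have -> : x = i by apply/val_inj.
  by split=> //; apply: st4.
by move=> di; apply: da4 => //; rewrite da //= DI_nonsquare_root.
Qed.

Definition processed n key h a := [/\ a -> roots_ok n key r,
  a -> forall k, 0 < k < h -> children_ok n key (key k) r & DI -> a].

Definition children_inv h u j st := exists f p m n key L R V T a,
  [/\ st = mkst f p m, ginv f p m n key L R V T a, all_reachable n key, p 12 = r - j /\ j <= r &
   [/\ p 11 = 4 * h.+1, f 1 = u, 0 < h <= n /\ key h = u, processed n key h a &
      a -> children_ok n key u (r - j)]].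

Lemma children_step h u j st : children_inv h u j st -> holds le (PLe (reg 12) (reg 22)) st ->
  exists2 j', j = j'.+1 & runs children_body st body_cost (children_inv h u j').
Proof.
move=> [f [p [m [n [key [L [R [V [T [a [-> G on [e12 jr] [e11 f1 [hn kh] pr ha]]]]]]]]]]]].
have [[hk e10 e13 e0] _] := G.
have [[k1 k2 k3 k4] [[k5 k8 k9 k20] [k21 k22 k23 kf4 kf5]]] := hk.
rewrite holds_PLe // e12 k22 => hj.
case: j jr e12 hj ha => [|j] jr e12 hj ha; first by lia.
exists j => //.
have ir : r - j.+1 < r by lia.
pose i := Ordinal ir.
have uo : reachable b c u by apply: on; exists h.
apply: (@runs_le _ _ _ _ _ _ _ _ _ (5 + ((7 * Len + 10) + ((48 * D + 20) + 1)))).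
  by rewrite /body_cost; lia.
rewrite /children_body.
apply: (@run_InB _ _ _ _ _ _ _ _ _ _ _ _ _ _ _ i) => //.
istep.
istep.
apply: (@run_InC _ _ _ _ _ _ _ _ _ _ _ _ _ _ _ i) => //.
istep.
set f1' := upd _ 0 (_ + _)%R.
have f10 : f1' 0 = qval i u by rewrite /f1' /qval; rd; rewrite f1 expr2.
have f11 : f1' 1 = u by rewrite -f1.
have ef1 : eqx [:: 0; 2] f f1' by rewrite /f1'; eqxt.
clearbody f1'.
have G1 : ginv f1' p m n key L R V T a.
  by apply: (ginv_eqx (X := [::]) (Y := [:: 0; 2])) G => //; eqxt.
apply: runs_cons; apply: (runs_weaken (nonsquare_step G1)) => //.
move=> _ [f2 [p2 [-> G2 ep2 ef2]]].
have f20 : f2 0 = qval i u by rewrite ef2.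
have of2 : reachable b c (f2 0) by rewrite f20; apply: reachable_qval.
rewrite f10 in G2.
apply: runs_cons; apply: (runs_weaken (insert_step G2 of2 on)) => //.
move=> _ [f4 [p4 [m4 [n4 [key4 [L4 [R4 [V4 [T4 [a4 [-> G4 ep4 ef4 [ext4 on4 as4 da4]]]]]]]]]]]].
have aa4 h := (as4 h).1; have st4 h := (as4 h).2.
have p41 : p4 1 = 1 by rewrite ep4 // ep2.
have p412 : p4 12 = r - j.+1 by rewrite ep4 // ep2.
istep; first by lia.
apply: runs_nil.
have [nn4 hext] := ext4.
have [pr1 pr2 pr3] := pr.
exists f4, (upd p4 12 (p4 12 + p4 1)), m4, n4, key4, L4, R4, V4, T4, a4; split=> //.
- by rewrite upd_eq p41 p412; lia.
split.
- by rewrite upd_neq // ep4 // ep2.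
- by rewrite ef4 // ef2.
- by split; [lia | rewrite hext].
- split.
  + by move=> /aa4 /andP[/pr1 h0 _]; apply: roots_ok_ext h0.
  + move=> /aa4 /andP[/pr2 h0 _] k kh0; rewrite hext; last by lia.
    by apply: children_ok_ext (h0 k kh0).
  + move=> di; apply: da4 => //; rewrite pr3 //=.
    exact: DI_nonsquare_qval.
move=> ha4; have /andP[ha0 nsq] := aa4 ha4.
have ro := children_ok_ext ext4 (ha ha0).
move=> x xj; have [xi|xi] : x < r - j.+1 \/ x = i :> nat by rewrite /=; lia.
  exact: ro.
have -> : x = i by apply/val_inj.
by split=> //; rewrite -f20; apply: st4.
Qed.

(** The node under examination is [h = cap.+1 - j]. Register 11 holds its end, so that comparison
    with the first free address by [<=] says whether node [h] exists. *)
Definition node_inv j st := exists f p m n key L R V T a,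
  [/\ st = mkst f p m, ginv f p m n key L R V T a, all_reachable n key, j <= cap &
   [/\ p 11 = 4 * (cap.+1 - j).+1, cap.+1 - j <= n.+1 & processed n key (cap.+1 - j) a]].

Definition node_cost := r * body_cost.+1 + 5.

Lemma node_step j st : node_inv j st -> holds le (PLe (reg 11) (reg 10)) st ->
  exists2 j', j = j'.+1 & runs node_body st node_cost (node_inv j').
Proof.
move=> [f [p [m [n [key [L [R [V [T [a [-> G on jc [e11 hn pr]]]]]]]]]]]].
have [[hk e10 e13 e0] [[H tb hr aT] _]] := G.
have [[k1 k2 k3 k4] [[k5 k8 k9 k20] [k21 k22 k23 kf4 kf5]]] := hk.
have [nc _ _ hkey] := H.
rewrite holds_PLe // e11 e10 => hj.
case: j jc e11 hn pr hj => [|j] jc e11 hn pr hj; first by lia.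
exists j => //; set h := cap.+1 - j.+1 in e11 hn pr hj.
have hE : cap.+1 - j = h.+1 by rewrite /h; lia.
have hn' : 0 < h <= n by rewrite /h; lia.
clearbody h.
apply: (@runs_le _ _ _ _ _ _ _ _ _ (3 + ((r * body_cost.+1).+1 + 1))).
  by rewrite /node_cost; lia.
rewrite /node_body; istep; first by lia.
apply: (run_FLoad (v := key h)) => //; [rd; lia | by rd; rewrite e11 k20 -hkey //; congr m; lia |].
istep; first by lia.
apply: runs_cons.
apply: (runs_while (I := children_inv h (key h)) (cost := body_cost) (j := r)).
- by move=> i s; apply: children_step.
- move=> i _ [f1 [p1 [m1 [n1 [key1 [L1 [R1 [V1 [T1 [a1 [-> G1 on1 [e12 ir] [e11' ff [hn1 kh] pr1 ha]]]]]]]]]]]].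
  have [[hk1 _ _ _] [[H1 _ _ _] _]] := G1; have [nc1 _ _ _] := H1.
  have [[k1' k2' k3' k4'] [[k5' k8' k9' k20'] [k21' k22' k23' kf4' kf5']]] := hk1.
  rewrite holds_PLe // e12 k22' => hi.
  have i0 : i = 0 by lia.
  rewrite i0 subn0 in ha.
  (* Slack in the memory size, which keeps the end of the next node below [W] even past the last
     node. *)
  have D2 : 2 * 1 <= D by apply: capD; lia.
  istep; first by lia.
  apply: runs_nil.
  exists f1, (upd p1 11 (p1 11 + p1 20)), m1, n1, key1, L1, R1, V1, T1, a1; split=> //.
  + by lia.
  rewrite hE upd_eq; split; [lia | lia |].
  have [q1 q2 q3] := pr1; split=> // a1t k; rewrite ltnS => kh1.
  case: (eqVneq k h) => [->|khn]; first by rewrite kh; apply: ha.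
  by apply: q2 => //; lia.
- eexists _, _, m, n, key, L, R, V, T, a; split; first reflexivity => //.
  + by apply: (ginv_eqx (X := [:: 12; 16]) (Y := [:: 1])) G => //; eqxt.
  + by [].
  + by rd; rewrite k21 subnn.
  by split=> //; rewrite subnn.
Qed.

Definition search_cost := 3 + (r * body_cost.+1).+1 + (cap * node_cost.+1).+1.

Lemma search_spec f p m L R V : ginv f p m 0 (fun=> 0%R) L R V Lf true ->
  runs search (mkst f p m) search_cost (fun st => exists a : bool,
    preg st (reg 0) = a /\ (a <-> DI)).
Proof.
move=> G; have [[hk e10 e13 e0] _] := G.
have [[k1 k2 k3 k4] [[k5 k8 k9 k20] [k21 k22 k23 kf4 kf5]]] := hk.
apply: (@runs_le _ _ _ _ _ _ _ _ _ (1 + ((r * body_cost.+1).+1 + (1 + ((cap * node_cost.+1).+1 + 0))))).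
  by rewrite /search_cost; lia.
rewrite /search; istep; first by lia.
apply: runs_cons.
apply: (runs_while (I := roots_inv) (cost := body_cost) (j := r)).
- by move=> i s; apply: roots_step.
- move=> i _ [f1 [p1 [m1 [n1 [key1 [L1 [R1 [V1 [T1 [a1 [-> G1 on1 [e12 ir] [ha da]]]]]]]]]]]].
  have [[hk1 _ _ _] [[H1 _ _ _] _]] := G1; have [nc1 _ _ _] := H1.
  have [[k1' k2' k3' k4'] [[k5' k8' k9' k20'] [k21' k22' k23' kf4' kf5']]] := hk1.
  rewrite holds_PLe // e12 k22' => hi.
  have i0 : i = 0 by lia.
  rewrite i0 subn0 in ha.
  istep; first by rewrite k20'; have q1 : 1 < q := finNzRing_gt1 F; lia.
  apply: runs_cons.
  apply: (runs_while (I := node_inv) (cost := node_cost) (j := cap)).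
  + by move=> j s; apply: node_step.
  + move=> j _ [f2 [p2 [m2 [n2 [key2 [L2 [R2 [V2 [T2 [a2 [-> G2 on2 jc [e11 hn [q1 q2 q3]]]]]]]]]]]]].
    have [[_ e10' _ e0'] _] := G2.
    rewrite holds_PLe // e11 e10' => hj.
    apply: runs_nil; exists a2; rewrite mk_preg //; split=> //.
    split=> [a2t|/q3 //].
    (* The stored set contains all [c j] and is closed under the quadratics, so it contains the
       whole orbit. *)
    have closed s j0 : stored n2 key2 ((comp_along (fun i => quadratic (b i) (c i)) s).[c j0])%R.
      elim: s => [|x s [k kn ks]] /=; first by rewrite hornerX; apply: (q1 a2t j0 _).2.
      rewrite -/(comp_along _ _) horner_comp horner_quadratic -ks.
      by apply: (q2 a2t k _ x _).2 => //; lia.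
    apply/(dynamically_irreducibleP _ _ oF); split=> [x|x s y].
      exact: (q1 a2t x _).1.
    rewrite /= -/(comp_along _ _) horner_comp horner_quadratic.
    have [k kn <-] := closed s y.
    by apply: (q2 a2t k _ x _).1 => //; lia.
  + exists f1, (upd p1 11 (p1 20 + p1 20)), m1, n1, key1, L1, R1, V1, T1, a1; split=> //.
    rewrite subSnn upd_eq; split=> //; first by rewrite k20'.
    by split=> // _ k; lia.
- eexists _, _, m, 0, (fun=> 0%R), L, R, V, Lf, true; split; first reflexivity => //.
  + by apply: (ginv_eqx (X := [:: 12]) (Y := [::])) G => //; eqxt.
  + by move=> u [k]; lia.
  + by rewrite upd_eq k21 subnn.
  by split=> // _ j; rewrite subnn.
Qed.

End Search.

(** * Initialisation of registers and memory *)

Definition consts_code : prog 24 := seqp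
  [:: pconst 1 1; pconst 2 2; pconst 3 3; pconst 20 4; Do (InR (reg 4)); Do (InQ (reg 5));
      Do (FOne (reg 3)); fsub 4 5 3; psub 22 4 1].

Definition log_code : prog 24 := seqp
  [:: pcopy 16 1; While (PLe (reg 16) (reg 5)) (seqp [:: padd 16 16 16; padd 6 6 1])].

(* Register 16 runs through the squares [(i + 1) ^ 2] and register 17 through their
   differences. *)
Definition sqrt_code : prog 24 := seqp
  [:: pcopy 16 1; pcopy 17 3;
      While (PLe (reg 16) (reg 5)) (seqp [:: padd 7 7 1; padd 16 16 17; padd 17 17 2])].

(** Pointers can only be added and subtracted, so this is multiplication by repeated addition. *)
Definition times_len x y : prog 24 := seqp
  [:: pcopy x 21; pcopy 17 6;
      While (PLe (reg 1) (reg 17)) (seqp [:: padd x x y; psub 17 17 1])].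

(* [LIM = 2 ^ 9 * Len ^ 2 * l + 4], the room for [128 * Len ^ 2 * l] nodes and node 0. *)
Definition lim_code : prog 24 := seqp
  [:: times_len 16 7; times_len 18 16;
      padd 18 18 18; padd 18 18 18; padd 18 18 18; padd 18 18 18; padd 18 18 18;
      padd 18 18 18; padd 18 18 18; padd 18 18 18; padd 18 18 18; padd 8 18 20].

Definition table_code : prog 24 := seqp
  [:: pcopy 16 1; pcopy 9 8;
      While (PLe (reg 16) (reg 5)) (seqp [:: pstore 9 16; padd 16 16 16; padd 9 9 1]);
      padd 23 9 1; pcopy 10 20; pcopy 0 1].

Definition decide : prog 24 := seqp
  [:: consts_code; log_code; sqrt_code; lim_code; table_code; search].

Section Setup.

Context (F : finFieldType) (le : rel F) (r : nat) (b c : 'I_r -> F) (M W : nat).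
Context (Len l LIM cap : nat).
Local Notation STK := (LIM + Len).
Local Notation q := #|F|.
Local Notation runs := (runs le b c M W).
Local Notation ginv := (@ginv F le r Len LIM cap).
Hypothesis Len1 : 1 <= Len.
Hypothesis qLen : q < 2 ^ Len.
Hypothesis qLen1 : 2 ^ Len.-1 <= q.
Hypothesis lq1 : l * l <= q.
Hypothesis lq2 : q <= l * l + 2 * l.
Hypothesis MW : M <= W.
Hypothesis qW : 4 * q + 8 < W.
Hypothesis rW : r.+1 < W.
Hypothesis LIM_cap : LIM = 4 * cap.+1.
Hypothesis capE : cap = 128 * (Len * (Len * l)).
Hypothesis LIM_M : STK + 2 < M.

Definition base (f : nat -> F) (p : nat -> nat) : Prop :=
  [/\ p 1 = 1, p 2 = 2, p 3 = 3 & p 4 = r] /\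
  [/\ p 5 = q, p 20 = 4, p 21 = 0, p 22 = r.-1 & p 13 = 0] /\ f 4 = (-1)%R /\ f 5 = 0%R.

Lemma base_eqx X f p p' :
  all (fun i => i \notin X) [:: 1; 2; 3; 4; 5; 13; 20; 21; 22] ->
  eqx X p p' -> base f p -> base f p'.
Proof.
move=> /allP hX ep [[? ? ? ?] [[? ? ? ? ?] ff]].
have h i : i \in [:: 1; 2; 3; 4; 5; 13; 20; 21; 22] -> p' i = p i.
  by move=> hi; apply: ep; apply: (hX i hi).
by rewrite /base !h.
Qed.

Lemma consts_spec m : runs consts_code (mkst (fun=> 0%R) (fun=> 0) m) 9
  (fun st => exists f p, [/\ st = mkst f p m, base f p, p 6 = 0 & p 7 = 0]).
Proof.
have q1 : 1 < q := finNzRing_gt1 F.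
rewrite /consts_code.
do 4 (istep; first by lia).
apply: run_InR => //; first by lia.
apply: run_InQ => //; first by lia.
istep.
istep.
istep; first by lia.
apply: runs_nil; eexists _, _; split; first reflexivity => //; last by [].
  split; [by []|split]; [split; rd; by rewrite ?subn1 | split=> //; rd].
  by rewrite sub0r.
by [].
Qed.

Lemma log_spec f p m : base f p -> p 6 = 0 -> runs log_code (mkst f p m) (3 * Len + 2)
  (fun st => exists p', [/\ st = mkst f p' m, eqx [:: 6; 16] p p' & p' 6 = Len]).
Proof.
move=> [[k1 k2 k3 k4] [[k5 k20 k21 k22 k13] _]] p6.
apply: (@runs_le _ _ _ _ _ _ _ _ _ (1 + ((Len * 3).+1 + 0))); first by lia.
rewrite /log_code; istep; first by lia.
apply: runs_cons.
apply: (runs_while (I := fun j st => exists p', [/\ st = mkst f p' m, eqx [:: 6; 16] p p',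
  p' 16 = 2 ^ (Len - j), p' 6 = Len - j & j <= Len]) (cost := 2) (j := Len)).
- move=> j _ [p' [-> ep e16 e6 jL]]; rewrite holds_PLe // e16 ep // k5 => hj.
  case: j e16 e6 jL hj => [|j] e16 e6 jL hj; first by move: hj; rewrite subn0; lia.
  exists j => //.
  have e1 : p' 1 = 1 by rewrite ep.
  have eL : Len - j = (Len - j.+1).+1 by lia.
  have Lq : Len <= q.
    by apply: leq_trans qLen1; rewrite -{1}(prednK Len1); apply: ltn_expl.
  istep; first by lia.
  istep; first by lia.
  apply: runs_nil; eexists; split; first reflexivity.
  + by eqxt.
  + by rd; rewrite e16 eL expnS; lia.
  + by rd; rewrite e6 e1; lia.
  + by lia.
- move=> j _ [p' [-> ep e16 e6 jL]]; rewrite holds_PLe // e16 ep // k5 => hj.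
  apply: runs_nil; exists p'; split=> //; rewrite e6.
  suff : j = 0 by lia.
  apply/eqP; rewrite -leqn0 leqNgt; apply: contra hj => j0.
  by apply: leq_trans qLen1; rewrite leq_exp2l //; lia.
- eexists; split; first reflexivity; [by eqxt | | | by []].
  + by rd; rewrite k1 subnn.
  + by rd; rewrite p6 subnn.
Qed.

Lemma sqrt_spec f p m : base f p -> p 7 = 0 -> runs sqrt_code (mkst f p m) (4 * l + 3)
  (fun st => exists p', [/\ st = mkst f p' m, eqx [:: 7; 16; 17] p p' & p' 7 = l]).
Proof.
move=> [[k1 k2 k3 k4] [[k5 k20 k21 k22 k13] _]] p7.
apply: (@runs_le _ _ _ _ _ _ _ _ _ (2 + ((l * 4).+1 + 0))); first by lia.
rewrite /sqrt_code; istep; first by lia.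
istep; first by lia.
apply: runs_cons.
apply: (runs_while (I := fun j st => exists p', [/\ st = mkst f p' m, eqx [:: 7; 16; 17] p p',
  p' 16 = (l - j).+1 * (l - j).+1, p' 7 = l - j & p' 17 = 2 * (l - j) + 3 /\ j <= l])
  (cost := 3) (j := l)).
- move=> j _ [p' [-> ep e16 e7 [e17 jl]]]; rewrite holds_PLe // e16 ep // k5 => hj.
  case: j e16 e7 e17 jl hj => [|j] e16 e7 e17 jl hj; first by move: hj; rewrite subn0; lia.
  exists j => //.
  have e1 : p' 1 = 1 by rewrite ep.
  have e2 : p' 2 = 2 by rewrite ep.
  have eL : l - j = (l - j.+1).+1 by lia.
  have jj : l - j.+1 <= (l - j.+1) * (l - j.+1) by case: (l - j.+1) => // x; rewrite leq_pmulr.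
  move: (l - j.+1) jj eL e16 e7 e17 hj => x jj eL e16 e7 e17 hj.
  istep; first by lia.
  istep; first by lia.
  istep; first by lia.
  apply: runs_nil; eexists; split; first reflexivity.
  + by eqxt.
  + by rd; rewrite e16 e17 eL; lia.
  + by rd; rewrite e7 e1 eL; lia.
  + by rd; rewrite e17 e2 eL; lia.
- move=> j _ [p' [-> ep e16 e7 [e17 jl]]]; rewrite holds_PLe // e16 ep // k5 => hj.
  apply: runs_nil; exists p'; split=> //; rewrite e7.
  suff : j = 0 by lia.
  apply/eqP; rewrite -leqn0 leqNgt; apply: contra hj => j0.
  by apply: leq_trans lq1; apply: leq_mul; lia.
- eexists; split; first reflexivity; [by eqxt | | | ].
  + by rd; rewrite k1 subnn.
  + by rd; rewrite p7 subnn.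
  + by rd; rewrite k3 subnn.
Qed.

Lemma times_len_spec x y v f p m : base f p -> p 6 = Len -> p y = v -> Len * v < W ->
  x < 24 -> y < 24 ->
  all (fun i => i \notin [:: x; 17]) [:: 1; 6; y; 21] -> x != 17 ->
  runs (times_len x y) (mkst f p m) (3 * Len + 3)
  (fun st => exists p', [/\ st = mkst f p' m, eqx [:: x; 17] p p' & p' x = Len * v]).
Proof.
move=> [[k1 k2 k3 k4] [[k5 k20 k21 k22 k13] _]] p6 py LW x24 y24 /allP hX x17.
have xX : x \in [:: x; 17] by rewrite mem_head.
have hX17 : 17 \in [:: x; 17] by rewrite !inE eqxx orbT.
have LenW : Len < W.
  have : Len <= q; last by lia.
  by apply: leq_trans qLen1; rewrite -{1}(prednK Len1); apply: ltn_expl.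
apply: (@runs_le _ _ _ _ _ _ _ _ _ (2 + ((Len * 3).+1 + 0))); first by lia.
have x6 : 6 != x by have := hX 6 isT; rewrite !inE; case: eqP.
rewrite /times_len; apply: run_PCopy => //; first by lia.
apply: run_PCopy => //; first by rewrite upd_neq // p6.
apply: runs_cons.
apply: (runs_while (I := fun j st => exists p', [/\ st = mkst f p' m, eqx [:: x; 17] p p',
  p' x = (Len - j) * v, p' 17 = j & j <= Len]) (cost := 2) (j := Len)).
- move=> j _ [p' [-> ep ex e17 jL]]; rewrite holds_PLe // ep ?(hX 1) // k1 e17 => hj.
  case: j e17 jL hj ex => // j e17 jL _ ex; exists j => //.
  have e1 : p' 1 = 1 by rewrite ep ?(hX 1).
  have ey : p' y = v by rewrite ep ?(hX y) // !inE eqxx !orbT.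
  have le1 : (Len - j.+1) * v + v <= Len * v.
    by rewrite -mulSnr leq_mul2r; apply/orP; right; lia.
  apply: run_PAdd => //; first by lia.
  apply: run_PSub => //; first by rewrite !upd_neq ?e17 ?e1 1?eq_sym //; [lia | by have := hX 1 isT; rewrite !inE eq_sym; case: eqP].
  apply: runs_nil; eexists; split; first reflexivity.
  + by apply: eqx_upd hX17 _; apply: eqx_upd xX _.
  + by rewrite upd_neq // upd_eq ex ey -mulSnr; congr (_ * _); lia.
  + rewrite upd_eq !upd_neq ?e17 ?e1 1?eq_sym //; [lia | by have := hX 1 isT; rewrite !inE eq_sym; case: eqP].
  + by lia.
- move=> j _ [p' [-> ep ex e17 jL]]; rewrite holds_PLe // ep ?(hX 1) // k1 e17 => hj.
  apply: runs_nil; exists p'; split=> //; rewrite ex.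
  by have -> : Len - j = Len by lia.
- eexists; split; first reflexivity.
  + by apply: eqx_upd hX17 _; apply: eqx_upd xX _.
  + by rewrite upd_neq // upd_eq k21 subnn.
  + by rewrite upd_eq upd_neq // p6.
  + by [].
Qed.

Lemma lim_spec f p m : base f p -> p 6 = Len -> p 7 = l -> runs lim_code (mkst f p m) (6 * Len + 16)
  (fun st => exists p', [/\ st = mkst f p' m, eqx [:: 8; 16; 17; 18] p p' & p' 8 = LIM]).
Proof.
move=> B p6 p7.
have LW : 512 * (Len * (Len * l)) + 4 < W by lia.
apply: (@runs_le _ _ _ _ _ _ _ _ _ ((3 * Len + 3) + ((3 * Len + 3) + 10))); first by lia.
rewrite /lim_code; apply: runs_cons.
have LW1 : Len * l < W.
  by apply: (@leq_ltn_trans (Len * (Len * l))); [rewrite leq_pmull | lia].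
apply: (runs_weaken (times_len_spec m B p6 p7 LW1 _ _ _ _)) => //.
move=> _ [p1 [-> ep1 e16]].
have B1 : base f p1 by apply: base_eqx ep1 B.
have p16 : p1 6 = Len by rewrite ep1.
apply: runs_cons; apply: (runs_weaken (times_len_spec m B1 p16 e16 _ _ _ _ _)) => //; first by lia.
move=> _ [p2 [-> ep2 e18]].
have B2 : base f p2 by apply: base_eqx ep2 B1.
have [_ [[_ k20 _ _ _] _]] := B2.
do 9 (istep; first by lia).
istep; first by rewrite k20 e18; lia.
apply: runs_nil; eexists; split; first reflexivity.
- do 10 (apply: eqx_upd; first by []).
  apply: (eqx_trans (p' := p1)); first by apply: eqx_sub ep1.
  by apply: eqx_sub ep2.
- by rd; rewrite k20 e18 LIM_cap capE; lia.
Qed.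

(** Node 0 is never written: its fields are the zeros of the initial memory, and the table starts
    above it. *)
Lemma table_spec f p m : base f p -> p 8 = LIM -> (forall a, a < 4 -> m a = inr 0) ->
  runs table_code (mkst f p m) (4 * Len + 6)
  (fun st => exists p' m', st = mkst f p' m' /\
    ginv f p' m' 0 (fun=> 0%R) (fun=> 0) (fun=> 0) (fun=> 0) Lf true).
Proof.
move=> B p8 m4; have [[k1 k2 k3 k4] [[k5 k20 k21 k22 k13] [kf4 kf5]]] := B.
apply: (@runs_le _ _ _ _ _ _ _ _ _ (2 + ((Len * 4).+1 + 3))); first by lia.
rewrite /table_code; istep; first by lia.
istep; first by lia.
apply: runs_cons.
apply: (runs_while (I := fun j st => exists p' m', [/\ st = mkst f p' m', eqx [:: 9; 16] p p',
  eq_below LIM m m', p' 16 = 2 ^ (Len - j) /\ p' 9 = LIM + (Len - j) &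
  j <= Len /\ forall i, i < Len - j -> m' (LIM + i) = inr (2 ^ i)]) (cost := 3) (j := Len)).
- move=> j _ [p' [m' [-> ep em [e16 e9] [jL tb]]]]; rewrite holds_PLe // e16 ep // k5 => hj.
  case: j e16 e9 jL hj tb => [|j] e16 e9 jL hj tb; first by move: hj; rewrite subn0; lia.
  exists j => //.
  have e1 : p' 1 = 1 by rewrite ep.
  have eL : Len - j = (Len - j.+1).+1 by lia.
  istep; first by lia.
  istep; first by lia.
  istep; first by lia.
  apply: runs_nil; eexists _, _; split; first reflexivity.
  + by eqxt.
  + by move=> a aL; rewrite upd_neq ?em //; lia.
  + split; rd; first by rewrite e16 eL expnS; lia.
    by rewrite e9 e1; lia.
  split; first by lia.
  move=> i; rewrite eL ltnS leq_eqVlt => /orP[/eqP ->|iL].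
    by rewrite -e9 upd_eq e16.
  by rewrite upd_neq ?tb //; lia.
- move=> j _ [p' [m' [-> ep em [e16 e9] [jL tb]]]]; rewrite holds_PLe // e16 ep // k5 => hj.
  have j0 : j = 0.
    apply/eqP; rewrite -leqn0 leqNgt; apply: contra hj => j0.
    by apply: leq_trans qLen1; rewrite leq_exp2l //; lia.
  rewrite j0 subn0 in e9 tb.
  have e1 : p' 1 = 1 by rewrite ep.
  have e20 : p' 20 = 4 by rewrite ep.
  istep; first by lia.
  istep; first by lia.
  istep; first by lia.
  apply: runs_nil; eexists _, _; split; first reflexivity.
  split; [|split; [|split=> //]].
  + split; [split; [|split] | | |]; rd; rewrite ?e20 ?e1 ?e9 ?ep ?k13 ?addn1 //.
  + split=> //.
    split=> // [i|i]; last by case: i.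
    by rewrite leqn0 => /eqP ->; rewrite !em ?m4 //; lia.
- eexists _, _; split; first reflexivity; [by eqxt | by [] | |].
  + by split; rd; rewrite ?k1 ?subnn // p8 addn0.
  + by rewrite subnn.
Qed.

End Setup.

(** * Choice of the parameters and total cost *)

Lemma exists_isqrt n : exists l, l * l <= n /\ n <= l * l + 2 * l.
Proof.
elim: n => [|n [l [h1 h2]]]; first by exists 0.
have [h|h] := leqP (l.+1 * l.+1) n.+1; first by exists l.+1; lia.
by exists l; lia.
Qed.

(** The ratio is largest at [n = 6], where it is 40.5. *)
Lemma quartic_leq_exp n : 0 < n -> n ^ 4 <= 41 * 2 ^ n.-1.
Proof.
case: n => // n _; elim: n => // n IH.
have [n4|n4] := leqP n 4.
  by clear IH; case: n n4 => [|[|[|[|[|]]]]].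
rewrite [n.+2.-1]/= [2 ^ n.+1]expnS mulnCA; apply: leq_trans _ (leq_mul (leqnn 2) IH).
rewrite !expnS !expn0 !muln1; nia.
Qed.

Section Decide.

Context (F : finFieldType) (le : rel F) (r : nat) (b c : 'I_r -> F) (L l : nat).
Local Notation q := #|F|.
(** 128 is a power of 2 large enough for [1 + 84 x <= 128 x], so [LIM] is reached by doublings. [M]
    holds the nodes, the table and two cells for each of [D] frames. *)
Local Notation cap := (128 * (L * (L * l))).
Local Notation LIM := (4 * cap.+1).
Local Notation D := (6 * L + 16).
Local Notation M := (LIM + L + 2 * D + 3).
Local Notation W := (4000 * (q + r)).
Hypothesis letot : total le.
Hypothesis leasym : antisymmetric le.
Hypothesis letr : transitive le.
Hypothesis oF : odd q.
Hypothesis r2 : 2 <= r.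
Hypothesis L1 : 0 < L.
Hypothesis qL1 : 2 ^ L.-1 <= q.
Hypothesis qL : q < 2 ^ L.
Hypothesis lq1 : l * l <= q.
Hypothesis lq2 : q <= l * l + 2 * l.
Hypothesis inj : injective (fun i => quadratic (b i) (c i)).

Let q1 : 1 < q. Proof. exact: finNzRing_gt1. Qed.

Let q3 : 3 <= q.
Proof. by move: q1 oF; case: q => [|[|[|n]]]. Qed.

Let l1 : 1 <= l.
Proof. by rewrite lt0n; apply/eqP => l0; move: lq2 q1; rewrite l0; lia. Qed.

(** After squaring, [L ^ 4 * l ^ 2 <= 41 * q * q], and [41 <= 7 ^ 2]. This keeps all addresses below
    a multiple of [q], despite the logarithmic factors. *)
Let LLl : L * (L * l) <= 7 * q.
Proof.
rewrite -(leq_exp2r _ _ (isT : 0 < 2)).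
have h := leq_trans (quartic_leq_exp L1) (leq_mul (leqnn 41) qL1).
have := leq_mul h lq1; move: (L) (q) => x y; rewrite !expnS !expn0 !muln1; nia.
Qed.

Let L_q : L <= q.
Proof. by apply: leq_trans qL1; rewrite -{1}(prednK L1); apply: ltn_expl. Qed.

Lemma decide_runs : exists n s (ans : bool),
  [/\ exec le b c M W decide (init_state 24 F) n s, preg s (reg 0) = ans,
      ans <-> dynamically_irreducible (fun i => quadratic (b i) (c i)) &
      n <= 150 * 1000 * (r * (L * L * L * l))].
Proof.
have lenq : 2 ^ L <= 2 * q by rewrite -(prednK L1) expnS leq_mul2l /= qL1.
have MW : M <= W by move: LLl L_q q3; move: (L * (L * l)) => x; lia.
have qW : 4 * q + 8 < W by lia.
have rW : r.+1 < W by lia.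
(* [L <= 2 ^ L] and [l <= 2 ^ L] give [cap.+1 <= 2 ^ (3 * L + 8)], hence the value of [D]. *)
have capD v : 2 ^ v <= cap.+1 -> 2 * v <= D.
  move=> hv; suff : v <= 3 * L + 8 by lia.
  rewrite -(leq_exp2l _ _ (isT : 1 < 2)); apply: leq_trans hv _.
  have e : 2 ^ (3 * L + 8) = 256 * (2 ^ L * (2 ^ L * 2 ^ L)).
    by rewrite (_ : 3 * L + 8 = 8 + (L + (L + L))) ?expnD //; move: (L) => x; lia.
  have h1 : L * (L * l) <= 2 ^ L * (2 ^ L * 2 ^ L).
    have lL : L <= 2 ^ L by apply: ltnW; apply: ltn_expl.
    apply: leq_mul => //; apply: leq_mul => //.
    apply: leq_trans (ltnW qL); apply: leq_trans lq1; exact: leq_pmulr.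
  have h2 : 0 < 2 ^ L * (2 ^ L * 2 ^ L) by rewrite !muln_gt0 expn_gt0.
  by rewrite e; move: h1 h2; move: (2 ^ L * _) (L * _) => x y; lia.
have oc : dynamically_irreducible (fun i => quadratic (b i) (c i)) ->
    forall A : {set F}, (forall u, u \in A -> reachable b c u) -> #|A| <= cap.
  move=> di A hA.
  pose i0 := Ordinal (ltnW r2); pose i1 := Ordinal r2.
  have neq : quadratic (b i0) (c i0) != quadratic (b i1) (c i1).
    by apply/eqP => /inj /(congr1 val).
  have L2 : 1 < L by rewrite ltnNge; apply/negP => h; move: qL; rewrite (_ : L = 1); lia.
  have := orbit_bound oF neq di (ltnW qL) L2 lq1 lq2 hA.
  have : 0 < L * (L * l) by rewrite !muln_gt0 L1 l1.
  rewrite -mulnA; move: (L * (L * l)) => x; lia.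
have qW' : 4 * q < W by lia.
have LM2 : LIM + L + 2 < M by lia.
have LMD : LIM + L + 2 * D + 2 < M by lia.
have r0 : 0 < r by lia.
pose N := 9 + ((3 * L + 2) + ((4 * l + 3) + ((6 * L + 16) + ((4 * L + 6) +
  (search_cost r L cap D + 0))))).
have [n [s [nN e [a [e1 e2]]]]] : runs le b c M W decide (init_state 24 F) N (fun st =>
    exists a : bool, preg st (reg 0) = a /\
      (a <-> dynamically_irreducible (fun i => quadratic (b i) (c i)))).
  rewrite /N /decide -[init_state 24 F]/(mkst (fun=> 0%R) (fun=> 0) (fun=> inr 0)).
  have capE : cap = 128 * (L * (L * l)) by [].
  have LIM_cap : LIM = 4 * cap.+1 by [].
  apply: runs_cons.
  apply: (runs_weaken (consts_spec le b c L1 qL qL1 lq1 lq2 MW qW rW LIM_cap capE LM2 _)) => //.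
  move=> _ [f [p [-> B p6 p7]]]; apply: runs_cons.
  apply: (runs_weaken (log_spec le b c L1 qL qL1 lq1 lq2 MW qW rW LIM_cap capE LM2 _ B p6)) => //.
  move=> _ [p1 [-> ep1 p16]]; have B1 := base_eqx (X := [:: 6; 16]) isT ep1 B.
  have p17 : p1 7 = 0 by rewrite ep1.
  apply: runs_cons.
  apply: (runs_weaken (sqrt_spec le b c L1 qL qL1 lq1 lq2 MW qW rW LIM_cap capE LM2 _ B1 p17)) => //.
  move=> _ [p2 [-> ep2 p27]]; have B2 := base_eqx (X := [:: 7; 16; 17]) isT ep2 B1.
  have p26 : p2 6 = L by rewrite ep2.
  apply: runs_cons.
  apply: (runs_weaken (lim_spec le b c L1 qL qL1 lq1 lq2 MW qW rW LIM_cap capE LM2 _ B2 p26 p27)) => //.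
  move=> _ [p3 [-> ep3 p38]]; have B3 := base_eqx (X := [:: 8; 16; 17; 18]) isT ep3 B2.
  apply: runs_cons.
  apply: (runs_weaken (table_spec le b c L1 qL qL1 lq1 lq2 MW qW rW LIM_cap capE LM2 B3 p38 _)) => //.
  move=> _ [p4 [m4 [-> G]]]; apply: runs_cons.
  apply: (runs_weaken (search_spec letot leasym letr oF r0 L1 qL lenq MW qW' rW LIM_cap LMD capD oc G)) => //.
  by move=> st h; apply: runs_nil.
exists n, s, a; split=> //; apply: leq_trans nN _.
(* The left-hand side is [295 * L + 805], and [L >= 1]. *)
have hb : (body_cost L D).+1 <= 1100 * L by rewrite /body_cost; lia.
have h1 : r * (body_cost L D).+1 <= 1100 * (r * L).
  by rewrite mulnCA leq_mul2l hb orbT.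
have h2 : cap * (node_cost r L D).+1 <= 128 * 1106 * (r * (L * L * L * l)).
  have h3 : (node_cost r L D).+1 <= 1106 * (r * L).
    have : 0 < r * L by rewrite muln_gt0 r0.
    by rewrite /node_cost; move: h1; move: (r * L) (r * _) => x y; lia.
  apply: leq_trans (leq_mul (leqnn _) h3) _.
  have assoc u v : u * (L * (L * l)) * (v * (r * L)) = u * v * (r * (L * L * L * l)) by ring.
  by rewrite assoc.
have h4 : r * L <= r * (L * L * L * l).
  by rewrite leq_mul2l -!mulnA leq_pmulr ?orbT // !muln_gt0 L1 l1.
have h5 : L <= r * L by rewrite leq_pmull.
have h6 : l <= r * (L * L * L * l) by rewrite mulnA leq_pmull // !muln_gt0 r0 L1.
have h7 : 0 < r * L by rewrite muln_gt0 r0.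
rewrite /N /search_cost addn0.
move: h1 h2 h4 h5 h6 h7; move: (r * (L * L * L * l)) (r * L) (r * _) (cap * _) => x y z w; lia.
Qed.

End Decide.

Local Open Scope ring_scope.

(** The factor 2 absorbs the successor, since [ln 2 <= ln n]. *)
Lemma trunc_log_le_ln (R : realType) (n : nat) : (1 < n)%N ->
  ((trunc_log 2 n).+1%:R : R) <= 2 / ln 2 * ln n%:R.
Proof.
move=> n1.
have ln2 : (0 : R) < ln 2 by rewrite ln_gt0 // ltr1n.
have h1 : (trunc_log 2 n)%:R * ln 2 <= ln n%:R :> R.
  rewrite mulr_natl -lnXn ?ltr0n // -natrX ler_ln ?posrE ?ltr0n ?expn_gt0 //; last by lia.
  by rewrite ler_nat trunc_logP //; lia.
have h2 : ln 2 <= ln n%:R :> R by rewrite ler_ln ?posrE ?ltr0n ?ler_nat //; lia.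
rewrite mulrAC ler_pdivlMr // -natr1 mulrDl mul1r.
by rewrite [X in _ <= X]mulr_natl mulr2n lerD.
Qed.

Theorem corollary3 :
  exists (k : nat) (P : prog k.+1) (K : nat),
  forall R : realType,
  exists C1 C2 : R,
  forall (F : finFieldType) (p : nat),
    p \in [pchar F] -> odd p ->
  forall le : rel F,
    total le -> antisymmetric le -> transitive le ->
  forall (r : nat) (f : 'I_r -> {poly F}) (b c : 'I_r -> F),
    (2 <= r)%N ->
    injective f ->
    (forall i, f i \is monic /\ size (f i) = 3%N) ->
    (forall i, f i = quadratic (b i) (c i)) ->
  exists n m : nat,
    [/\ decides_with P le b c (K * (#|F| + r)) (dynamically_irreducible f) n m,
        n%:R <= C1 * (r%:R * ln (#|F|%:R : R) ^+ 3 * Num.sqrt #|F|%:R)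
      & m%:R <= C2 * (ln (#|F|%:R : R) ^+ 2 * Num.sqrt #|F|%:R)].
Proof.
(* There are 24 registers of each sort; 4000 covers the memory size, at most [512 * 7 * q] plus
   lower terms. The powers of [2 / ln 2] in the constants below convert the bit length of [q] into
   [ln q]. *)
exists 23%N, decide, 4000%N => R.
exists ((150 * 1000)%N%:R * (2 / ln 2) ^+ 3), (1000%:R * (2 / ln 2) ^+ 2).
move=> F p pF op le letot leasym letr r f b c r2 finj _ fE.
have {fE} fE : f = fun i => quadratic (b i) (c i) by apply/funext.
rewrite {}fE in finj *.
have oF : odd #|F|.
  have := pprimeChar_pgroup pF; rewrite /pgroup cardsT => /p_natP[n ->].
  by rewrite oddX op orbT.
have q1 : (1 < #|F|)%N := finNzRing_gt1 F.
have [l [lq1 lq2]] := exists_isqrt #|F|.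
have l1 : (0 < l)%N by rewrite lt0n; apply/eqP => l0; move: lq2 q1; rewrite l0; lia.
have [L [L0 qL1 qL hL]] : exists L, [/\ (0 < L)%N, (2 ^ L.-1 <= #|F|)%N, (#|F| < 2 ^ L)%N &
    L%:R <= 2 / ln 2 * ln #|F|%:R :> R].
  exists (trunc_log 2 #|F|).+1; split=> //; last exact: trunc_log_le_ln.
    by apply: trunc_logP => //; lia.
  exact: trunc_log_ltn.
have [n [s [a [he ha hd hn]]]] := decide_runs letot leasym letr oF r2 L0 qL1 qL lq1 lq2 finj.
have hl : l%:R <= Num.sqrt #|F|%:R :> R.
  rewrite -(ler_pXn2r (n := 2)) ?nnegrE ?sqrtr_ge0 ?ler0n // sqr_sqrtr ?ler0n //.
  by rewrite -natrX ler_nat expnS expn1.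
set M := (X in exec _ _ _ X) in he.
exists n, (24 + 24 + M)%N; split.
- exists M, s, a; split=> //; rewrite -ha; congr (preg s _).
  by apply/val_inj; rewrite /= inordK.
- apply: (@le_trans _ _ ((150 * 1000)%N%:R * (r%:R * (L%:R ^+ 3 * l%:R)))).
    rewrite -natrX -!natrM ler_nat; apply: leq_trans hn _.
    by rewrite !expnS expn0 muln1 !mulnA.
  rewrite [leRHS](_ : _ = (150 * 1000)%N%:R *
      (r%:R * ((2 / ln 2 * ln #|F|%:R) ^+ 3 * Num.sqrt #|F|%:R))); last first.
    by move: ((150 * 1000)%N) (2 / ln 2 : R) (Num.sqrt _) => u t y; move: (ln _) => x; ring.
  rewrite !ler_wpM2l ?ler0n //; apply: ler_pM; rewrite ?exprn_ge0 ?ler0n //.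
  by apply: lerXn2r; rewrite ?nnegrE ?ler0n //; apply: le_trans hL; rewrite ler0n.
apply: (@le_trans _ _ (1000%:R * (L%:R ^+ 2 * l%:R))).
  rewrite -natrX -!natrM ler_nat /M expnS expn1.
  have h1 : (L <= L * L * l)%N by rewrite -mulnA leq_pmulr // muln_gt0 L0 l1.
  rewrite /M (mulnA L L l); clear -h1 L0; move: (L * L * l)%N h1 => x h1; lia.
rewrite [leRHS](_ : _ = 1000%:R *
    ((2 / ln 2 * ln #|F|%:R) ^+ 2 * Num.sqrt #|F|%:R)); last first.
  by move: 1000%N (2 / ln 2 : R) (Num.sqrt _) => u t y; move: (ln _) => x; ring.
rewrite ler_wpM2l ?ler0n //; apply: ler_pM; rewrite ?exprn_ge0 ?ler0n //.
by apply: lerXn2r; rewrite ?nnegrE ?ler0n //; apply: le_trans hL; rewrite ler0n.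
Qed.
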